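(* Let $f,g$ be regular functions on a symmetric slice domain $\Omega\subseteq\mathbb{H}$, with $f\not\equiv0$, and consider the quotient $f^{-*}*g:\Omega\setminus Z_{f^s}\to\mathbb{H}$, where $Z_{f^s}$ is the zero set of $f^s$. Each $p\in Z_{f^s}$ is a pole for $f^{-*}*g$, of order $$\mathrm{ord}_{f^{-*}*g}(p)\le m_{f^s}(p),$$ where $m_{f^s}(p)$ denotes the classical multiplicity of $p$ as a zero of $f^s$. As a consequence, $f^{-*}*g$ is semiregular in $\Omega$.
   Context: $\mathbb{H}$ denotes the quaternions, $\mathbb{S}=\{q\in\mathbb{H}:q^2=-1\}$, and $x+y\mathbb{S}=\{x+Jy:J\in\mathbb{S}\}$. For $\Omega\subseteq\mathbb{H}$ and $I\in\mathbb{S}$ put $\Omega_I=\Omega\cap(\mathbb{R}+I\mathbb{R})$ and $f_I=f|_{\Omega_I}$. A function $f_I$ is holomorphic if it has continuous partial derivatives and $\frac12\left(\frac{\partial}{\partial x}+I\frac{\partial}{\partial y}\right)f_I(x+Iy)\equiv0$; a function $f:\Omega\to\mathbb{H}$ on an open set is regular if $f_I$ is holomorphic for all $I\in\mathbb{S}$. A set is symmetric if together with each $x+Iy$ it contains $x+y\mathbb{S}$. A domain (connected open set) $\Omega$ is a slice domain if it meets the real axis and every $\Omega_I$ is a domain in $\mathbb{R}+I\mathbb{R}$. On a symmetric slice domain $\Omega$, every holomorphic $\phi:\Omega_I\to\mathbb{H}$ has a unique regular extension $\mathrm{ext}(\phi)$ to $\Omega$. For $f,g$ regular on $\Omega$ and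 $I\perp J$ in $\mathbb{S}$, write $f_I=F+GJ$, $g_I=H+KJ$ with $F,G,H,K:\Omega_I\to\mathbb{R}+I\mathbb{R}$ holomorphic; then (independently of $I,J$) $$f*g=\mathrm{ext}\left(\left[F(z)H(z)-G(z)\overline{K(\bar z)}\right]+\left[F(z)K(z)+G(z)\overline{H(\bar z)}\right]J\right),\qquad f^c=\mathrm{ext}\left(\overline{F(\bar z)}-G(z)J\right),$$ and $f^s=f*f^c=f^c*f$. If $f\not\equiv0$, $f^{-*}=\frac1{f^s}f^c$, a regular function on the symmetric slice domain $\Omega\setminus Z_{f^s}$. $(q-p)^{*n}$ denotes the $n$-th $*$-power of $q\mapsto q-p$, and for $m\in\mathbb{N}$, $(q-p)^{*(-m)}$ is the regular reciprocal of $(q-p)^{*m}$. The classical multiplicity $m_f(p)$ is the largest $n\in\mathbb{N}$ such that $f(q)=(q-p)^{*n}*g(q)$ for some regular $g:\Omega\to\mathbb{H}$. Singularities. Put $\sigma(q,p)=\tau(q,p)=|q-p|$ if $p,q$ lie on a common complex line $\mathbb{R}+I\mathbb{R}$, and otherwise $\sigma(q,p)=\sqrt{(\mathrm{Re}\,q-\mathrm{Re}\,p)^2+(|\mathrm{Im}\,q|+|\mathrm{Im}\,p|)^2}$, $\tau(q,p)=\sqrt{(\mathrm{Re}\,q-\mathrm{Re}\,p)^2+(|\mathrm{Im}\,q|-|\mathrm{Im}\,p|)^2}$. Let $\Sigma(p,0,R)=\{q:\tau(q,p)>0,\ \sigma(q,p)<R\}$. If $f$ is regular on a symmetric slice domain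 $\Omega'$, a point $p\in\mathbb{H}$ is a singularity for $f$ if $\Sigma(p,0,R)\subseteq\Omega'$ for some $R>0$; then $f(q)=\sum_{n\in\mathbb{Z}}(q-p)^{*n}a_n$ in $\Sigma(p,0,R)$, whose restriction to the complex line $\mathbb{R}+I\mathbb{R}$ through $p$ is the Laurent expansion $f_I(z)=\sum_{n\in\mathbb{Z}}(z-p)^na_n$ in $0<|z-p|<R$. The point $p$ is a pole if there is $m\ge0$ with $a_{-k}=0$ for all $k>m$; the least such $m$ is $\mathrm{ord}_f(p)$ (order $0$ is allowed). It is removable if $f$ extends to a neighborhood of $p$ as a regular function. A function is semiregular in a symmetric slice domain $\Omega$ if it is regular in a symmetric slice domain $\Omega'\subseteq\Omega$ such that every point of $\Omega\setminus\Omega'$ is a pole or a removable singularity for it. *)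

(* Defs.v *)
From HB Require Import structures.
From mathcomp Require Import all_boot all_order all_algebra.
From mathcomp Require Import ring lra.
From mathcomp Require Import all_classical all_reals all_analysis.

Set Implicit Arguments.
Unset Strict Implicit.
Unset Printing Implicit Defensive.

Import Order.TTheory GRing.Theory Num.Theory.
Import numFieldNormedType.Exports.

Local Open Scope classical_set_scope.
Local Open Scope ring_scope.

(* The row (a, b, c, d) is a + b i + c j + d k.  The normed module structure
   is that of row vectors: it induces the usual topology, but `|q| is the sup
   norm; the Euclidean norm is qnorm below. *)
Definition quat (R : realType) : Type := 'rV[R]_4.

Section QuaternionAlgebra.
Variable R : realType.
Local Notation H := (quat R).

HB.instance Definition _ := NormedModule.copy H 'rV[R]_4.
HB.instance Definition _ := Complete.copy H 'rV[R]_4.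

Definition mkquat (a b c d : R) : H := \row_(i < 4) nth 0 [:: a; b; c; d] i.

Definition qcoord (k : nat) (q : H) : R := (q : 'rV[R]_4) 0 (inord k).
Local Notation q0 := (qcoord 0).
Local Notation q1 := (qcoord 1).
Local Notation q2 := (qcoord 2).
Local Notation q3 := (qcoord 3).

Definition qre (q : H) : R := q0 q.
Definition qim (q : H) : H := mkquat 0 (q1 q) (q2 q) (q3 q).
Definition qone : H := mkquat 1 0 0 0.

Definition qmul (p q : H) : H := mkquat
  (q0 p * q0 q - q1 p * q1 q - q2 p * q2 q - q3 p * q3 q)
  (q0 p * q1 q + q1 p * q0 q + q2 p * q3 q - q3 p * q2 q)
  (q0 p * q2 q - q1 p * q3 q + q2 p * q0 q + q3 p * q1 q)
  (q0 p * q3 q + q1 p * q2 q - q2 p * q1 q + q3 p * q0 q).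

Definition qconj (q : H) : H := mkquat (q0 q) (- q1 q) (- q2 q) (- q3 q).

Definition qdot (p q : H) : R :=
  q0 p * q0 q + q1 p * q1 q + q2 p * q2 q + q3 p * q3 q.

Definition qnorm (q : H) : R := Num.sqrt (qdot q q).

Definition qinv (q : H) : H := (qdot q q)^-1 *: qconj q.

Lemma quatP (p q : H) :
  [/\ q0 p = q0 q, q1 p = q1 q, q2 p = q2 q & q3 p = q3 q] -> p = q.
Proof.
move=> [h0 h1 h2 h3]; apply/rowP => i; rewrite -[i]inord_val.
by case: i => -[|[|[|[|]]]] //=.
Qed.

Lemma qcoord_mk (a b c d : R) k : (k < 4)%N ->
  qcoord k (mkquat a b c d) = nth 0 [:: a; b; c; d] k.
Proof. by move=> k4; rewrite /qcoord mxE inordK. Qed.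

Lemma qcoordD k (p q : H) : qcoord k (p + q) = qcoord k p + qcoord k q.
Proof. exact: mxE. Qed.

Lemma qcoordN k (p : H) : qcoord k (- p) = - qcoord k p.
Proof. exact: mxE. Qed.

Lemma qcoordZ k (x : R) (p : H) : qcoord k (x *: p) = x * qcoord k p.
Proof. exact: mxE. Qed.

Lemma qcoord0 k : qcoord k 0 = 0.
Proof. exact: mxE. Qed.

Definition qcoordE := (qcoordD, qcoordN, qcoordZ, qcoord0).

Lemma qcoord_mul (p q : H) :
  (q0 (qmul p q) = q0 p * q0 q - q1 p * q1 q - q2 p * q2 q - q3 p * q3 q) *
  (q1 (qmul p q) = q0 p * q1 q + q1 p * q0 q + q2 p * q3 q - q3 p * q2 q) *
  (q2 (qmul p q) = q0 p * q2 q - q1 p * q3 q + q2 p * q0 q + q3 p * q1 q) *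
  (q3 (qmul p q) = q0 p * q3 q + q1 p * q2 q - q2 p * q1 q + q3 p * q0 q).
Proof. by do !split; rewrite /qmul qcoord_mk. Qed.

Lemma qcoord_one :
  (q0 qone = 1) * (q1 qone = 0) * (q2 qone = 0) * (q3 qone = 0).
Proof. by do !split; rewrite /qone qcoord_mk. Qed.

Lemma qcoord_conj (q : H) :
  (q0 (qconj q) = q0 q) * (q1 (qconj q) = - q1 q) *
  (q2 (qconj q) = - q2 q) * (q3 (qconj q) = - q3 q).
Proof. by do !split; rewrite /qconj qcoord_mk. Qed.

Lemma qmulA : associative qmul.
Proof. by move=> p q r; apply: quatP; rewrite !qcoord_mul; split; ring. Qed.

Lemma qmul1q : left_id qone qmul.
Proof.
by move=> p; apply: quatP; rewrite !qcoord_mul !qcoord_one; split; ring.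
Qed.

Lemma qmulq1 : right_id qone qmul.
Proof.
by move=> p; apply: quatP; rewrite !qcoord_mul !qcoord_one; split; ring.
Qed.

Lemma qmulDl : left_distributive qmul +%R.
Proof.
by move=> p q r; apply: quatP; rewrite !(qcoord_mul, qcoordE); split; ring.
Qed.

Lemma qmulDr : right_distributive qmul +%R.
Proof.
by move=> p q r; apply: quatP; rewrite !(qcoord_mul, qcoordE); split; ring.
Qed.

Lemma qone_neq0 : qone != 0.
Proof.
apply/eqP => /(congr1 (qcoord 0)) /eqP.
by rewrite qcoord_one qcoord0 oner_eq0.
Qed.

HB.instance Definition _ := GRing.Zmodule_isNzRing.Build H
  qmulA qmul1q qmulq1 qmulDl qmulDr qone_neq0.

Lemma qcoord1 :
  (q0 (1 : H) = 1) * (q1 (1 : H) = 0) * (q2 (1 : H) = 0) * (q3 (1 : H) = 0).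
Proof. exact: qcoord_one. Qed.

Lemma qcoordM (p q : H) :
  (q0 (p * q) = q0 p * q0 q - q1 p * q1 q - q2 p * q2 q - q3 p * q3 q) *
  (q1 (p * q) = q0 p * q1 q + q1 p * q0 q + q2 p * q3 q - q3 p * q2 q) *
  (q2 (p * q) = q0 p * q2 q - q1 p * q3 q + q2 p * q0 q + q3 p * q1 q) *
  (q3 (p * q) = q0 p * q3 q + q1 p * q2 q - q2 p * q1 q + q3 p * q0 q).
Proof. exact: qcoord_mul. Qed.

Lemma qscaleAl (x : R) (p q : H) : x *: (p * q : H) = (x *: p : H) * q.
Proof.
by apply: quatP; rewrite !(qcoordM, qcoordE); split; ring.
Qed.

HB.instance Definition _ := GRing.Lmodule_isLalgebra.Build R H qscaleAl.

Lemma qscaleAr (x : R) (p q : H) : x *: (p * q : H) = p * (x *: q : H).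
Proof.
by apply: quatP; rewrite !(qcoordM, qcoordE); split; ring.
Qed.

HB.instance Definition _ := GRing.Lalgebra_isAlgebra.Build R H qscaleAr.

Lemma qdot_eq0 (q : H) : (qdot q q == 0) = (q == 0).
Proof.
apply/eqP/eqP => [|->]; last by rewrite /qdot !qcoord0 !mulr0 !addr0.
rewrite /qdot -!expr2 => h; have := (sqr_ge0 (q0 q), sqr_ge0 (q1 q)).
have := (sqr_ge0 (q2 q), sqr_ge0 (q3 q)) => -[h2 h3] [h0 h1].
apply: quatP; rewrite !qcoord0.
by split; apply/eqP; rewrite -sqrf_eq0; apply/eqP; lra.
Qed.

Lemma qmul_conj (q : H) : q * qconj q = qdot q q *: 1.
Proof.
apply: quatP; rewrite !(qcoordM, qcoordE, qcoord1, qcoord_conj) /qdot.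
by split; ring.
Qed.

Lemma qconj_mul (q : H) : qconj q * q = qdot q q *: 1.
Proof.
apply: quatP; rewrite !(qcoordM, qcoordE, qcoord1, qcoord_conj) /qdot.
by split; ring.
Qed.

Lemma qmulVq : {in [pred q : H | q != 0], left_inverse 1 qinv *%R}.
Proof.
move=> q; rewrite inE -qdot_eq0 => q_neq0.
by rewrite /qinv -scalerAl qconj_mul scalerA mulVf ?scale1r.
Qed.

Lemma qmulqV : {in [pred q : H | q != 0], right_inverse 1 qinv *%R}.
Proof.
move=> q; rewrite inE -qdot_eq0 => q_neq0.
by rewrite /qinv -scalerAr qmul_conj scalerA mulVf ?scale1r.
Qed.

Lemma qunitP (p q : H) : q * p = 1 /\ p * q = 1 -> [pred q : H | q != 0] p.
Proof.
case=> + _ /=; apply: contra_eq_neq => ->.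
by rewrite mulr0 eq_sym oner_neq0.
Qed.

Lemma qinv_out : {in [predC [pred q : H | q != 0]], qinv =1 id}.
Proof.
move=> q; rewrite !inE negbK => /eqP ->.
by rewrite /qinv /qdot !qcoord0 !mulr0 !addr0 invr0 scale0r.
Qed.

HB.instance Definition _ := GRing.NzRing_hasMulInverse.Build H
  qmulVq qmulqV qunitP qinv_out.

End QuaternionAlgebra.

Section SliceRegularity.
Variable R : realType.
Local Notation H := (quat R).
Implicit Types (W D : set H) (f g h : H -> H) (I J p q : H) (m n : nat).

Definition imag_units : set H := [set I | I * I = -1].

Definition cline I : set H := [set q | exists x y : R, q = x%:A + y *: I].

Definition symmetric_set W := forall (x y : R) I J,
  imag_units I -> imag_units J -> W (x%:A + y *: I) -> W (x%:A + y *: J).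

(* W `&` cline I is relatively open in cline I as soon as W is open, and
   nonempty as soon as W meets the real axis. *)
Definition slice_domain W :=
  [/\ open W, connected W, exists x : R, W x%:A &
      forall I, imag_units I -> connected (W `&` cline I)].

Definition symmetric_slice_domain W := symmetric_set W /\ slice_domain W.

(* The derivatives of f at z along 1 and I only involve the values of f on
   the line through z parallel to these directions: when z lies in cline I
   they are the partial derivatives in x and y of f_I (x + I y). *)
Definition slice_holomorphic I D f :=
  [/\ forall z, D z -> derivable f z 1 /\ derivable f z I,
      {within D, continuous (fun z => 'D_1 f z)},
      {within D, continuous (fun z => 'D_I f z)} &
      forall z, D z -> 2^-1 *: ('D_1 f z + I * 'D_I f z) = 0].

Definition regular W f :=
  forall I, imag_units I -> slice_holomorphic I (W `&` cline I) f.

Definition zeros W f : set H := [set q | W q /\ f q = 0].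

Definition is_ext W I (phi h : H -> H) :=
  regular W h /\ forall z, (W `&` cline I) z -> h z = phi z.

Definition splitting W I J f (F G : H -> H) :=
  forall z, (W `&` cline I) z ->
    [/\ cline I (F z), cline I (G z) & f z = F z + G z * J].

(* The regular product and conjugate do not depend on the orthogonal units
   I, J: they are the function that extends the given expression for every
   choice of I and J.  Functions on W are total functions whose values
   outside W are irrelevant. *)
Definition is_star W f g h := forall I J (F G K L : H -> H),
  imag_units I -> imag_units J -> qdot I J = 0 ->
  splitting W I J f F G -> splitting W I J g K L ->
  is_ext W I (fun z =>
    (F z * K z - G z * qconj (L (qconj z)))
    + (F z * L z + G z * qconj (K (qconj z))) * J) h.

Definition star W f g : H -> H := xget (cst 0) [set h | is_star W f g h].

Definition is_regconj W f h := forall I J (F G : H -> H),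
  imag_units I -> imag_units J -> qdot I J = 0 ->
  splitting W I J f F G ->
  is_ext W I (fun z => qconj (F (qconj z)) - G z * J) h.

Definition regconj W f : H -> H := xget (cst 0) [set h | is_regconj W f h].

Definition symmetrization W f := star W f (regconj W f).

(* Meaningful on W `\` zeros W (symmetrization W f). *)
Definition regrecip W f : H -> H :=
  fun q => (symmetrization W f q)^-1 * regconj W f q.

Definition star_pow W f n : H -> H := iter n (star W f) (cst 1).

Definition lin_pow p (k : int) : H -> H :=
  match k with
  | Posz n => star_pow setT (fun q => q - p) n
  | Negz n => regrecip setT (star_pow setT (fun q => q - p) n.+1)
  end.

Definition greatest (P : set nat) n := P n /\ forall k, P k -> (k <= n)%N.
Definition least (P : set nat) n := P n /\ forall k, P k -> (n <= k)%N.

Definition classical_mult W f p : nat := xget 0%N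
  (greatest [set n | exists2 g, regular W g &
     forall q, W q -> f q = star W (lin_pow p n) g q]).

Definition common_cline p q :=
  exists I, [/\ imag_units I, cline I p & cline I q].

Definition sigma_dist q p : R :=
  if `[< common_cline p q >] then qnorm (q - p)
  else Num.sqrt ((qre q - qre p) ^+ 2 + (qnorm (qim q) + qnorm (qim p)) ^+ 2).

Definition tau_dist q p : R :=
  if `[< common_cline p q >] then qnorm (q - p)
  else Num.sqrt ((qre q - qre p) ^+ 2 + (qnorm (qim q) - qnorm (qim p)) ^+ 2).

Definition punctured_sigma_ball p (r : R) : set H :=
  [set q | 0 < tau_dist q p /\ sigma_dist q p < r].

Definition singularity W p :=
  exists2 r : R, 0 < r & punctured_sigma_ball p r `<=` W.

(* The radius is existentially quantified: the coefficients do not depend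
   on it, whereas for p not real and r > 2 |Im p| the set
   punctured_sigma_ball p r contains the conjugate of p, at which
   (q - p)^{*(-m)} is not defined. *)
Definition laurent W f p (a : int -> H) :=
  exists r : R, [/\ 0 < r, punctured_sigma_ball p r `<=` W &
    forall q, punctured_sigma_ball p r q -> exists s t : H,
      [/\ series (fun n => lin_pow p n%:Z q * a n%:Z) @ \oo --> s,
          series (fun n => lin_pow p (- n.+1%:Z) q * a (- n.+1%:Z)) @ \oo --> t
        & f q = s + t]].

Definition principal_bound (a : int -> H) : set nat :=
  [set m | forall k, (m < k)%N -> a (- k%:Z) = 0].

Definition pole W f p :=
  exists2 a, laurent W f p a & exists m, principal_bound a m.

Definition pole_order W f p : nat := xget 0%N
  [set m | exists2 a, laurent W f p a & least (principal_bound a) m].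

Definition removable W f p := singularity W p /\
  exists U h, [/\ open U, U p, regular U h &
                  forall q, (U `&` W) q -> h q = f q].

(* f is a function with domain D, seen as semiregular in W. *)
Definition semiregular W D f :=
  [/\ symmetric_slice_domain W, symmetric_slice_domain D, D `<=` W,
      regular D f &
      forall p, (W `\` D) p -> pole D f p \/ removable D f p].

End SliceRegularity.

(* Main.v *)
Require Import Defs.
From mathcomp Require Import all_boot all_order all_algebra.
From mathcomp Require Import ring lra.
From mathcomp Require Import all_classical all_reals all_analysis.

Set Implicit Arguments.
Unset Strict Implicit.
Unset Printing Implicit Defensive.

Import Order.TTheory GRing.Theory Num.Theory.
Import numFieldNormedType.Exports.

Local Open Scope classical_set_scope.
Local Open Scope ring_scope.

(* On every slice, f^s takes values in the slice and f^{-*} * g equals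
   (f^s)^{-1} (f^c * g). On the real axis f^s = |f|^2, so by the identity
   principle f^s vanishes identically on no slice: at a zero p it is (z - p)^m
   u(z) with u(p) <> 0, and the quotient is (z - p)^{-m} times the holomorphic
   function u^{-1} (f^c * g), whose Taylor expansion gives the Laurent
   expansion. By the representation formula the norm of f^s does not depend on
   the slice, so f^s vanishes to order m along the whole sphere through p and
   is divisible there by the m-th power of the quadratic polynomial (q - p) *
   (q - \bar p), or by (q - p)^m if p is real; hence (q - p)^{*m} divides f^s
   and m is at most the classical multiplicity. The same formula shows that the
   zeros of f^s form spheres, isolated on every slice, so that removing them
   leaves a symmetric slice domain.

   Local complex analysis is done on the slices without integrals: averaging f
   against a truncated Cauchy kernel over the n-th roots of unity gives
   polynomials that converge to f, and a limit of their coefficients along an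
   ultrafilter yields the Taylor series. *)

(** * The multiplicative norm and the slices *)

(** [star], [regconj], [classical_mult] and [pole_order] select a value by [xget], about which
    nothing is known until some witness exists. This shapes the proof in three places. Explicit
    pointwise formulas are shown to satisfy the defining properties of the regular product and
    conjugate. The vanishing order m is shown to be the largest exponent that divides f^s, so that
    the multiplicity is attained. The order of the pole is bounded for every Laurent expansion at p,
    by the boundedness of (z - p)^m times the quotient, which makes uniqueness of the coefficients
    unnecessary.

    The main obstacle is that m is read off on one slice, while divisibility by (q - p)^{*m} is a
    statement on the whole domain, and for p not real this power is an ordinary power only on the
    slice of p. The quadratic polynomial removes it: having real coefficients, it preserves every
    slice, its powers are pointwise powers, and they pass freely through regular products. Division
    by it needs only the vanishing order on each slice, and this order is detected by norms alone,
    which is the information that f^s carries from one slice to another. *)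

Section Norm.
Variable R : realType.
Local Notation H := (quat R).
Local Notation q0 := (qcoord 0).
Local Notation q1 := (qcoord 1).
Local Notation q2 := (qcoord 2).
Local Notation q3 := (qcoord 3).
Local Notation N := (@qnorm R).
Implicit Types (p q r z w I J : H).

Lemma qdot_ge0 q : 0 <= qdot q q.
Proof. by rewrite /qdot -!expr2 !addr_ge0 ?sqr_ge0. Qed.

Lemma qnorm_ge0 q : 0 <= N q.
Proof. exact: sqrtr_ge0. Qed.

Lemma sqr_qnorm q : N q ^+ 2 = qdot q q.
Proof. by rewrite sqr_sqrtr ?qdot_ge0. Qed.

Lemma qnormM p q : N (p * q) = N p * N q.
Proof.
rewrite /qnorm -sqrtrM ?qdot_ge0//; congr Num.sqrt.
by rewrite /qdot !qcoordM; ring.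
Qed.

Lemma qnorm0 : N 0 = 0.
Proof. by rewrite /qnorm /qdot !qcoord0 !mulr0 !addr0 sqrtr0. Qed.

Lemma qnorm1 : N 1 = 1.
Proof. by rewrite /qnorm /qdot !qcoord1 !mulr0 !addr0 mulr1 sqrtr1. Qed.

Lemma qnorm_eq0 q : (N q == 0) = (q == 0).
Proof. by rewrite /qnorm sqrtr_eq0 -qdot_eq0 eq_le qdot_ge0 andbT. Qed.

Lemma qnorm_gt0 q : (0 < N q) = (q != 0).
Proof. by rewrite lt_neqAle qnorm_ge0 andbT eq_sym qnorm_eq0. Qed.

Lemma qnormZ (x : R) q : N (x *: q) = `|x| * N q.
Proof.
rewrite /qnorm -sqrtr_sqr -sqrtrM ?sqr_ge0//; congr Num.sqrt.
by rewrite /qdot !qcoordE; ring.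
Qed.

Lemma qnormN q : N (- q) = N q.
Proof. by rewrite -scaleN1r qnormZ normrN1 mul1r. Qed.

Lemma qnorm_conj q : N (qconj q) = N q.
Proof. by rewrite /qnorm /qdot !qcoord_conj !mulrNN. Qed.

Lemma qdot_le p q : qdot p q <= N p * N q.
Proof.
apply: le_trans (ler_norm _) _.
rewrite -(ler_sqr (normr_nneg _)) ?nnegrE ?mulr_ge0 ?qnorm_ge0//.
rewrite real_normK ?num_real// exprMn !sqr_qnorm -subr_ge0.
(* Lagrange's identity writes the defect in the Cauchy-Schwarz inequality as a sum of squares. *)
have -> : qdot p p * qdot q q - qdot p q ^+ 2 =
    (q0 p * q1 q - q1 p * q0 q) ^+ 2 + (q0 p * q2 q - q2 p * q0 q) ^+ 2 +
    (q0 p * q3 q - q3 p * q0 q) ^+ 2 + (q1 p * q2 q - q2 p * q1 q) ^+ 2 +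
    (q1 p * q3 q - q3 p * q1 q) ^+ 2 + (q2 p * q3 q - q3 p * q2 q) ^+ 2.
  by rewrite /qdot; ring.
by rewrite !addr_ge0 ?sqr_ge0.
Qed.

Lemma qnormD p q : N (p + q) <= N p + N q.
Proof.
rewrite -ler_sqr ?nnegrE ?addr_ge0 ?qnorm_ge0// sqrrD !sqr_qnorm.
have -> : qdot (p + q) (p + q) = qdot p p + qdot p q *+ 2 + qdot q q.
  by rewrite /qdot !qcoordE; ring.
by rewrite lerD2r lerD2l lerMn2r qdot_le.
Qed.

Lemma qnormB p q : N (p - q) <= N p + N q.
Proof. by rewrite (le_trans (qnormD _ _))// qnormN. Qed.

Lemma qdistC p q : N (p - q) = N (q - p).
Proof. by rewrite -qnormN opprB. Qed.

Lemma ler_distqD r p q : N (p - q) <= N (p - r) + N (r - q).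
Proof. by rewrite (le_trans _ (qnormD _ _))// addrA subrK. Qed.

Lemma qnorm_dist_ge p q : N p - N q <= N (p - q).
Proof. by rewrite lerBlDr (le_trans _ (qnormD _ _))// subrK. Qed.

Lemma qnormX q n : N (q ^+ n) = N q ^+ n.
Proof. by elim: n => [|n IH]; rewrite ?qnorm1// !exprS qnormM IH. Qed.

Lemma unitq q : (q \is a GRing.unit) = (q != 0).
Proof. by []. Qed.

Lemma mulqV q : q != 0 -> q * q^-1 = 1.
Proof. by move=> ?; rewrite mulrV. Qed.

Lemma mulVq q : q != 0 -> q^-1 * q = 1.
Proof. by move=> ?; rewrite mulVr. Qed.

Lemma qnormV q : N q^-1 = (N q)^-1.
Proof.
have [->|q0] := eqVneq q 0; first by rewrite invr0 qnorm0 invr0.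
apply: (mulfI (x := N q)); first by rewrite qnorm_eq0.
by rewrite -qnormM mulqV// qnorm1 divff ?qnorm_eq0.
Qed.

Lemma mulq_eq0 p q : (p * q == 0) = (p == 0) || (q == 0).
Proof. by rewrite -!qnorm_eq0 qnormM mulf_eq0. Qed.

Lemma expq_eq0 q n : (q ^+ n == 0) = (n > 0)%N && (q == 0).
Proof. by rewrite -!qnorm_eq0 qnormX expf_eq0. Qed.

Lemma qnorm_sum (T : Type) (s : seq T) (P : pred T) (F : T -> H) :
  N (\sum_(i <- s | P i) F i) <= \sum_(i <- s | P i) N (F i).
Proof.
elim/big_rec2: _ => [|i y x _ h]; first by rewrite qnorm0.
by rewrite (le_trans (qnormD _ _))// lerD2l.
Qed.

Lemma qcoord_le k q : (k < 4)%N -> `|qcoord k q| <= N q.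
Proof.
move=> k4; rewrite -ler_sqr ?nnegrE ?qnorm_ge0// sqr_qnorm real_normK ?num_real//.
have := (sqr_ge0 (q0 q), sqr_ge0 (q1 q)).
have := (sqr_ge0 (q2 q), sqr_ge0 (q3 q)) => -[h2 h3] [h0 h1].
by rewrite /qdot -!expr2; case: k k4 => [|[|[|[|]]]]//= _; lra.
Qed.

Lemma mx_norm_le_qnorm q : `|q| <= N q.
Proof.
rewrite /Num.norm/= mx_normrE.
apply: bigmax_le; first exact: qnorm_ge0.
move=> [i k] _ /=; rewrite (ord1 i).
by rewrite -[k in (q : 'rV_4) _ k]inord_val qcoord_le.
Qed.

(** The constant is the square root of the number of coordinates. With the preceding bound, it lets
    the topology of the sup norm be handled through the multiplicative norm. *)
Lemma qnorm_le_mx_norm q : N q <= 2 * `|q|.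
Proof.
rewrite -ler_sqr ?nnegrE ?qnorm_ge0 ?mulr_ge0// sqr_qnorm exprMn.
have h k : qcoord k q * qcoord k q <= `|q| ^+ 2.
  rewrite -expr2 -[_ ^+ 2]real_normK ?num_real// ler_sqr ?nnegrE//.
  rewrite {2}/Num.norm/= mx_normrE.
  exact: (le_bigmax _ (fun i : 'I_1 * 'I_4 => `|(q : 'rV_4) i.1 i.2|) (0, inord k)).
have := (h 0%N, h 1%N); have := (h 2%N, h 3%N) => -[h2 h3] [h0 h1].
by rewrite /qdot; lra.
Qed.

End Norm.

Section Slices.
Variable R : realType.
Local Notation H := (quat R).
Local Notation q0 := (qcoord 0).
Local Notation q1 := (qcoord 1).
Local Notation q2 := (qcoord 2).
Local Notation q3 := (qcoord 3).
Local Notation N := (@qnorm R).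
Implicit Types (p q r z w I J : H).

Lemma qcoordA (x : R) :
  (q0 (x%:A : H) = x) * (q1 (x%:A : H) = 0) * (q2 (x%:A : H) = 0) *
  (q3 (x%:A : H) = 0).
Proof. by rewrite !qcoordZ !qcoord1 !mulr0 mulr1. Qed.

Lemma qscalarC (x : R) q : x%:A * q = q * x%:A.
Proof. by rewrite mulr_algl mulr_algr. Qed.

Lemma imag_unitsP I : imag_units I <-> q0 I = 0 /\ qdot I I = 1.
Proof.
rewrite /imag_units /=; split=> [II|[I0 II]]; last first.
  by apply: quatP; move: II; rewrite /qdot !(qcoordM, qcoordE, qcoord1) I0; split; lra.
have [] := (congr1 q0 II, congr1 q1 II); have [] := (congr1 q2 II, congr1 q3 II).
rewrite !(qcoordM, qcoordE, qcoord1) => h2 h3 h0 h1.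
suff I0 : q0 I = 0 by split=> //; rewrite /qdot I0 in h0 *; lra.
apply/eqP/negPn/negP => I0.
(* The imaginary coordinates of I * I are twice the real part times those of I. If the real part is
   not 0 they force I to be real, and a real square is not -1. *)
have z x : q0 I * x + x * q0 I = 0 -> x = 0.
  by move=> e; apply: (mulfI I0); lra.
have [e1 e2 e3] : [/\ q1 I = 0, q2 I = 0 & q3 I = 0] by split; apply: z; lra.
have := sqr_ge0 (q0 I); rewrite e1 e2 e3 in h0; lra.
Qed.

Lemma imag_unit_sqr I : imag_units I -> I * I = -1.
Proof. by []. Qed.

Lemma imag_unit_norm I : imag_units I -> N I = 1.
Proof. by move/imag_unitsP => [_ e]; rewrite /qnorm e sqrtr1. Qed.

Lemma imag_unit_neq0 I : imag_units I -> I != 0.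
Proof. by move=> hI; rewrite -qnorm_eq0 imag_unit_norm// oner_eq0. Qed.

Lemma imag_unitN I : imag_units I -> imag_units (- I).
Proof. by rewrite /imag_units/= mulrNN. Qed.

Lemma imag_unit_conj I : imag_units I -> qconj I = - I.
Proof.
move/imag_unitsP => [I0 _]; apply: quatP.
by rewrite !(qcoord_conj, qcoordE) I0 oppr0.
Qed.

Lemma qconjM p q : qconj (p * q) = qconj q * qconj p.
Proof. by apply: quatP; rewrite !(qcoord_conj, qcoordM); split; ring. Qed.

Lemma qconjD p q : qconj (p + q) = qconj p + qconj q.
Proof. by apply: quatP; rewrite !(qcoord_conj, qcoordE); split; ring. Qed.

Lemma qconjN p : qconj (- p) = - qconj p.
Proof. by apply: quatP; rewrite !(qcoord_conj, qcoordE); split. Qed.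

Lemma qconjB p q : qconj (p - q) = qconj p - qconj q.
Proof. by rewrite qconjD qconjN. Qed.

Lemma qconjZ (x : R) q : qconj (x *: q) = x *: qconj q.
Proof. by apply: quatP; rewrite !(qcoord_conj, qcoordE); split; ring. Qed.

Lemma qconj1 : qconj 1 = 1 :> H.
Proof. by apply: quatP; rewrite !(qcoord_conj, qcoord1) oppr0. Qed.

Lemma qconjA (x : R) : qconj (x%:A) = x%:A :> H.
Proof. by rewrite qconjZ qconj1. Qed.

Lemma qconjK : involutive (@qconj R).
Proof. by move=> q; apply: quatP; rewrite !qcoord_conj !opprK. Qed.

Lemma qconjX q n : qconj (q ^+ n) = qconj q ^+ n.
Proof. by elim: n => [|n IH]; rewrite ?qconj1// exprS exprSr qconjM IH. Qed.

Definition slice_pt I (x y : R) : H := x%:A + y *: I.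

Lemma cline_pt I x y : cline I (slice_pt I x y).
Proof. by exists x, y. Qed.

(** Commuting with I describes the slice by an equation, from which its closure properties follow by
    algebra. The commutator is twice the cross product of the imaginary parts; when it vanishes they
    are parallel, and the coefficient is the inner product with I. *)
Lemma clineP I z : imag_units I -> cline I z <-> z * I = I * z.
Proof.
move=> hI; split=> [[x [y ->]]|e].
  by rewrite mulrDl mulrDr qscalarC -(scalerAl y) -(scalerAr y).
exists (q0 z), (qdot z I).
have /imag_unitsP[I0 II] := hI.
have h1 : q2 z * q3 I - q3 z * q2 I = 0.
  by have := congr1 q1 e; rewrite !qcoordM I0; lra.
have h2 : q3 z * q1 I - q1 z * q3 I = 0.
  by have := congr1 q2 e; rewrite !qcoordM I0; lra.
have h3 : q1 z * q2 I - q2 z * q1 I = 0.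
  by have := congr1 q3 e; rewrite !qcoordM I0; lra.
have E x : x = x * qdot I I by rewrite II mulr1.
apply: quatP; rewrite !(qcoordA, qcoordE) I0.
split.
- by rewrite mulr0 addr0.
- rewrite add0r {1}(E (q1 z)) /qdot I0.
  have -> : q1 z * (0 * 0 + q1 I * q1 I + q2 I * q2 I + q3 I * q3 I) =
    (q0 z * 0 + q1 z * q1 I + q2 z * q2 I + q3 z * q3 I) * q1 I
    + q2 I * (q1 z * q2 I - q2 z * q1 I) - q3 I * (q3 z * q1 I - q1 z * q3 I) by ring.
  by rewrite h3 h2; ring.
- rewrite add0r {1}(E (q2 z)) /qdot I0.
  have -> : q2 z * (0 * 0 + q1 I * q1 I + q2 I * q2 I + q3 I * q3 I) =
    (q0 z * 0 + q1 z * q1 I + q2 z * q2 I + q3 z * q3 I) * q2 I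
    - q1 I * (q1 z * q2 I - q2 z * q1 I) + q3 I * (q2 z * q3 I - q3 z * q2 I) by ring.
  by rewrite h3 h1; ring.
- rewrite add0r {1}(E (q3 z)) /qdot I0.
  have -> : q3 z * (0 * 0 + q1 I * q1 I + q2 I * q2 I + q3 I * q3 I) =
    (q0 z * 0 + q1 z * q1 I + q2 z * q2 I + q3 z * q3 I) * q3 I
    + q1 I * (q3 z * q1 I - q1 z * q3 I) - q2 I * (q2 z * q3 I - q3 z * q2 I) by ring.
  by rewrite h2 h1; ring.
Qed.

Lemma cline_comm I z w : imag_units I -> cline I z -> cline I w -> z * w = w * z.
Proof.
move=> hI [x [y ->]] /(clineP _ hI) wI.
by rewrite mulrDl mulrDr qscalarC -(scalerAl y) -(scalerAr y) wI.
Qed.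

Section ClineClosed.
Variable (I : H) (hI : imag_units I).
Local Notation L := (cline I).

Lemma clineA (x : R) : L x%:A.
Proof. by apply/clineP => //; rewrite qscalarC. Qed.
Lemma cline0 : L 0. Proof. by apply/clineP => //; rewrite mul0r mulr0. Qed.
Lemma cline1 : L 1. Proof. by apply/clineP => //; rewrite mul1r mulr1. Qed.
Lemma clineI : L I. Proof. by apply/clineP. Qed.
Lemma clineD z w : L z -> L w -> L (z + w).
Proof. by move=> /(clineP _ hI) zI /(clineP _ hI) wI; apply/clineP => //; rewrite mulrDl mulrDr zI wI. Qed.
Lemma clineN z : L z -> L (- z).
Proof. by move=> /(clineP _ hI) zI; apply/clineP => //; rewrite mulNr mulrN zI. Qed.
Lemma clineB z w : L z -> L w -> L (z - w).
Proof. by move=> Lz Lw; apply/clineD/clineN. Qed.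
Lemma clineM z w : L z -> L w -> L (z * w).
Proof. by move=> /(clineP _ hI) zI /(clineP _ hI) wI; apply/clineP => //; rewrite -mulrA wI !mulrA zI. Qed.
Lemma clineX z n : L z -> L (z ^+ n).
Proof. by move=> Lz; elim: n => [|n IH]; [exact: cline1|rewrite exprS; apply: clineM]. Qed.
Lemma clineV z : L z -> L z^-1.
Proof.
move=> /(clineP _ hI) zI; apply/clineP => //.
have [->|z0] := eqVneq z 0; first by rewrite invr0 mul0r mulr0.
by rewrite -[LHS]mulr1 -(mulqV z0) mulrA -(mulrA _ I) -zI mulrA mulVq// mul1r.
Qed.
Lemma clineZ (x : R) z : L z -> L (x *: z).
Proof. by move=> Lz; rewrite -mulr_algl; apply/clineM => //; exact: clineA. Qed.
Lemma cline_conj z : L z -> L (qconj z).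
Proof.
by move=> [x [y ->]]; rewrite qconjD qconjA qconjZ imag_unit_conj// scalerN;
  apply/clineB; [exact: clineA|apply: clineZ; exact: clineI].
Qed.
Lemma cline_sum (T : Type) (s : seq T) (P : pred T) (F : T -> H) :
  (forall i, P i -> L (F i)) -> L (\sum_(i <- s | P i) F i).
Proof. by move=> h; elim/big_rec: _ => [|i x Pi Lx]; [exact: cline0|apply: clineD => //; exact: h]. Qed.

Lemma qconj_pt x y : qconj (slice_pt I x y) = slice_pt I x (- y).
Proof. by rewrite /slice_pt qconjD qconjA qconjZ imag_unit_conj// scalerN scaleNr. Qed.

Lemma qre_pt x y : qre (slice_pt I x y) = x.
Proof. by have /imag_unitsP[I0 _] := hI; rewrite /qre !(qcoordA, qcoordE) I0 mulr0 addr0. Qed.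

Lemma qdot_pt x y : qdot (slice_pt I x y) I = y.
Proof.
have /imag_unitsP[I0 II] := hI.
have -> : qdot (slice_pt I x y) I = x * q0 I + y * qdot I I.
  by rewrite /qdot !(qcoordA, qcoordE); ring.
by rewrite I0 II mulr0 add0r mulr1.
Qed.

Lemma slice_ptE z : L z -> z = slice_pt I (qre z) (qdot z I).
Proof. by move=> [x [y ->]]; rewrite qre_pt qdot_pt. Qed.

Lemma sqr_norm_pt x y : N (slice_pt I x y) ^+ 2 = x ^+ 2 + y ^+ 2.
Proof.
have /imag_unitsP[I0 II] := hI.
rewrite sqr_qnorm.
have -> : qdot (slice_pt I x y) (slice_pt I x y) = x ^+ 2 + x * y * q0 I *+ 2 + y ^+ 2 * qdot I I.
  by rewrite /qdot !(qcoordA, qcoordE); ring.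
by rewrite I0 II mulr0 mul0rn addr0 mulr1.
Qed.

Lemma slice_pt_inj x y x' y' : slice_pt I x y = slice_pt I x' y' -> x = x' /\ y = y'.
Proof.
move=> e; split; first by rewrite -(qre_pt x y) e qre_pt.
by rewrite -(qdot_pt x y) e qdot_pt.
Qed.

End ClineClosed.

(** The projection of I to the plane of i and j, turned by a right angle and normalized, is
    orthogonal to I. If this projection is 0, then i itself will do. *)
Lemma exists_orth I : imag_units I -> exists2 J, imag_units J & qdot I J = 0.
Proof.
move=> /imag_unitsP[I0 II].
have [e|ne] := eqVneq (q1 I * q1 I + q2 I * q2 I) 0.
  have e1 := sqr_ge0 (q1 I); have e2 := sqr_ge0 (q2 I).
  have I1 : q1 I = 0 by apply/eqP; rewrite -sqrf_eq0; apply/eqP; lra.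
  exists (mkquat 0 1 0 0).
    by apply/imag_unitsP; rewrite /qdot !qcoord_mk//=; split=> //; lra.
  by rewrite /qdot !qcoord_mk//= I1; ring.
have p : 0 < q1 I * q1 I + q2 I * q2 I.
  by rewrite lt_neqAle eq_sym ne -!expr2 addr_ge0 ?sqr_ge0.
pose t := (Num.sqrt (q1 I * q1 I + q2 I * q2 I))^-1.
have tt : t * t * (q1 I * q1 I + q2 I * q2 I) = 1.
  rewrite -expr2 exprVn sqr_sqrtr ?(ltW p)//.
  by rewrite mulVf ?gt_eqF.
exists (mkquat 0 (t * q2 I) (- t * q1 I) 0).
  apply/imag_unitsP; rewrite /qdot !qcoord_mk//=; split=> //.
  by rewrite -[RHS]tt; ring.
by rewrite /qdot !qcoord_mk//=; ring.
Qed.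

Lemma orth_anticomm I J : imag_units I -> imag_units J -> qdot I J = 0 ->
  J * I = - (I * J).
Proof.
move=> /imag_unitsP[I0 _] /imag_unitsP[J0 _] e.
by apply: quatP; move: e; rewrite /qdot !(qcoordM, qcoordE) I0 J0; split; lra.
Qed.

(* Takes the value 0 at real q, where 0^-1 = 0. *)
Definition qunit q : H := (N (qim q))^-1 *: qim q.

Lemma qim_pt I x y : imag_units I -> qim (slice_pt I x y) = y *: I.
Proof.
move=> /imag_unitsP[I0 _]; apply: quatP.
by rewrite /qim /slice_pt !qcoord_mk//= !(qcoordA, qcoordE) I0 mulr0 !add0r.
Qed.

Lemma qunit_pt I x y : imag_units I ->
  [\/ y = 0 /\ qunit (slice_pt I x y) = 0,
      0 < y /\ qunit (slice_pt I x y) = I | y < 0 /\ qunit (slice_pt I x y) = - I].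
Proof.
move=> hI; rewrite /qunit qim_pt// qnormZ imag_unit_norm// mulr1 scalerA.
have [y0|y0|->] := ltgtP y 0; last by rewrite normr0 mulr0 scale0r; apply: Or31.
- by apply: Or33; rewrite ltr0_norm// invrN mulNr mulVf ?scaleN1r ?lt_eqF.
- by apply: Or32; rewrite gtr0_norm// mulVf ?scale1r ?gt_eqF.
Qed.

Lemma quat_slice q : exists I x y, [/\ imag_units I, 0 <= y & q = slice_pt I x y].
Proof.
have qE : q = (q0 q)%:A + qim q.
  by apply: quatP; rewrite !(qcoordA, qcoordE) /qim !qcoord_mk//= addr0 !add0r.
have [e|ne] := eqVneq (qim q) 0.
  have hJ : imag_units (mkquat 0 1 0 0 : H).
    by apply/imag_unitsP; rewrite /qdot !qcoord_mk//=; split=> //; lra.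
  by exists (mkquat 0 1 0 0), (q0 q), 0; rewrite /slice_pt scale0r addr0 {1}qE e addr0.
exists (qunit q), (q0 q), (N (qim q)); split; last first.
- by rewrite /slice_pt /qunit scalerA divff ?scale1r// qnorm_eq0.
- exact: qnorm_ge0.
- apply/imag_unitsP; rewrite /qunit qcoordZ {2}/qim qcoord_mk//= mulr0; split=> //.
  by rewrite -sqr_qnorm qnormZ normfV ger0_norm ?qnorm_ge0// mulVf ?expr1n// qnorm_eq0.
Qed.

End Slices.

(** * Slice holomorphy as strict differentiability *)

Section SliceDerivative.
Variable R : realType.
Local Notation H := (quat R).
Local Notation N := (@qnorm R).
Implicit Types (p q r z w I J : H) (f g : H -> H).

Lemma nbhs_qnormP p (A : set H) :
  nbhs p A <-> exists2 d : R, 0 < d & forall q, N (q - p) < d -> A q.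
Proof.
split=> [/nbhs_normP [d d0 dA]|[d d0 dA]].
  exists d => // q qd; apply: dA => /=.
  by rewrite distrC (le_lt_trans (mx_norm_le_qnorm _)).
apply/nbhs_ballP; exists (d / 2) => /=; first by rewrite divr_gt0.
move=> q; rewrite -ball_normE/= distrC => qd; apply: dA.
by rewrite (le_lt_trans (qnorm_le_mx_norm _))// mulrC -ltr_pdivlMr.
Qed.

Lemma open_qnormP (A : set H) :
  open A <-> forall p, A p -> exists2 d : R, 0 < d & forall q, N (q - p) < d -> A q.
Proof.
rewrite openE; split=> h p Ap; first exact/nbhs_qnormP/h.
exact/nbhs_qnormP/h.
Qed.

Lemma cvg_qnormP (T : Type) (F : set_system T) {FF : Filter F} (u : T -> H) l :
  u @ F --> l <-> forall e : R, 0 < e -> \forall t \near F, N (u t - l) <= e.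
Proof.
split=> [/cvgrPdist_le h e e0|h].
  have := h (e / 2) (divr_gt0 e0 (ltr0Sn _ _)); apply: filterS => t.
  rewrite distrC => ut; rewrite (le_trans (qnorm_le_mx_norm _))// mulrC -ler_pdivlMr//.
apply/cvgrPdist_le => e e0; apply: filterS (h e e0) => t ut.
by rewrite distrC (le_trans (mx_norm_le_qnorm _)).
Qed.

Lemma dnbhs_deltaP (P : R -> Prop) :
  (\forall h \near 0^', P h) <->
  exists2 d : R, 0 < d & forall h, h != 0 -> `|h| < d -> P h.
Proof.
split=> [/nbhs_ballP[d d0 dP]|[d d0 dP]].
  exists d => // h h0 hd; apply: (dP h) => //.
  by rewrite /ball/= sub0r normrN.
apply/nbhs_ballP; exists d => // h; rewrite /ball/= sub0r normrN => hd h0.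
exact: dP.
Qed.

Lemma directional_deriveP f z v d :
  (derivable f z v /\ 'D_v f z = d) <->
  forall e : R, 0 < e -> exists2 dl : R, 0 < dl &
    forall h : R, h != 0 -> `|h| < dl -> N (h^-1 *: (f (z + h *: v) - f z) - d) <= e.
Proof.
transitivity ((fun h : R => h^-1 *: ((f \o shift z) (h *: v) - f z)) @ 0^' --> d).
  split=> [[h <-]|h]; first exact: h.
  by split; [apply/cvg_ex; exists d|exact/cvg_lim].
rewrite cvg_qnormP; split=> h e /h; first move/dnbhs_deltaP.
  by case=> dl dl0 hd; exists dl => // t t0 td; rewrite [z + _]addrC; exact: hd.
case=> dl dl0 hd; apply/dnbhs_deltaP.
by exists dl => // t t0 td /=; rewrite [_ + z]addrC; exact: hd.
Qed.

Lemma real_deriveP (g : R -> R) t d :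
  (forall e : R, 0 < e -> exists2 dl : R, 0 < dl &
    forall h : R, h != 0 -> `|h| < dl -> `|h^-1 * (g (t + h) - g t) - d| <= e) ->
  is_derive t (1 : R) g d.
Proof.
move=> h.
have c : (fun h : R => h^-1 *: ((g \o shift t) (h *: 1) - g t)) @ 0^' --> d.
  apply/cvgrPdist_le => e /h [dl dl0 hd]; apply/dnbhs_deltaP.
  exists dl => // s s0 sd /=; rewrite distrC [_ + t]addrC [s *: 1]mulr1; exact: hd.
by apply: DeriveDef; [apply/cvg_ex; exists d|exact/cvg_lim].
Qed.

Lemma within_continuous_qnormP (D : set H) (F : H -> H) :
  {within D, continuous F} <-> forall p, D p -> forall e : R, 0 < e ->
    exists2 d : R, 0 < d & forall z, D z -> N (z - p) < d -> N (F z - F p) <= e.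
Proof.
rewrite subspace_continuousP; split=> h p Dp.
  move=> e e0; have /cvg_qnormP/(_ e e0)/nbhs_qnormP[d d0 hd] := h p Dp.
  by exists d => // z Dz zd; exact: hd.
apply/cvg_qnormP => e e0; have [d d0 hd] := h p Dp e e0.
by apply/nbhs_qnormP; exists d => // z zd Dz; exact: hd.
Qed.

(** The real mean value theorem applies to each coordinate of f (z + t u) - t e, whose derivative is
    at most c. The factor 2 is the cost of returning from the largest coordinate to the Euclidean
    norm. *)
Lemma mean_value_le f z u (a : R) e (c : R) : 0 <= a ->
  (forall t, 0 <= t <= a -> derivable f (z + t *: u) u /\
     N ('D_u f (z + t *: u) - e) <= c) ->
  N (f (z + a *: u) - f z - a *: e) <= 2 * (c * a).
Proof.
move=> a0 h.
rewrite (le_trans (qnorm_le_mx_norm _))// ler_pM2l//.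
rewrite {1}/Num.norm/= mx_normrE.
have c0 : 0 <= c.
  by have [|_] := h 0; rewrite ?lexx//; apply: le_trans; exact: qnorm_ge0.
apply: bigmax_le; first exact: mulr_ge0.
move=> [i k] _ /=; rewrite (ord1 i) -[k]inord_val.
set x := (X in `|X| <= _).
have -> : x = qcoord k (f (z + a *: u) - f z - a *: e) by [].
rewrite {}/x.
pose g t := qcoord k (f (z + t *: u) - t *: e).
have dg t : 0 <= t <= a -> is_derive t (1 : R) g (qcoord k ('D_u f (z + t *: u) - e)).
  move=> ta; have [dt _] := h t ta.
  apply: real_deriveP => eps eps0.
  have [dl dl0 hdl] :=
    (directional_deriveP f (z + t *: u) u ('D_u f (z + t *: u))).1 (conj dt erefl) eps eps0.
  exists dl => // s s0 sdl.
  apply: le_trans (hdl s s0 sdl).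
  rewrite -addrA -scalerDl.
  set X := (X in N X).
  suff -> : s^-1 * (g (t + s) - g t) - qcoord k ('D_u f (z + t *: u) - e) = qcoord k X.
    exact: qcoord_le X (ltn_ord k).
  by rewrite /g /X !qcoordE; field.
have cg : {within `[0, a], continuous g}.
  apply: derivable_within_continuous => t; rewrite in_itv/= => /dg dt.
  exact: ex_derive.
have dg' t : t \in `]0, a[ -> is_derive t (1 : R) g (qcoord k ('D_u f (z + t *: u) - e)).
  by rewrite in_itv/= => /andP[t0 ta]; apply: dg; rewrite !ltW.
have [t] := MVT_segment a0 dg' cg.
rewrite in_itv/= subr0 => /h [_ ht] /(congr1 Num.norm).
rewrite /g scale0r addr0 scale0r subr0 -qcoordN -qcoordD addrAC => ->.
rewrite normrM (ger0_norm a0) ler_wpM2r//.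
by rewrite (le_trans _ ht)// qcoord_le.
Qed.

Lemma mean_value_norm_le f z u (a : R) e (c : R) :
  (forall t, `|t| <= `|a| -> derivable f (z + t *: u) u /\
     N ('D_u f (z + t *: u) - e) <= c) ->
  N (f (z + a *: u) - f z - a *: e) <= 2 * (c * `|a|).
Proof.
move=> h; have [a0|a0] := leP 0 a.
  rewrite (ger0_norm a0) in h *; apply: mean_value_le => // t /andP[t0 ta].
  by apply: h; rewrite ger0_norm.
rewrite (ltr0_norm a0) in h *.
have zE : z + a *: u + (- a) *: u = z by rewrite scaleNr addrK.
have -> : f (z + a *: u) - f z - a *: e = - (f z - f (z + a *: u) - (- a) *: e).
  by rewrite scaleNr opprK opprD opprB.
rewrite qnormN -{1}zE; apply: mean_value_le; first by rewrite oppr_ge0 ltW.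
move=> t /andP[t0 ta]; rewrite -addrA -scalerDl; apply: h.
by rewrite ler_norml opprK; apply/andP; split; lra.
Qed.

(* Strict differentiability along the slice: a single predicate that packages
   differentiability on cline I, the Cauchy-Riemann equation (d multiplies
   the increment on the right) and continuity of the derivative. *)
Definition slice_deriv I f p d := forall e : R, 0 < e -> exists2 dl : R, 0 < dl &
  forall z1 z2, cline I z1 -> cline I z2 -> N (z1 - p) < dl -> N (z2 - p) < dl ->
    N (f z2 - f z1 - (z2 - z1) * d) <= e * N (z2 - z1).

Definition slice_smooth I f p := exists d, slice_deriv I f p d.

Lemma pt_coord_le I x y : imag_units I ->
  `|x| <= N (slice_pt I x y) /\ `|y| <= N (slice_pt I x y).
Proof.
move=> hI; rewrite -!(@ler_sqr _ `|_|) ?nnegrE ?qnorm_ge0// !real_normK ?num_real//.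
by rewrite sqr_norm_pt// lerDl lerDr !sqr_ge0.
Qed.

Lemma slice_pt_norm_le I x y : imag_units I -> N (slice_pt I x y) <= `|x| + `|y|.
Proof.
move=> hI; rewrite (le_trans (qnormD _ _))// !qnormZ qnorm1 (imag_unit_norm hI).
by rewrite !mulr1.
Qed.

(** The increment from z1 to z2 is split into a leg along 1 and a leg along I, each treated by the
    mean value inequality. The Cauchy-Riemann equation turns the derivative along I into I times the
    one along 1, so both legs are compared with the same derivative at p. *)
Lemma holomorphic_smooth I W f p : imag_units I -> open W ->
  slice_holomorphic I (W `&` cline I) f -> W p -> cline I p -> slice_smooth I f p.
Proof.
move=> hI /open_qnormP oW [dv c1 _ CR] Wp Lp.
exists ('D_1 f p) => e e0.
have DIE z : W z -> cline I z -> 'D_I f z = I * 'D_1 f z.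
  move=> Wz Lz; have /eqP := CR z (conj Wz Lz).
  rewrite scaler_eq0 invr_eq0 pnatr_eq0/= addr_eq0 => /eqP ->.
  by rewrite mulrN mulrA imag_unit_sqr// mulN1r opprK.
have e4 : 0 < e / 4 by rewrite divr_gt0.
have [dl1 dl10 h1] := (within_continuous_qnormP _ _).1 c1 p (conj Wp Lp) _ e4.
have [dl2 dl20 h2] := oW p Wp.
have near z dl : N (z - p) < dl -> dl <= Num.min dl1 dl2 -> cline I z ->
    [/\ W z, derivable f z 1, derivable f z I & N ('D_1 f z - 'D_1 f p) <= e / 4].
  rewrite le_min => zd /andP[d1 d2] Lz.
  have Wz : W z by apply: h2; exact: lt_le_trans zd d2.
  have [z1 z2] := dv z (conj Wz Lz).
  by split=> //; apply: h1 => //; exact: lt_le_trans zd d1.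
have m0 : 0 < Num.min dl1 dl2 by rewrite lt_min dl10.
(* Two points this close to p differ by at most a quarter of the minimum in each coordinate, so both
   legs of the path stay within the minimum of p. *)
exists (Num.min dl1 dl2 / 8); first by rewrite divr_gt0.
move: near m0; set m := Num.min _ _ => near m0 z1 z2 Lz1 Lz2 z1p z2p.
have [a [b ab]] : cline I (z2 - z1) by apply: clineB.
have abm : `|a| + `|b| <= m / 2.
  have [] := pt_coord_le a b hI; rewrite /slice_pt -ab => ha hb.
  have := le_lt_trans (ler_distqD p z2 z1); rewrite (qdistC p) => /(_ (m / 4)).
  by rewrite (splitr (m / 4)) -mulrA -invfM -natrM/= ltrD// => /(_ isT); lra.
have L1 := cline1 hI; have LI := clineI hI.
have H1 : N (f (z1 + a%:A) - f z1 - a *: 'D_1 f p) <= 2 * (e / 4 * `|a|).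
  apply: mean_value_norm_le => t ta.
  have Lt : cline I (z1 + t%:A) by apply/clineD => //; exact: clineA.
  have [||//|_ ? _ ?] := near (z1 + t%:A) m; last by split.
    rewrite addrAC (le_lt_trans (qnormD _ _))// qnormZ qnorm1 mulr1.
    by have := normr_ge0 b; lra.
  by rewrite lexx.
have H2 : N (f (z1 + a%:A + b *: I) - f (z1 + a%:A) - b *: (I * 'D_1 f p)) <= 2 * (e / 4 * `|b|).
  apply: mean_value_norm_le => t tb.
  have Lt : cline I (z1 + a%:A + t *: I).
    by apply/clineD/clineZ => //; apply/clineD => //; exact: clineA.
  have [||//|Wt _ ? ht] := near (z1 + a%:A + t *: I) m; last first.
    by split=> //; rewrite DIE// -mulrBr qnormM (imag_unit_norm hI) mul1r.
    by rewrite lexx.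
  rewrite addrAC (le_lt_trans (qnormD _ _))// qnormZ (imag_unit_norm hI) mulr1.
  have E : N (z1 + a%:A - p) <= N (z1 - p) + `|a|.
    by rewrite addrAC (le_trans (qnormD _ _))// qnormZ qnorm1 mulr1.
  by lra.
have e2 : z2 = z1 + a%:A + b *: I by rewrite -addrA -ab addrC subrK.
have -> : f z2 - f z1 - (z2 - z1) * 'D_1 f p =
   (f (z1 + a%:A + b *: I) - f (z1 + a%:A) - b *: (I * 'D_1 f p)) +
   (f (z1 + a%:A) - f z1 - a *: 'D_1 f p).
  rewrite -e2 ab mulrDl -!scalerAl mul1r opprD [RHS]addrACA; congr (_ + _).
    by rewrite addrA subrK.
  by rewrite addrC.
apply: le_trans (qnormD _ _) _; apply: le_trans (lerD H2 H1) _.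
have [] := pt_coord_le a b hI; rewrite /slice_pt -ab => ha hb.
have := ler_pM2l e0; move=> hm; have := hm `|a| (N (z2 - z1)); have := hm `|b| (N (z2 - z1)).
rewrite ha hb; lra.
Qed.

Lemma smooth_derive I f p d : imag_units I -> cline I p -> slice_deriv I f p d ->
  [/\ derivable f p 1, 'D_1 f p = d, derivable f p I & 'D_I f p = I * d].
Proof.
move=> hI Lp h.
suff H1 v : cline I v -> N v = 1 -> derivable f p v /\ 'D_v f p = v * d.
  have [d1 D1] := H1 1 (cline1 hI) (qnorm1 _).
  have [dI DI] := H1 I (clineI hI) (imag_unit_norm hI).
  by rewrite mul1r in D1; split; [exact: d1|exact: D1|exact: dI|exact: DI].
move=> Lv v1; apply/directional_deriveP => e e0.
have [dl dl0 hd] := h e e0; exists dl => // t t0 td.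
have := hd p (p + t *: v) Lp _ _ _.
rewrite subrr qnorm0 => /(_ (clineD hI Lp (clineZ hI _ Lv)) dl0).
rewrite addrAC subrr add0r qnormZ v1 mulr1 => /(_ td) H2.
have -> : t^-1 *: (f (p + t *: v) - f p) - v * d =
  t^-1 *: (f (p + t *: v) - f p - t *: v * d).
  by rewrite [in RHS]scalerBr -scalerAl scalerA mulVf// scale1r.
by rewrite qnormZ normfV ler_pdivrMl ?normr_gt0// mulrC.
Qed.

Lemma small_cline I p (d : R) : imag_units I -> cline I p -> 0 < d ->
  exists2 z, cline I z & 0 < N (z - p) < d.
Proof.
move=> hI Lp d0; exists (p + (d / 2)%:A); first by apply: clineD => //; exact: clineA.
by rewrite addrAC subrr add0r qnormZ qnorm1 mulr1 gtr0_norm ?divr_gt0//=; lra.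
Qed.

(** Strictness at p makes every difference quotient near p close to d, while those based at z tend
    to d'. Comparing the two at a single w close to z is enough. *)
Lemma slice_deriv_continuous I f p d (e : R) : imag_units I -> slice_deriv I f p d ->
  0 < e -> exists2 dl : R, 0 < dl & forall z d', cline I z -> N (z - p) < dl ->
    slice_deriv I f z d' -> N (d' - d) <= e.
Proof.
move=> hI h e0; have e2 : 0 < e / 2 by rewrite divr_gt0.
have [dl dl0 hd] := h _ e2; exists dl => // z d' Lz zp hz.
have [dl' dl'0 hd'] := hz _ e2.
have [|w Lw /andP[w0 wd]] := @small_cline I z (Num.min dl' (dl - N (z - p))) hI Lz.
  by rewrite lt_min dl'0 subr_gt0.
move: wd; rewrite lt_min => /andP[wd' wd].
have H1 := hd z w Lz Lw zp (le_lt_trans (ler_distqD z w p) _).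
have {}H1 : N (f w - f z - (w - z) * d) <= e / 2 * N (w - z) by apply: H1; lra.
have H2 : N (f w - f z - (w - z) * d') <= e / 2 * N (w - z).
  by apply: hd' => //; rewrite subrr qnorm0.
rewrite -(ler_pM2l w0) -qnormM mulrBr.
have -> : (w - z) * d' - (w - z) * d =
  (f w - f z - (w - z) * d) - (f w - f z - (w - z) * d').
  by rewrite opprB [RHS]addrC addrA subrK.
by apply: le_trans (qnormB _ _) _; lra.
Qed.

Lemma slice_smooth_continuous I f p (e : R) : imag_units I -> cline I p ->
  slice_smooth I f p -> 0 < e -> exists2 dl : R, 0 < dl &
  forall z, cline I z -> N (z - p) < dl -> N (f z - f p) <= e.
Proof.
move=> hI Lp [d h] e0; have [dl dl0 hd] := h 1 ltr01.
have k0 : 0 < 1 + N d by have := qnorm_ge0 d; lra.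
exists (Num.min dl (e / (1 + N d))); first by rewrite lt_min dl0 divr_gt0.
move=> z Lz; rewrite lt_min => /andP[z1 z2].
have := hd p z Lp Lz; rewrite subrr qnorm0 mul1r => /(_ dl0 z1) H1.
rewrite ltr_pdivlMr// mulrDr mulr1 -qnormM in z2.
apply: le_trans (ltW z2); rewrite -[X in N X](subrK ((z - p) * d)).
by apply: le_trans (qnormD _ _) _; rewrite lerD2r.
Qed.

Lemma slice_holomorphicP I W f : imag_units I -> open W ->
  slice_holomorphic I (W `&` cline I) f <->
  forall p, W p -> cline I p -> slice_smooth I f p.
Proof.
move=> hI oW; split=> [h p Wp Lp|h]; first exact: holomorphic_smooth h Wp Lp.
have cD : forall p, (W `&` cline I) p -> forall e : R, 0 < e -> exists2 d : R, 0 < d &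
    forall z, (W `&` cline I) z -> N (z - p) < d -> N ('D_1 f z - 'D_1 f p) <= e.
  move=> p [Wp Lp] e e0; have [d hd] := h p Wp Lp.
  have [_ -> _ _] := smooth_derive hI Lp hd.
  have [dl dl0 hdl] := slice_deriv_continuous hI hd e0.
  exists dl => // z [Wz Lz] zp; have [d' hd'] := h z Wz Lz.
  by have [_ -> _ _] := smooth_derive hI Lz hd'; exact: hdl hd'.
split.
- move=> p [Wp Lp]; have [d hd] := h p Wp Lp.
  by have [? _ ? _] := smooth_derive hI Lp hd.
- exact/within_continuous_qnormP.
- apply/within_continuous_qnormP => p Dp e e0; have [dl dl0 hdl] := cD p Dp e e0.
  exists dl; first exact: dl0.
  move=> z Dz zp; have Hz := hdl z Dz zp.
  move: Dp Dz => [Wp Lp] [Wz Lz].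
  have [d hd] := h p Wp Lp; have [d' hd'] := h z Wz Lz.
  have [_ E1 _ E2] := smooth_derive hI Lp hd.
  have [_ E3 _ E4] := smooth_derive hI Lz hd'.
  rewrite E1 E3 in Hz; rewrite E2 E4.
  by rewrite -mulrBr qnormM (imag_unit_norm hI) mul1r.
- move=> p [Wp Lp]; have [d hd] := h p Wp Lp.
  have [_ E1 _ E2] := smooth_derive hI Lp hd; rewrite E2 E1.
  by rewrite mulrA imag_unit_sqr// mulN1r subrr scaler0.
Qed.

Lemma regularP W f : open W ->
  regular W f <-> forall I p, imag_units I -> W p -> cline I p -> slice_smooth I f p.
Proof.
move=> oW; split=> h I.
  by move=> p hI Wp Lp; exact: (slice_holomorphicP _ hI oW).1 (h I hI) p Wp Lp.
by move=> hI; apply/(slice_holomorphicP _ hI oW) => p; exact: h.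
Qed.

End SliceDerivative.

(** * A discrete Cauchy formula *)

Lemma slice_ptM (R : realType) (I : quat R) (a b c d : R) : imag_units I ->
  slice_pt I a b * slice_pt I c d = slice_pt I (a * c - b * d) (a * d + b * c).
Proof.
move=> /imag_unitsP[I0 II]; apply: quatP.
rewrite !(qcoordM, qcoordA, qcoordE) I0; split; [|ring..].
rewrite -[in RHS](mulr1 (b * d)) -II /qdot I0; ring.
Qed.

Section DiscreteCauchy.
Variable R : realType.
Local Notation H := (quat R).
Local Notation N := (@qnorm R).
Variables (I : H) (hI : imag_units I).
Local Notation L := (cline I).
Implicit Types (p q z w v : H) (f g : H -> H).

Let expi (t : R) : H := slice_pt I (cos t) (sin t).

Let expiD s t : expi (s + t) = expi s * expi t.
Proof. by rewrite /expi slice_ptM// cosD sinD [sin s * cos t + _]addrC. Qed.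

Let expi0 : expi 0 = 1.
Proof. by rewrite /expi /slice_pt cos0 sin0 scale1r scale0r addr0. Qed.

Let expi2pi : expi (pi *+ 2) = 1.
Proof. by rewrite /expi /slice_pt cos2pi sin2pi scale1r scale0r addr0. Qed.

Let expi_norm t : N (expi t) = 1.
Proof.
apply/eqP; rewrite -(@eqrXn2 _ 2)// ?qnorm_ge0// sqr_norm_pt//.
by rewrite cos2Dsin2 expr1n.
Qed.

Let expi_line t : L (expi t).
Proof. exact: cline_pt. Qed.

Let expiX t n : expi t ^+ n = expi (t *+ n).
Proof. by elim: n => [|n IH]; rewrite ?expi0// exprS mulrS expiD IH. Qed.

Let expi_neq1 t : 0 < t < pi *+ 2 -> expi t != 1.
Proof.
move=> /andP[t0 t2]; apply/eqP => /(congr1 (@qre R)).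
rewrite /expi qre_pt// /qre qcoord1 => c1.
have s0 : 0 < sin (t / 2).
  apply: sin_gt0_pi; rewrite divr_gt0//= ltr_pdivrMr// mulrC mulr_natl; exact: t2.
have := cos_mulr2n (t / 2); rewrite -[t / 2 *+ 2]mulr_natr mulfVK// c1 cos2sin2.
have : 0 < sin (t / 2) ^+ 2 by rewrite exprn_gt0.
lra.
Qed.

Let expi_small (e : R) : 0 < e -> \forall n \near \oo,
  N (expi (pi *+ 2 / n.+1%:R) - 1) < e.
Proof.
move=> e0.
have c : (fun n => pi *+ 2 / n.+1%:R : R) @ \oo --> (0 : R).
  rewrite -[X in _ --> X](mulr0 (pi *+ 2)); apply: cvgMl_tmp; exact: cvg_harmonic.
have cc : (fun n => cos (pi *+ 2 / n.+1%:R) : R) @ \oo --> (1 : R).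
  by rewrite -[X in _ --> X](@cos0 R); apply: continuous_cvg => //; exact: continuous_cos.
have cs : (fun n => sin (pi *+ 2 / n.+1%:R) : R) @ \oo --> (0 : R).
  by rewrite -[X in _ --> X](@sin0 R); apply: continuous_cvg => //; exact: continuous_sin.
have e2 : 0 < e / 2 by rewrite divr_gt0.
apply: filterS (filterI ((cvgrPdist_lt _ _).1 cc _ e2) ((cvgrPdist_lt _ _).1 cs _ e2)).
move=> n [/=]; rewrite sub0r normrN distrC => h2 h1.
have -> : expi (pi *+ 2 / n.+1%:R) - 1 =
  slice_pt I (cos (pi *+ 2 / n.+1%:R) - 1) (sin (pi *+ 2 / n.+1%:R)).
  by rewrite /expi /slice_pt addrAC scalerBl scale1r.
by rewrite (le_lt_trans (slice_pt_norm_le _ _ hI))// (splitr e) ltrD.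
Qed.

Section OneFunction.
Variables (f : H -> H) (r : R) (r0 : 0 < r).
Local Notation K := [set z | L z /\ N z <= r].
Hypothesis fK : forall z, K z -> slice_smooth I f z.

Let compactK : compact (K : set 'rV[R]_4).
Proof.
apply: bounded_closed_compact.
  exists r; split; first exact: num_real.
  move=> M rM z [_ zr]; apply: ltW; apply: le_lt_trans rM.
  exact: le_trans (mx_norm_le_qnorm _) zr.
rewrite -[X in closed X]setCK; apply: open_closedC.
apply/open_qnormP => p /= /not_andP[nL|/negP]; last first.
  rewrite -ltNge => pr; exists (N p - r); first by rewrite subr_gt0.
  move=> q qp /= [_ qr]; have := qnorm_dist_ge p q; rewrite qdistC; lra.
have d0 : 0 < N (p * I - I * p).
  by rewrite qnorm_gt0 subr_eq0; apply/eqP => e; apply: nL; apply/clineP.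
exists (N (p * I - I * p) / 2); first by rewrite divr_gt0.
move=> q qp /= [/(clineP _ hI) qI _].
have : N ((p - q) * I - I * (p - q)) <= 2 * N (q - p).
  rewrite (le_trans (qnormB _ _))// !qnormM (imag_unit_norm hI) mulr1 mul1r.
  by rewrite qdistC; lra.
rewrite mulrBl mulrBr qI opprB addrA subrK; lra.
Qed.

Let fd z := xget 0 [set d | slice_deriv I f z d].

Let fdP z : K z -> slice_deriv I f z (fd z).
Proof. by move=> /fK[d hd]; apply: (xgetPex 0 (P := [set d | slice_deriv I f z d])); exists d. Qed.

Let uniform_bound : exists A : R, forall z, K z -> N (f z) <= A.
Proof.
have /compact_near_coveringP cov := compactK.
pose P (M : R) z := K z -> N (f z) <= M.
have cvr : \forall M \near +oo, K `<=` P M.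
  apply: cov => x Kx; have [Lx _] := Kx.
  have [d d0 hd] := slice_smooth_continuous hI Lx (fK Kx) ltr01.
  exists ([set z | N (z - x) < d], [set M | N (f x) + 1 < M]).
    split; first by apply/nbhs_qnormP; exists d.
    by exists (N (f x) + 1); split; [exact: num_real|].
  move=> [z M] /= [zx xM] [Lz _]; apply: le_trans (ltW xM).
  have := hd z Lz zx; have := qnorm_dist_ge (f z) (f x); lra.
have [M hM] := filter_ex cvr.
by exists M => z Kz; exact: hM.
Qed.

(** Strict differentiability at a point gives the estimate with the derivative at that point;
    continuity of the derivative replaces it by [fd z1], and compactness of the disc makes the
    radius uniform. *)
Let uniform_deriv (e : R) : 0 < e -> exists2 dl : R, 0 < dl & forall z1 z2,
  K z1 -> K z2 -> N (z2 - z1) < dl ->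
  N (f z2 - f z1 - (z2 - z1) * fd z1) <= e * N (z2 - z1).
Proof.
move=> e0; have /compact_near_coveringP cov := compactK.
pose P (dl : R) z1 := K z1 -> forall z2, K z2 -> N (z2 - z1) < dl ->
  N (f z2 - f z1 - (z2 - z1) * fd z1) <= e * N (z2 - z1).
have cvr : \forall dl \near 0^'+, K `<=` P dl.
  apply: cov => x Kx; have e2 : 0 < e / 2 by rewrite divr_gt0.
  have [d1 d10 h1] := fdP Kx e2.
  have [d2 d20 h2] := slice_deriv_continuous hI (fdP Kx) e2.
  exists ([set z | N (z - x) < Num.min (d1 / 2) d2], [set dl | dl < d1 / 2]).
    split; last by apply: nbhs_right_lt; rewrite divr_gt0.
    by apply/nbhs_qnormP; exists (Num.min (d1 / 2) d2) => //; rewrite lt_min d20 divr_gt0.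
  move=> [z1 dl] /= [+ dld] Kz1 z2 Kz2 z12; rewrite lt_min => /andP[z1x z1x'].
  have [[Lz1 _] [Lz2 _]] := (Kz1, Kz2).
  have z2x : N (z2 - x) < d1 by have := ler_distqD z1 z2 x; lra.
  have z1x2 : N (z1 - x) < d1 by lra.
  have H1 := h1 z1 z2 Lz1 Lz2 z1x2 z2x.
  have H2 := h2 z1 _ Lz1 z1x' (fdP Kz1).
  have -> : f z2 - f z1 - (z2 - z1) * fd z1 =
    (f z2 - f z1 - (z2 - z1) * fd x) - (z2 - z1) * (fd z1 - fd x).
    by rewrite [in RHS]mulrBr opprB addrA subrK.
  have H3 : N ((z2 - z1) * (fd z1 - fd x)) <= e / 2 * N (z2 - z1).
    by rewrite qnormM mulrC ler_wpM2r ?qnorm_ge0.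
  by apply: le_trans (qnormB _ _) _; lra.
have [dl [dl0 hdl]] := filter_ex (filterI (nbhs_right_gt (0 : R)) cvr).
by exists dl => // z1 z2 Kz1; exact: hdl.
Qed.

Section OneN.
Variables (n : nat) (n1 : (1 < n)%N).
Let n0 : (0 < n)%N. Proof. exact: ltnW. Qed.
Local Notation om := (expi (pi *+ 2 / n%:R)).
Local Notation eta := (expi (- (pi *+ 2 / n%:R))).

Let omX : om ^+ n = 1.
Proof. by rewrite expiX -[_ *+ n]mulr_natr mulfVK ?expi2pi// pnatr_eq0 -lt0n. Qed.

Let eta_om k : eta ^+ k * om ^+ k = 1.
Proof. by rewrite !expiX -expiD -mulrnDl addNr mul0rn expi0. Qed.

Let om_eta k : om ^+ k * eta ^+ k = 1.
Proof. by rewrite !expiX -expiD -mulrnDl addrN mul0rn expi0. Qed.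

Let etaX : eta ^+ n = 1.
Proof. by have := eta_om n; rewrite omX mulr1. Qed.

Let eta_neq1 j : (0 < j < n)%N -> eta ^+ j != 1.
Proof.
move=> /andP[j0 jn]; have : om ^+ j != 1.
  rewrite expiX; apply: expi_neq1.
  have npos : 0 < n%:R :> R by rewrite ltr0n.
  have pi2 : 0 < pi *+ 2 :> R by rewrite pmulrn_lgt0// pi_gt0.
  rewrite -[_ *+ j]mulr_natr mulrAC -mulrA; apply/andP; split.
    by apply: mulr_gt0 => //; apply: divr_gt0 => //; rewrite ltr0n.
  rewrite -[X in _ < X]mulr1 ltr_pM2l//.
  by rewrite ltr_pdivrMr// mul1r ltr_nat.
by apply: contra_neq => e; have := om_eta j; rewrite e mulr1.
Qed.

(* kern v k is the geometric series of zeta k / (zeta k - r v) truncated at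
   order n, which makes its mean over the n-th roots of unity exactly 1. *)
Let zeta k : H := r *: om ^+ k.
Let kern v k : H := \sum_(j < n) v ^+ j * (eta ^+ k) ^+ j.
Let nV : R := n%:R^-1.

Let om_line k : L (om ^+ k). Proof. exact: clineX. Qed.
Let eta_line k : L (eta ^+ k). Proof. exact: clineX. Qed.

(** Summed over k first, each power j with 0 < j < n gives a geometric sum over a nontrivial n-th
    root of unity, which is 0. Only j = 0 contributes. *)
Let kern_mean v : L v -> \sum_(k < n) kern v k = n%:R.
Proof.
move=> Lv; rewrite exchange_big/=.
rewrite (bigD1 (Ordinal n0))//= [X in _ + X]big1 ?addr0.
  under eq_bigr do rewrite !expr0 mulr1.
  by rewrite sumr_const card_ord.
move=> j j0; rewrite -mulr_sumr.
suff -> : \sum_(k < n) (eta ^+ k) ^+ j = 0 by rewrite mulr0.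
under eq_bigr do rewrite -exprM mulnC exprM.
have h : (0 < j < n)%N by rewrite ltn_ord andbT lt0n; apply: contra j0 => /eqP e; apply/eqP/val_inj.
have := subrX1 (eta ^+ j) n; rewrite -exprM mulnC exprM etaX expr1n subrr => /esym/eqP.
by rewrite mulq_eq0 subr_eq0 (negPf (eta_neq1 h))/= => /eqP.
Qed.

Let kern_norm v k : N v <= 1 / 2 -> N (kern v k) <= 2.
Proof.
move=> v2; apply: le_trans (qnorm_sum _ _ _) _.
apply: (@le_trans _ _ (\sum_(j < n) (1 / 2) ^+ j)).
  apply: ler_sum => j _; rewrite qnormM !qnormX expi_norm !expr1n mulr1.
  by rewrite lerXn2r ?nnegrE ?qnorm_ge0.
have := subrX1 (1 / 2 : R) n; have : 0 <= (1 / 2 : R) ^+ n by rewrite exprn_ge0.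
lra.
Qed.

(** The points [gam v s k] move in the direction zeta k - r v as s grows. The kernel turns this
    direction into zeta k, up to a factor that does not depend on k. *)
Let kern_zeta v k : L v -> kern v k * (zeta k - r *: v) = (1 - v ^+ n) * zeta k.
Proof.
move=> Lv; have Lt : L (v * eta ^+ k) by apply: clineM.
have -> : kern v k = \sum_(j < n) (v * eta ^+ k) ^+ j.
  apply: eq_bigr => j _; rewrite exprMn_comm//; exact: cline_comm hI Lv (eta_line k).
have -> : zeta k - r *: v = (1 - v * eta ^+ k) * zeta k.
  by rewrite mulrBl mul1r /zeta -scalerAr -mulrA eta_om mulr1.
rewrite mulrA; congr (_ * _).
have Ls : L (\sum_(j < n) (v * eta ^+ k) ^+ j) by apply: cline_sum => // j _; exact: clineX.
rewrite (cline_comm hI Ls); last by apply: clineB => //; exact: cline1.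
have := subrX1 (v * eta ^+ k) n.
rewrite exprMn_comm; last exact: cline_comm hI Lv (eta_line k).
rewrite -exprM mulnC exprM etaX expr1n mulr1 => /(congr1 -%R).
by rewrite opprB -mulNr opprB => ->.
Qed.

Let zeta_norm k : N (zeta k) = r.
Proof. by rewrite /zeta qnormZ qnormX expi_norm expr1n mulr1 gtr0_norm. Qed.

Let gam v (s : R) k : H := r *: v + s *: (zeta k - r *: v).

Let gamK v s k : L v -> N v <= 1 / 2 -> 0 <= s <= 1 -> K (gam v s k).
Proof.
move=> Lv v2 /andP[s0 s1]; split.
  apply: clineD => //; first exact: clineZ.
  by apply: clineZ => //; apply: clineB => //; apply: clineZ.
have -> : gam v s k = (1 - s) *: (r *: v) + s *: zeta k.
  by rewrite /gam scalerBr scalerBl scale1r [s *: zeta k - _]addrC addrA.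
apply: le_trans (qnormD _ _) _; rewrite (qnormZ (1 - s)) (qnormZ s) zeta_norm (qnormZ r) !ger0_norm ?subr_ge0 ?(ltW r0)//.
have : r * N v <= r by rewrite ler_piMr ?(ltW r0)//; lra.
by nra.
Qed.

(* The sum over a circle shrunk towards r v: C v 0 is f (r v), C v 1 is a
   polynomial in v, and the increments in s are small because the sum of
   zeta k * f' is nearly telescoping. *)
Let C v s : H := nV *: \sum_(k < n) kern v k * f (gam v s k).

Section OneV.
Variables (v : H) (Lv : L v) (v2 : N v <= 1 / 2).
Variables (e dl : R) (e0 : 0 < e) (dl0 : 0 < dl).
Hypothesis hdl : forall z1 z2, K z1 -> K z2 -> N (z2 - z1) < dl ->
  N (f z2 - f z1 - (z2 - z1) * fd z1) <= e * N (z2 - z1).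
Hypothesis hom : N (om - 1) * r < dl.

(** Consecutive points of the shrunk circle differ by s (om - 1) zeta k. Hence s (om - 1) times the
    sum is, up to linearization errors, the telescoping sum of the increments of f around a closed
    polygon, which is 0. *)
Let sum_zeta_fd s : 0 <= s <= 1 ->
  N (\sum_(k < n) zeta k * fd (gam v s k)) <= n%:R * (e * r).
Proof.
move=> s01; have om1 : om != 1.
  apply/eqP => o1; have := @eta_neq1 1; rewrite n1 => /(_ isT) /eqP; apply.
  by have := eta_om 1; rewrite !expr1 o1 mulr1.
have zS k : zeta k.+1 - zeta k = (om - 1) * zeta k.
  by rewrite /zeta -scalerBr -scalerAr mulrBl mul1r exprS.
have gS k : gam v s k.+1 - gam v s k = s *: ((om - 1) * zeta k).
  rewrite /gam opprD addrACA subrr add0r -scalerBr opprB.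
  by rewrite addrA subrK zS.
have gn : gam v s n = gam v s 0 by rewrite /gam /zeta omX expr0.
have zn : zeta n = zeta 0 by rewrite /zeta omX expr0.
have p1 : 0 < N (om - 1) by rewrite qnorm_gt0 subr_eq0.
have /andP[s0 s1] := s01.
(* At s = 0 there is no s to divide by, but all the points coincide and the sum of the roots of
   unity vanishes exactly. *)
move: s0; rewrite le_eqVlt => /orP[/eqP s0|s0].
  have g0 k : gam v s k = r *: v by rewrite /gam -s0 scale0r addr0.
  under eq_bigr do rewrite g0.
  rewrite -mulr_suml.
  suff -> : \sum_(k < n) zeta k = 0.
    by rewrite mul0r qnorm0 !mulr_ge0 ?(ltW e0) ?(ltW r0).
  apply/eqP; have : (om - 1) * \sum_(k < n) zeta k == 0.
    rewrite mulr_sumr; under eq_bigr do rewrite -zS.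
    by rewrite -(big_mkord xpredT (fun k => zeta k.+1 - zeta k)) telescope_sumr// zn subrr.
  by rewrite mulq_eq0 subr_eq0 (negPf om1).
pose E k := f (gam v s k.+1) - f (gam v s k) - (gam v s k.+1 - gam v s k) * fd (gam v s k).
have hE k : N (E k) <= e * (s * (N (om - 1) * r)).
  have -> : s * (N (om - 1) * r) = N (gam v s k.+1 - gam v s k).
    by rewrite gS qnormZ qnormM zeta_norm gtr0_norm.
  apply: hdl; [exact: gamK|exact: gamK|].
  rewrite gS qnormZ qnormM zeta_norm gtr0_norm//; apply: le_lt_trans hom.
  by rewrite ler_piMl// mulr_ge0 ?qnorm_ge0 ?ltW.
have sE : s *: ((om - 1) * \sum_(k < n) zeta k * fd (gam v s k)) = - \sum_(k < n) E k.
  rewrite mulr_sumr scaler_sumr.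
  have -> : \sum_(k < n) E k = \sum_(k < n) (f (gam v s k.+1) - f (gam v s k))
     - \sum_(k < n) s *: ((om - 1) * (zeta k * fd (gam v s k))).
    rewrite -sumrB; apply: eq_bigr => k _; rewrite /E gS.
    by rewrite -scalerAl mulrA.
  rewrite -(big_mkord xpredT (fun k => f (gam v s k.+1) - f (gam v s k))).
  by rewrite telescope_sumr// gn subrr sub0r opprK.
have := congr1 N sE; rewrite qnormN qnormZ qnormM (gtr0_norm s0) => h.
rewrite -(ler_pM2l p1) -(ler_pM2l s0) h; apply: le_trans (qnorm_sum _ _ _) _.
apply: (@le_trans _ _ (\sum_(k < n) e * (s * (N (om - 1) * r)))).
  by apply: ler_sum => k _; exact: hE.
rewrite sumr_const card_ord -[leLHS]mulr_natr.
by rewrite le_eqVlt; apply/orP; left; apply/eqP; ring.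
Qed.

(** The constant 6 is 2 + 4: the factor 1 - v^n, of norm at most 2, times the nearly telescoping
    mean gives 2 r e, and the linearization errors over a displacement of at most 2 r h, weighted by
    kernels of norm at most 2, give 4 r e. *)
Let step s h : 0 <= s -> 0 < h -> s + h <= 1 -> h * (2 * r) < dl ->
  N (C v (s + h) - C v s) <= h * (6 * r * e).
Proof.
move=> s0 h0 s1 hd.
have s01 : 0 <= s <= 1 by rewrite s0/=; lra.
have s02 : 0 <= s + h <= 1 by rewrite s1 andbT addr_ge0// ltW.
have npos : 0 < n%:R :> R by rewrite ltr0n ltnW.
have gB k : gam v (s + h) k - gam v s k = h *: (zeta k - r *: v).
  by rewrite /gam opprD addrACA subrr add0r -scalerBl addrAC subrr add0r.
have zv k : N (zeta k - r *: v) <= 2 * r.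
  rewrite (le_trans (qnormB _ _))// zeta_norm qnormZ gtr0_norm//.
  have v1 : N v <= 1 by move: v2; lra.
  have : r * N v <= r by rewrite ler_piMr ?(ltW r0).
  lra.
pose E k := f (gam v (s + h) k) - f (gam v s k) - (gam v (s + h) k - gam v s k) * fd (gam v s k).
have hE k : N (E k) <= e * (h * (2 * r)).
  have hz : N (gam v (s + h) k - gam v s k) <= h * (2 * r).
    by rewrite gB qnormZ gtr0_norm// ler_pM2l.
  apply: (@le_trans _ _ (e * N (gam v (s + h) k - gam v s k))); last by rewrite ler_pM2l.
  by apply: hdl; [exact: gamK|exact: gamK|exact: le_lt_trans hd].
have -> : C v (s + h) - C v s = nV *: (h *: ((1 - v ^+ n) * \sum_(k < n) zeta k * fd (gam v s k))
    + \sum_(k < n) kern v k * E k).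
  rewrite /C -scalerBr; congr (_ *: _); rewrite -sumrB mulr_sumr scaler_sumr -big_split/=.
  apply: eq_bigr => k _; rewrite -mulrBr mulrA -kern_zeta// /E gB.
  have -> : h *: (kern v k * (zeta k - r *: v) * fd (gam v s k)) =
      kern v k * (h *: (zeta k - r *: v) * fd (gam v s k)).
    by rewrite -!mulrA scalerAr scalerAl.
  by rewrite -mulrDr; congr (_ * _); rewrite [RHS]addrC subrK.
have vn : N (1 - v ^+ n) <= 2.
  rewrite (le_trans (qnormB _ _))// qnorm1 qnormX.
  have : N v ^+ n <= 1 by apply: exprn_ile1; rewrite ?qnorm_ge0//; move: v2; lra.
  lra.
rewrite qnormZ ger0_norm ?invr_ge0 ?ler0n//.
rewrite /nV ler_pdivrMl//.
have h1 := sum_zeta_fd s01.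
have h2 : N (\sum_(k < n) kern v k * E k) <= n%:R * (2 * (e * (h * (2 * r)))).
  apply: le_trans (qnorm_sum _ _ _) _.
  apply: (@le_trans _ _ (\sum_(k < n) 2 * (e * (h * (2 * r))))); last first.
    by rewrite sumr_const card_ord -[leLHS]mulr_natl lexx.
  apply: ler_sum => k _; rewrite qnormM ler_pM ?qnorm_ge0//; exact: kern_norm.
apply: le_trans (qnormD _ _) _; rewrite qnormZ qnormM (gtr0_norm h0).
have h3 : h * (N (1 - v ^+ n) * N (\sum_(k < n) zeta k * fd (gam v s k))) <= h * (2 * (n%:R * (e * r))).
  by rewrite ler_pM2l// ler_pM ?qnorm_ge0.
apply: le_trans (lerD h3 h2) _.
by rewrite le_eqVlt; apply/orP; left; apply/eqP; ring.
Qed.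

Let C0 : C v 0 = f (r *: v).
Proof.
rewrite /C /gam; under eq_bigr do rewrite scale0r addr0.
rewrite -mulr_suml kern_mean// -scaler_nat -scalerAl mul1r scalerA mulVf ?scale1r//.
by rewrite pnatr_eq0 -lt0n ltnW.
Qed.

Let CE1 : C v 1 = \sum_(j < n) v ^+ j * (nV *: \sum_(k < n) (eta ^+ k) ^+ j * f (zeta k)).
Proof.
rewrite /C /gam; under eq_bigr do rewrite scale1r addrC subrK /kern mulr_suml.
rewrite exchange_big/= scaler_sumr; apply: eq_bigr => j _.
rewrite -scalerAr mulr_sumr; congr (_ *: _); apply: eq_bigr => k _.
by rewrite mulrA.
Qed.

Lemma discrete_cauchy1 :
  N (f (r *: v) - \sum_(j < n) v ^+ j * (nV *: \sum_(k < n) (eta ^+ k) ^+ j * f (zeta k)))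
  <= 6 * r * e.
Proof.
rewrite -CE1 -C0.
(* The interval from 0 to 1 is cut into M.+1 steps short enough for [step]. The errors are
   proportional to the lengths, so their sum does not depend on M. *)
have [M hM] : exists M : nat, 2 * r / dl < M.+1%:R.
  exists (Num.bound (2 * r / dl)); apply: lt_le_trans (archi_boundP _) _.
    by rewrite divr_ge0 ?mulr_ge0 ?ltW.
  by rewrite ler_nat.
have Mpos : 0 < M.+1%:R :> R by rewrite ltr0n.
pose h : R := M.+1%:R^-1.
have h0 : 0 < h by rewrite invr_gt0.
have main m : (m <= M.+1)%N -> N (C v 0 - C v (m%:R * h)) <= (m%:R * h) * (6 * r * e).
  elim: m => [|m IH] mM; first by rewrite !mul0r subrr qnorm0.
  apply: le_trans (ler_distqD (C v (m%:R * h)) _ _) _.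
  have -> : m.+1%:R * h = m%:R * h + h by rewrite -[m.+1]addn1 natrD mulrDl mul1r.
  rewrite mulrDl lerD ?IH ?(ltnW mM)// qdistC step//.
  - by rewrite mulr_ge0 ?(ltW h0).
  - by rewrite -[X in _ + X]mul1r -mulrDl natr1 ler_pdivrMr// mul1r ler_nat.
  - by rewrite mulrC ltr_pdivrMr// [ltRHS]mulrC -ltr_pdivrMr.
have := main M.+1 (leqnn _).
by rewrite divff ?gt_eqF// mul1r.
Qed.

End OneV.

Let coef j : H := nV *: \sum_(k < n) (eta ^+ k) ^+ j * f (zeta k).

Lemma coef_norm (A : R) j : (forall z, K z -> N (f z) <= A) -> N (coef j) <= A.
Proof.
move=> hA; rewrite /coef qnormZ ger0_norm ?invr_ge0//.
rewrite /nV ler_pdivrMl ?ltr0n ?(ltnW n1)//; apply: le_trans (qnorm_sum _ _ _) _.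
apply: (@le_trans _ _ (\sum_(k < n) A)); last by rewrite sumr_const card_ord -[leLHS]mulr_natl lexx.
apply: ler_sum => k _; rewrite qnormM !qnormX expi_norm !expr1n mul1r; apply: hA.
by split; [exact: clineZ|rewrite zeta_norm].
Qed.

End OneN.

(** The coefficients are means of values of f on the circle times numbers of norm 1, hence bounded
    uniformly. The order is n.+2 because the telescoping argument divides by om - 1, which requires
    at least two roots of unity. *)
Lemma discrete_cauchy : exists (A : R) (c : nat -> nat -> H), [/\ 0 <= A,
  forall n j, N (c n j) <= A &
  forall e : R, 0 < e -> \forall n \near \oo, forall v, L v -> N v <= 1 / 2 ->
    N (f (r *: v) - \sum_(j < n.+2) v ^+ j * c n j) <= e].
Proof.
have [A hA] := uniform_bound.
exists A, (fun n j => n.+2%:R^-1 *: \sum_(k < n.+2)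
  ((expi (- (pi *+ 2 / n.+2%:R))) ^+ k) ^+ j * f (r *: expi (pi *+ 2 / n.+2%:R) ^+ k)).
split.
- apply: le_trans (hA 0 _); first exact: qnorm_ge0.
  by split; [exact: cline0|rewrite qnorm0 ltW].
- by move=> n j; exact: (@coef_norm n.+2).
- move=> e e0.
  have e1 : 0 < e / (6 * r) by rewrite divr_gt0// mulr_gt0.
  have [dl dl0 hdl] := uniform_deriv e1.
  have [n0 _ hn0] := expi_small (divr_gt0 dl0 r0).
  exists n0 => // n /= n0n v Lv v2.
  have := @discrete_cauchy1 n.+2 isT v Lv v2 _ dl e1 dl0 hdl.
  have -> : 6 * r * (e / (6 * r)) = e by rewrite mulrC mulfVK// mulf_neq0 ?gt_eqF.
  apply; rewrite -ltr_pdivlMr//; apply: hn0 => /=; exact: leqW.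
Qed.

End OneFunction.
End DiscreteCauchy.

(** * Taylor expansions on a slice *)

Section Taylor.
Variable R : realType.
Local Notation H := (quat R).
Local Notation N := (@qnorm R).
Implicit Types (I p q z w v : H) (f g : H -> H).

Lemma ultra_bounded_cvg (U : set_system nat) (A : R) (c : nat -> H) :
  UltraFilter U -> (forall n, N (c n) <= A) -> exists l : H, c @ U --> l.
Proof.
move=> UU cA; have FU := @ultra_proper _ _ UU.
have UF : UltraFilter (c @ U).
  split; first exact: fmap_proper_filter.
  move=> G GF cG; rewrite eqEsubset; split=> // B GB.
  have [//|UB] := in_ultra_setVsetC (c @^-1` B) UU.
  have : G (~` B) by apply: cG.
  move=> /(filterI GB); rewrite setICr => /filter_ex[x []].
have cK : compact ([set z | N z <= A] : set 'rV[R]_4).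
  apply: bounded_closed_compact.
    exists A; split; first exact: num_real.
    move=> M AM z zA; apply: ltW; apply: le_lt_trans AM.
    exact: le_trans (mx_norm_le_qnorm _) zA.
  rewrite -[X in closed X]setCK; apply: open_closedC.
  apply/open_qnormP => p /= /negP; rewrite -ltNge => pA.
  exists (N p - A); first by rewrite subr_gt0.
  by move=> q qp /= qA; have := qnorm_dist_ge p q; rewrite qdistC; lra.
move: cK; rewrite compact_ultra => /(_ (c @ U) UF) [|l [_ hl]]; last by exists l.
by apply: (@filterS _ U _ setT) => [n _|]; [exact: cA|exact: filterT].
Qed.

Lemma geometric_tail (t : R) k n : 0 <= t <= 1 / 2 -> (k <= n)%N ->
  \sum_(k <= j < n) t ^+ j <= 2 * t ^+ k.
Proof.
move=> /andP[t0 t2] kn; have tn : 0 <= t ^+ n by rewrite exprn_ge0.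
(* The subtracted power makes the bound inductive. *)
suff : \sum_(k <= j < n) t ^+ j <= 2 * (t ^+ k - t ^+ n) by lra.
elim: n kn tn => [|n IH] kn tn.
  by move: kn; rewrite leqn0 => /eqP ->; rewrite big_geq// subrr mulr0.
move: kn; rewrite leq_eqVlt => /predU1P[->|kn].
  by rewrite big_geq// subrr mulr0.
rewrite big_nat_recr//=; have tn' : 0 <= t ^+ n by rewrite exprn_ge0.
have := IH kn tn'; have : t ^+ n.+1 <= 1 / 2 * t ^+ n by rewrite exprS ler_wpM2r.
lra.
Qed.

(** A power series is recorded by the remainders of all its partial sums. C is the inverse of a
    radius, and the geometric bound contains both the convergence and the Cauchy estimates for the
    coefficients. *)
Definition taylor I f p (a : nat -> H) (B C : R) := [/\ 0 <= B, 0 < C &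
  forall z, cline I z -> C * N (z - p) <= 1 / 2 -> forall k,
    N (f z - \sum_(j < k) (z - p) ^+ j * a j) <= B * (C * N (z - p)) ^+ k].

Lemma slice_smooth_shift I f p z : imag_units I -> cline I p ->
  slice_smooth I f (p + z) -> slice_smooth I (fun w => f (p + w)) z.
Proof.
move=> hI Lp [d hd]; exists d => e /hd[dl dl0 h]; exists dl => // z1 z2 L1 L2 z1z z2z.
have E w w' : p + w - (p + w') = w - w' by rewrite opprD addrACA subrr add0r.
by rewrite -!(E z2 z1); apply: h; rewrite ?E//; exact: clineD.
Qed.

Lemma taylor_exists I f p (r : R) : imag_units I -> cline I p -> 0 < r ->
  (forall z, cline I z -> N (z - p) <= r -> slice_smooth I f z) ->
  exists a B, taylor I f p a B r^-1.
Proof.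
move=> hI Lp r0 hf.
have [|A [c [A0 cA hc]]] := @discrete_cauchy R I hI (fun w => f (p + w)) r r0.
  move=> z [Lz zr]; apply: slice_smooth_shift => //; apply: hf; first exact: clineD.
  by rewrite addrAC subrr add0r.
(* The Fourier coefficients of the discrete formula only need to converge along
   an ultrafilter, which boundedness provides. *)
have [U [UU oU]] := ultraFilterLemma (eventually_filter : ProperFilter \oo).
have FU := @ultra_proper _ _ UU.
have /choice[l hl] : forall j, exists l : H, (c ^~ j) @ U --> l.
  by move=> j; apply: (ultra_bounded_cvg UU) => n; exact: cA.
have lk (v : H) k (e : R) : N v <= 1 -> 0 < e -> \forall n \near U,
    N (\sum_(j < k) v ^+ j * (c n j - l j)) <= e.
  move=> v1 ; elim: k e => [|k IH] e e0.
    by apply: nearW => n; rewrite big_ord0 qnorm0 ltW.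
  have e2 : 0 < e / 2 by rewrite divr_gt0.
  have /cvg_qnormP/(_ _ e2) h1 := hl k.
  near=> n.
  have h2 : N (\sum_(j < k) v ^+ j * (c n j - l j)) <= e / 2 by near: n; exact: IH.
  have h3 : N (c n k - l k) <= e / 2 by near: n; exact: h1.
  rewrite big_ord_recr/=; apply: le_trans (qnormD _ _) _.
  rewrite (splitr e) lerD// qnormM qnormX.
  have : N v ^+ k <= 1 by rewrite exprn_ile1 ?qnorm_ge0.
  by have := qnorm_ge0 (c n k - l k); nra.
exists (fun j => r^-1 ^+ j *: l j), (2 * A); split.
- by rewrite mulr_ge0.
- by rewrite invr_gt0.
move=> z Lz zr k; pose v := r^-1 *: (z - p).
have Nv : r^-1 * N (z - p) = N v by rewrite /v qnormZ gtr0_norm// invr_gt0.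
have Lv : cline I v by apply: clineZ => //; exact: clineB.
have zE : z = p + r *: v by rewrite /v scalerA divff ?gt_eqF// scale1r addrC subrK.
have -> : \sum_(j < k) (z - p) ^+ j * (r^-1 ^+ j *: l j) = \sum_(j < k) v ^+ j * l j.
  by apply: eq_bigr => j _; rewrite /v exprZn -scalerAl -scalerAr.
rewrite Nv in zr *; rewrite zE.
apply/ler_addgt0Pr => e e0; have e2 : 0 < e / 2 by rewrite divr_gt0.
have v1 : N v <= 1 by lra.
have kU : U [set n | (k <= n.+2)%N].
  by apply: oU; exists k => // n /= kn; rewrite (leq_trans kn)// -addn2 leq_addr.
(* One index is enough: there the polynomial is close to f, the contribution of its first k
   coefficients is close to that of their limits, and the degree bound exceeds k. What remains is
   the tail from degree k on, whose bound gives B = 2 A. *)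
have [n [/= [h1 h2] h3]] := filter_ex (filterI (filterI (lk v k _ v1 e2) (oU _ (hc _ e2))) kU).
have {h2} := h2 v Lv zr; set S := \sum_(j < n.+2) _ => h2.
have SE : S = \sum_(j < k) v ^+ j * c n j + \sum_(k <= j < n.+2) v ^+ j * c n j.
  by rewrite /S -(big_mkord xpredT (fun j => v ^+ j * c n j)) (big_cat_nat (leq0n k) h3)/= big_mkord.
have ht : N (\sum_(k <= j < n.+2) v ^+ j * c n j) <= 2 * A * N v ^+ k.
  apply: le_trans (qnorm_sum _ _ _) _.
  apply: (@le_trans _ _ (\sum_(k <= j < n.+2) A * N v ^+ j)).
    by apply: ler_sum => j _; rewrite qnormM qnormX mulrC ler_wpM2r ?exprn_ge0 ?qnorm_ge0.
  rewrite -mulr_sumr [2 * A]mulrC -mulrA ler_wpM2l// geometric_tail// qnorm_ge0//.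
have -> : f (p + r *: v) - \sum_(j < k) v ^+ j * l j =
  (f (p + r *: v) - S) + \sum_(j < k) v ^+ j * (c n j - l j)
   + \sum_(k <= j < n.+2) v ^+ j * c n j.
  have -> : \sum_(j < k) v ^+ j * (c n j - l j) =
      \sum_(j < k) v ^+ j * c n j - \sum_(j < k) v ^+ j * l j.
    by rewrite -sumrB; apply: eq_bigr => j _; rewrite mulrBr.
  by rewrite SE [RHS]addrAC opprD [f _ + (- _ - _)]addrA subrK addrA subrK.
apply: le_trans (qnormD _ _) _; have := qnormD (f (p + r *: v) - S) (\sum_(j < k) v ^+ j * (c n j - l j)).
lra.
Unshelve. all: by end_near. Qed.

(** At distance 1 / (2 C) from p, the limit of the validity of the expansion, the term of degree j
    is the difference of two consecutive remainders. *)
Lemma taylor_coef_le I f p a B C j : imag_units I -> cline I p ->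
  taylor I f p a B C -> N (a j) <= 2 * B * C ^+ j.
Proof.
move=> hI Lp [B0 C0 h].
pose t : R := (2 * C)^-1; have t0 : 0 < t by rewrite invr_gt0 mulr_gt0.
have Nz : N (p + t%:A - p) = t by rewrite addrAC subrr add0r qnormZ qnorm1 mulr1 gtr0_norm.
have Ct : C * t = 1 / 2.
  by rewrite /t invfM mulrC -mulrA mulVf ?gt_eqF// mulr1 mul1r.
have Lz : cline I (p + t%:A) by apply: clineD => //; exact: clineA.
have := h _ Lz; rewrite Nz Ct => /(_ (lexx _)) h'.
have h1 := h' j; have h2 := h' j.+1.
have : N ((p + t%:A - p) ^+ j * a j) <= B * (1 / 2) ^+ j + B * (1 / 2) ^+ j.+1.
  move: h2; rewrite big_ord_recr/=; set S := \sum_(i < j) _ in h1 *; set X := (_ ^+ j * _).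
  move=> h2; have -> : X = (f (p + t%:A) - S) - (f (p + t%:A) - (S + X)).
    by rewrite opprB addrA [f _ - S + _]addrA subrK [_ + X]addrC addrK.
  by rewrite (le_trans (qnormB _ _))// lerD.
rewrite qnormM qnormX Nz => h3.
have tj : (t * C) ^+ j = (1 / 2) ^+ j by rewrite mulrC Ct.
rewrite -(ler_pM2l (exprn_gt0 j t0)); apply: le_trans h3 _.
rewrite mulrCA -exprMn tj exprS; have : 0 <= (1 / 2 : R) ^+ j by rewrite exprn_ge0.
nra.
Qed.

Lemma taylor_value I f p a B C : imag_units I -> cline I p ->
  taylor I f p a B C -> f p = a 0%N.
Proof.
move=> hI Lp [B0 C0 h]; have := h p Lp; rewrite subrr qnorm0 mulr0.
have h2 : (0 : R) <= 1 / 2 by lra.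
move=> /(_ h2 1%N); rewrite big_ord1 expr0 mul1r expr1 mulr0 => h1.
by apply/eqP; rewrite -subr_eq0 -qnorm_eq0 eq_le h1 qnorm_ge0.
Qed.

Lemma taylor_zero I f p a B C : taylor I f p a B C -> (forall j, a j = 0) ->
  forall z, cline I z -> C * N (z - p) <= 1 / 2 -> f z = 0.
Proof.
move=> [B0 C0 h] a0 z Lz zC; apply/eqP; rewrite -qnorm_eq0 eq_le qnorm_ge0 andbT.
have t0 : 0 <= C * N (z - p) by rewrite mulr_ge0 ?qnorm_ge0// ltW.
have hk k : N (f z) <= B * (1 / 2) ^+ k.
  have := h z Lz zC k; rewrite big1 => [|j _]; last by rewrite a0 mulr0.
  rewrite subr0 => /le_trans; apply; rewrite ler_wpM2l// lerXn2r ?nnegrE//; lra.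
have c : (fun k => B * (1 / 2 : R) ^+ k) @ \oo --> (B * 0 : R).
  by apply: cvgMl_tmp; apply: cvg_expr; rewrite ger0_norm//; lra.
rewrite mulr0 in c.
rewrite -(cvg_lim _ c)//; apply: limr_ge; first exact: cvgP c.
exact: nearW.
Qed.

(* The value l at p is meant to be the first nonzero Taylor coefficient. *)
Definition divp f p (m : nat) (l : H) z := if z == p then l else (z - p) ^- m * f z.

(** The first summand of the new bound comes from dividing the remainder of order m + k by (z -
    p)^m; the second bounds the coefficient [a m], and is needed at z = p for k = 0. *)
Lemma taylor_divp I f p a B C m : imag_units I -> cline I p -> taylor I f p a B C ->
  (forall j, (j < m)%N -> a j = 0) ->
  taylor I (divp f p m (a m)) p (fun j => a (j + m)%N) (B * C ^+ m + 2 * B * C ^+ m) C.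
Proof.
move=> hI Lp ht a0; have [B0 C0 h] := ht; split=> //.
  by rewrite addr_ge0// !mulr_ge0// exprn_ge0// ltW.
have Cm : 0 <= C ^+ m by rewrite exprn_ge0// ltW.
move=> z Lz zC k; rewrite /divp; have [->|zp] := eqVneq z p.
  rewrite subrr qnorm0 mulr0.
  case: k => [|k].
    rewrite big_ord0 subr0 expr0 mulr1 (le_trans (taylor_coef_le m hI Lp ht))//.
    by rewrite lerDr mulr_ge0.
  rewrite big_ord_recl expr0 mul1r add0n big1 => [|j _]; last by rewrite exprS !mul0r.
  by rewrite addr0 subrr qnorm0 expr0n/= mulr0.
have d0 : z - p != 0 by rewrite subr_eq0.
have := h z Lz zC (m + k)%N.
rewrite big_split_ord/= big1 ?add0r => [|j _]; last by rewrite a0// mulr0.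
have E : f z - \sum_(i < k) (z - p) ^+ (m + i) * a (m + i)%N =
  (z - p) ^+ m * ((z - p) ^- m * f z - \sum_(j < k) (z - p) ^+ j * a (j + m)%N).
  rewrite mulrBr mulrA mulqV ?expq_eq0 ?(negPf d0) ?andbF// mul1r mulr_sumr.
  by congr (_ - _); apply: eq_bigr => j _; rewrite exprD mulrA addnC.
rewrite E qnormM qnormX.
have dm : 0 < N (z - p) ^+ m by rewrite exprn_gt0// qnorm_gt0.
have -> : B * (C * N (z - p)) ^+ (m + k) =
    N (z - p) ^+ m * (B * C ^+ m * (C * N (z - p)) ^+ k).
  by rewrite exprD exprMn; ring.
rewrite ler_pM2l// => /le_trans; apply.
rewrite ler_wpM2r ?exprn_ge0 ?mulr_ge0 ?qnorm_ge0 ?(ltW C0)//.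
by rewrite lerDl !mulr_ge0.
Qed.

Lemma divpE f p m l z : z != p -> divp f p m l z = (z - p) ^- m * f z.
Proof. by rewrite /divp => /negPf ->. Qed.

(* A Taylor bound gives strict differentiability at the center only; this is
   all that is needed for removing singularities, as the other points are
   covered by the quotient rule. *)
Lemma taylor_smooth I f p a B C : imag_units I -> cline I p -> taylor I f p a B C ->
  slice_deriv I f p (a 1%N).
Proof.
move=> hI Lp ht e e0; have [B0 C0 h] := ht.
(* Degree j contributes at most 8 B C (2 C t)^(j-1) times the increment, where j <= 4 * 2^(j-1)
   absorbs the factor j from differentiation; summing from degree 2 on gives 32 B C^2 t. The 1 keeps
   the divisor positive. *)
have K0 : 0 < 32 * B * C ^+ 2 + 1.
  by rewrite ltr_pwDr// mulr_ge0 ?sqr_ge0// mulr_ge0.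
pose dl := Num.min (1 / (4 * C)) (e / (32 * B * C ^+ 2 + 1)).
exists dl; first by rewrite lt_min !divr_gt0// mulr_gt0.
move=> z1 z2 L1 L2; rewrite !lt_min => /andP[z1C z1e] /andP[z2C z2e].
pose t := Num.max (N (z1 - p)) (N (z2 - p)).
have t1 : N (z1 - p) <= t by rewrite le_max lexx.
have t2 : N (z2 - p) <= t by rewrite le_max lexx orbT.
have t0 : 0 <= t by rewrite (le_trans _ t1)// qnorm_ge0.
have tC : C * t <= 1 / 4.
  have : t <= 1 / (4 * C) by rewrite ge_max !ltW.
  by rewrite ler_pdivlMr ?mulr_gt0//; lra.
have te : (32 * B * C ^+ 2 + 1) * t <= e.
  have : t <= e / (32 * B * C ^+ 2 + 1) by rewrite ge_max !ltW.
  by rewrite ler_pdivlMr// mulrC.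
have hC z : N (z - p) <= t -> C * N (z - p) <= 1 / 4.
  by move=> zt; rewrite (le_trans _ tC)// ler_pM2l.
set d := z2 - z1.
have pw j : N ((z2 - p) ^+ j - (z1 - p) ^+ j) <= j%:R * t ^+ j.-1 * N d.
  elim: j => [|j IH]; first by rewrite !expr0 subrr qnorm0 !mul0r.
  have -> : (z2 - p) ^+ j.+1 - (z1 - p) ^+ j.+1 =
     (z2 - p) * ((z2 - p) ^+ j - (z1 - p) ^+ j) + d * (z1 - p) ^+ j.
    have -> : d = (z2 - p) - (z1 - p) by rewrite opprB addrA subrK.
    by rewrite [in RHS]mulrBr [X in _ = _ + X]mulrBl -!exprS addrA subrK.
  apply: le_trans (qnormD _ _) _; rewrite !qnormM qnormX/=.
  have h1 : N (z2 - p) * N ((z2 - p) ^+ j - (z1 - p) ^+ j) <= t * (j%:R * t ^+ j.-1 * N d).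
    by rewrite ler_pM ?qnorm_ge0.
  have h2 : N d * N (z1 - p) ^+ j <= N d * t ^+ j.
    by rewrite ler_wpM2l ?qnorm_ge0// lerXn2r ?nnegrE ?qnorm_ge0.
  apply: le_trans (lerD h1 h2) _; rewrite -natr1 le_eqVlt; apply/orP; left; apply/eqP.
  case: j {IH h1 h2} => [|j]; rewrite /= ?exprS; ring.
have pw2 (j : nat) : (2 <= j)%N ->
    N (((z2 - p) ^+ j - (z1 - p) ^+ j) * a j) <= 8 * B * C * N d * (2 * (C * t)) ^+ j.-1.
  move=> j2; rewrite qnormM.
  apply: le_trans (ler_pM (qnorm_ge0 _) (qnorm_ge0 _) (pw j) (taylor_coef_le j hI Lp ht)) _.
  have j2n : j%:R <= 4 * 2 ^+ j.-1 :> R.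
    rewrite -natrX -natrM ler_nat; case: j j2 => // j _ /=.
    by apply: leq_trans (ltn_expl j (isT : (1 < 2)%N)) _; rewrite leq_pmull.
  case: j j2 j2n => [//|j] _ /= j2n.
  have : 0 <= (4 * 2 ^+ j - j.+1%:R) * (2 * B * C * N d * (C * t) ^+ j).
    by rewrite mulr_ge0 ?subr_ge0// !mulr_ge0 ?qnorm_ge0 ?exprn_ge0 ?mulr_ge0// ltW.
  by rewrite exprS !exprMn; lra.
have tail k : N (\sum_(2 <= j < k.+2) ((z2 - p) ^+ j - (z1 - p) ^+ j) * a j) <= e * N d.
  apply: le_trans (qnorm_sum _ _ _) _.
  apply: (@le_trans _ _ (\sum_(2 <= j < k.+2) 8 * B * C * N d * (2 * (C * t)) ^+ j.-1)).
    by apply: ler_sum_nat => j /andP[j2 _]; exact: pw2.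
  rewrite big_add1/= -mulr_sumr.
  have ct : 0 <= 2 * (C * t) <= 1 / 2 by rewrite !mulr_ge0 ?(ltW C0)//=; lra.
  have := geometric_tail ct (isT : (1 <= k.+1)%N) => hg.
  have BC : 0 <= 8 * B * C * N d by rewrite !mulr_ge0 ?qnorm_ge0// ltW.
  apply: le_trans (ler_wpM2l BC hg) _.
  have : 0 <= (e - (32 * B * C ^+ 2 + 1) * t) * N d by rewrite mulr_ge0 ?qnorm_ge0 ?subr_ge0.
  have : 0 <= t * N d by rewrite mulr_ge0 ?qnorm_ge0.
  rewrite expr1 expr2; lra.
have C2 z : N (z - p) <= t -> C * N (z - p) <= 1 / 2 by move=> /hC; lra.
pose S z k := \sum_(j < k) (z - p) ^+ j * a j.
have Sd k : S z2 k.+2 - S z1 k.+2 =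
    d * a 1%N + \sum_(2 <= j < k.+2) ((z2 - p) ^+ j - (z1 - p) ^+ j) * a j.
  rewrite /S -sumrB -(big_mkord xpredT (fun j => (z2 - p) ^+ j * a j - (z1 - p) ^+ j * a j)).
  rewrite big_nat_recl// big_nat_recl// !expr0 subrr add0r expr1 -mulrBl; congr (_ + _).
    by congr (_ * _); rewrite opprB addrA subrK.
  by rewrite !big_add1/=; apply: eq_bigr => j _; rewrite mulrBl.
(* The remainders at z1 and z2 are not proportional to the increment; they disappear only when k
   tends to infinity. *)
have hk k : N (f z2 - f z1 - d * a 1%N) <= e * N d + 2 * B * (1 / 2) ^+ k.
  have r1 := h z1 L1 (C2 _ t1) k.+2; have r2 := h z2 L2 (C2 _ t2) k.+2.
  have P z : N (z - p) <= t -> (C * N (z - p)) ^+ k.+2 <= (1 / 2) ^+ k.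
    move=> zt; have x0 : 0 <= C * N (z - p) by rewrite mulr_ge0 ?qnorm_ge0 ?(ltW C0).
    apply: (@le_trans _ _ ((1 / 2) ^+ k.+2)).
      by rewrite lerXn2r ?nnegrE//; exact: C2.
    have k0 : 0 <= (1 / 2 : R) ^+ k by rewrite exprn_ge0.
    by rewrite !exprS; lra.
  have -> : f z2 - f z1 - d * a 1%N = (f z2 - S z2 k.+2) - (f z1 - S z1 k.+2) +
      \sum_(2 <= j < k.+2) ((z2 - p) ^+ j - (z1 - p) ^+ j) * a j.
    have -> : \sum_(2 <= j < k.+2) ((z2 - p) ^+ j - (z1 - p) ^+ j) * a j =
      S z2 k.+2 - S z1 k.+2 - d * a 1%N by rewrite Sd [RHS]addrC addKr.
    rewrite [RHS]addrA; congr (_ - _).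
    by rewrite opprB [RHS]addrAC [X in _ = X + _]addrA subrK addrA subrK.
  have B1 : B * (C * N (z1 - p)) ^+ k.+2 <= B * (1 / 2) ^+ k by rewrite ler_wpM2l// P.
  have B2 : B * (C * N (z2 - p)) ^+ k.+2 <= B * (1 / 2) ^+ k by rewrite ler_wpM2l// P.
  apply: le_trans (qnormD _ _) _; have := tail k.
  have := qnormB (f z2 - S z2 k.+2) (f z1 - S z1 k.+2).
  rewrite /S in r1 r2 *; lra.
have c : (fun k => e * N d + 2 * B * (1 / 2 : R) ^+ k) @ \oo --> (e * N d + 2 * B * 0 : R).
  apply: cvgD; first exact: cvg_cst.
  by apply: cvgMl_tmp; apply: cvg_expr; rewrite ger0_norm//; lra.
rewrite mulr0 addr0 in c.
rewrite -(cvg_lim _ c)//; apply: limr_ge; first exact: cvgP c.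
exact: nearW.
Qed.

End Taylor.

(** * Slice calculus and the identity principle *)

Section Calculus.
Variable R : realType.
Local Notation H := (quat R).
Local Notation N := (@qnorm R).
Implicit Types (I J p q z w v : H) (f g F : H -> H).

Lemma slice_smooth_near I f g p : cline I p ->
  (exists2 d : R, 0 < d & forall z, cline I z -> N (z - p) < d -> f z = g z) ->
  slice_smooth I f p -> slice_smooth I g p.
Proof.
move=> Lp [d d0 fg] [a ha]; exists a => e /ha[dl dl0 h].
exists (Num.min d dl); first by rewrite lt_min d0.
move=> z1 z2 L1 L2; rewrite !lt_min => /andP[a1 b1] /andP[a2 b2].
by rewrite -!fg//; exact: h.
Qed.

Lemma slice_smooth_cst I p c : slice_smooth I (cst c) p.
Proof.
exists 0 => e e0; exists 1 => // z1 z2 _ _ _ _.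
by rewrite /cst subrr mulr0 subrr qnorm0 mulr_ge0 ?qnorm_ge0// ltW.
Qed.

Lemma slice_smooth_id I p : slice_smooth I id p.
Proof.
exists 1 => e e0; exists 1 => // z1 z2 _ _ _ _.
by rewrite mulr1 subrr qnorm0 mulr_ge0 ?qnorm_ge0// ltW.
Qed.

Lemma slice_smoothD I f g p : slice_smooth I f p -> slice_smooth I g p ->
  slice_smooth I (fun z => f z + g z) p.
Proof.
move=> [a ha] [b hb]; exists (a + b) => e e0; have e2 : 0 < e / 2 by rewrite divr_gt0.
have [d1 d10 h1] := ha _ e2; have [d2 d20 h2] := hb _ e2.
exists (Num.min d1 d2); first by rewrite lt_min d10.
move=> z1 z2 L1 L2; rewrite !lt_min => /andP[a1 b1] /andP[a2 b2].
have -> : f z2 + g z2 - (f z1 + g z1) - (z2 - z1) * (a + b) =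
   (f z2 - f z1 - (z2 - z1) * a) + (g z2 - g z1 - (z2 - z1) * b).
  by rewrite mulrDr !opprD [RHS]addrACA; congr (_ + _); rewrite addrACA.
apply: le_trans (qnormD _ _) _.
have := h1 z1 z2 L1 L2 a1 a2; have := h2 z1 z2 L1 L2 b1 b2; lra.
Qed.

Lemma slice_smooth_mulr I f p c : slice_smooth I f p -> slice_smooth I (fun z => f z * c) p.
Proof.
move=> [a ha]; exists (a * c) => e e0.
have c0 : 0 < N c + 1 by have := qnorm_ge0 c; lra.
have [d d0 h] := ha (e / (N c + 1)) (divr_gt0 e0 c0).
exists d => // z1 z2 L1 L2 a1 a2.
rewrite mulrA -!mulrBl qnormM.
have := h z1 z2 L1 L2 a1 a2; have c1 := qnorm_ge0 c => h1.
apply: le_trans (ler_wpM2r c1 h1) _.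
set k := e / _; have ke : k * (N c + 1) = e by rewrite mulfVK ?gt_eqF.
have : 0 <= k * N (z2 - z1) by rewrite mulr_ge0 ?qnorm_ge0// divr_ge0 ?ltW.
by rewrite -ke; lra.
Qed.

Lemma slice_smoothN I f p : slice_smooth I f p -> slice_smooth I (fun z => - f z) p.
Proof.
move=> h; have := @slice_smooth_mulr I f p (-1) h.
by have -> : (fun z => f z * -1) = (fun z => - f z) by apply: funext => z; rewrite mulrN1.
Qed.

Lemma slice_smoothB I f g p : slice_smooth I f p -> slice_smooth I g p ->
  slice_smooth I (fun z => f z - g z) p.
Proof. by move=> hf hg; apply: slice_smoothD => //; exact: slice_smoothN. Qed.

Definition slice_isom J I (tau : H -> H) := [/\ forall z, cline J z -> cline I (tau z),
  forall z w, cline J z -> cline J w -> tau (z - w) = tau z - tau w &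
  forall z, cline J z -> N (tau z) = N z].

(* The twist [F z * tau v = v * F z] makes the increments of [g \o tau] come
   out on the left of the product; it covers products (tau = id), regular
   products (tau = conjugation, F anticommuting with the unit of the slice) and
   the representation formula (F constant, tau changing the slice). *)
Lemma slice_smooth_twist J I (tau F g : H -> H) p : imag_units J -> imag_units I ->
  slice_isom J I tau -> cline J p -> slice_smooth J F p -> slice_smooth I g (tau p) ->
  (exists2 d : R, 0 < d & forall z v, cline J z -> N (z - p) < d -> cline J v ->
     F z * tau v = v * F z) ->
  slice_smooth J (fun z => F z * g (tau z)) p.
Proof.
move=> hJ hI [tL tB tN] Lp hF hg [d0 d00 tw].
have [a ha] := hF; have [b hb] := hg.
exists (a * g (tau p) + F p * b) => e e0.
pose K : R := N (g (tau p)) + N a + N (F p) + N b + 3.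
have [k1 k2 k3 k4] : [/\ 0 <= N (g (tau p)), 0 <= N a, 0 <= N (F p) & 0 <= N b].
  by split; exact: qnorm_ge0.
have K0 : 0 < K by rewrite /K; lra.
pose e1 := Num.min 1 (e / K).
have e10 : 0 < e1 by rewrite lt_min ltr01 divr_gt0.
have e11 : e1 <= 1 by rewrite ge_min lexx.
have e1K : K * e1 <= e by rewrite mulrC -ler_pdivlMr// ge_min lexx orbT.
have [d1 d10 h1] := ha _ e10; have [d2 d20 h2] := hb _ e10.
have [d3 d30 h3] := slice_smooth_continuous hJ Lp hF e10.
have [d4 d40 h4] := slice_smooth_continuous hI (tL _ Lp) hg e10.
exists (Num.min d0 (Num.min (Num.min d1 d2) (Num.min d3 d4))).
  by rewrite !lt_min d00 d10 d20 d30 d40.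
move=> z1 z2 L1 L2; rewrite !lt_min.
move=> /andP[x0 /andP[/andP[x1 x2] /andP[x3 x4]]] /andP[y0 /andP[/andP[y1 y2] /andP[y3 y4]]].
have T1 : N (tau z1 - tau p) = N (z1 - p) by rewrite -tB// tN//; exact: clineB.
have T2 : N (tau z2 - tau p) = N (z2 - p) by rewrite -tB// tN//; exact: clineB.
have T12 : tau z2 - tau z1 = tau (z2 - z1) by rewrite tB.
have L12 : cline J (z2 - z1) by exact: clineB.
have NT : N (tau (z2 - z1)) = N (z2 - z1) by rewrite tN.
have H1 := h1 z1 z2 L1 L2 x1 y1.
have H2 := h2 (tau z1) (tau z2) (tL _ L1) (tL _ L2).
rewrite T1 T2 T12 NT in H2; have {}H2 := H2 x2 y2.
have H3 := h3 z1 L1 x3.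
have H4 := h4 (tau z2) (tL _ L2); rewrite T2 in H4; have {}H4 := H4 y4.
have -> : F z2 * g (tau z2) - F z1 * g (tau z1) -
   (z2 - z1) * (a * g (tau p) + F p * b) =
  (F z2 - F z1 - (z2 - z1) * a) * g (tau z2) +
  (z2 - z1) * a * (g (tau z2) - g (tau p)) +
  F z1 * (g (tau z2) - g (tau z1) - tau (z2 - z1) * b) +
  (z2 - z1) * ((F z1 - F p) * b).
  rewrite (mulrBr (F z1)) (mulrBr (F z1)) (mulrA (F z1)) tw//.
  rewrite (mulrBr ((z2 - z1) * a)) [(F z1 - F p) * b]mulrBl (mulrBr (z2 - z1) (F z1 * b)).
  rewrite [(F z2 - _ - _) * _]mulrBl [(F z2 - _) * _]mulrBl mulrDr !mulrA.
  move: (F z2 * g (tau z2)) (F z1 * g (tau z2)) (F z1 * g (tau z1)) => x1' x2' x3'.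
  move: ((z2 - z1) * a * g (tau p)) ((z2 - z1) * a * g (tau z2)) ((z2 - z1) * F z1 * b)
    ((z2 - z1) * F p * b) => x4' x5' x6' x7'.
  by apply: quatP; rewrite !qcoordE; split; ring.
have B1 : N ((F z2 - F z1 - (z2 - z1) * a) * g (tau z2)) <= e1 * N (z2 - z1) * (N (g (tau p)) + 1).
  rewrite qnormM ler_pM ?qnorm_ge0//.
  have := qnorm_dist_ge (g (tau z2)) (g (tau p)); lra.
have B2 : N ((z2 - z1) * a * (g (tau z2) - g (tau p))) <= N (z2 - z1) * N a * e1.
  by rewrite !qnormM ler_wpM2l ?mulr_ge0 ?qnorm_ge0.
have B3 : N (F z1 * (g (tau z2) - g (tau z1) - tau (z2 - z1) * b)) <= (N (F p) + 1) * (e1 * N (z2 - z1)).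
  rewrite qnormM ler_pM ?qnorm_ge0//.
  have := qnorm_dist_ge (F z1) (F p); lra.
have B4 : N ((z2 - z1) * ((F z1 - F p) * b)) <= N (z2 - z1) * (e1 * N b).
  by rewrite !qnormM ler_wpM2l ?qnorm_ge0// ler_wpM2r ?qnorm_ge0.
apply: le_trans (qnormD _ _) _; apply: le_trans (lerD (qnormD _ _) B4) _.
apply: le_trans (lerD (lerD (qnormD _ _) B3) (lexx _)) _.
have : K * e1 * N (z2 - z1) <= e * N (z2 - z1) by rewrite ler_wpM2r ?qnorm_ge0.
have : 0 <= e1 * N (z2 - z1) by rewrite mulr_ge0 ?qnorm_ge0 ?ltW.
rewrite /K; lra.
Qed.

Lemma slice_isom_id I : slice_isom I I id.
Proof. by split. Qed.

Lemma slice_isom_conj I : imag_units I -> slice_isom I I (@qconj R).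
Proof.
move=> hI; split=> [z|z w _ _|z _]; [exact: cline_conj|exact: qconjB|exact: qnorm_conj].
Qed.

(** The increment, which stands on the left, has to cross F in order to reach g; this is why F must
    stay in the slice near p. *)
Lemma slice_smoothM I F g p : imag_units I -> cline I p ->
  slice_smooth I F p -> slice_smooth I g p ->
  (exists2 d : R, 0 < d & forall z, cline I z -> N (z - p) < d -> cline I (F z)) ->
  slice_smooth I (fun z => F z * g z) p.
Proof.
move=> hI Lp hF hg [d d0 hd].
apply: (slice_smooth_twist hI hI (slice_isom_id I) Lp hF hg).
by exists d => // z v Lz zp Lv; apply: (cline_comm hI) => //; exact: hd.
Qed.

Lemma slice_smoothX I p q n : imag_units I -> cline I p -> cline I q ->
  slice_smooth I (fun z => (z - q) ^+ n) p.
Proof.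
move=> hI Lp Lq.
have h1 : slice_smooth I (fun z => z - q) p.
  by apply: slice_smoothB; [exact: slice_smooth_id|exact: slice_smooth_cst].
elim: n => [|n IH]; first exact: slice_smooth_cst.
have -> : (fun z => (z - q) ^+ n.+1) = (fun z => (z - q) * (z - q) ^+ n).
  by apply: funext => z; rewrite exprS.
by apply: slice_smoothM => //; exists 1 => // z Lz _; exact: clineB.
Qed.

Lemma slice_smoothV I F p : imag_units I -> cline I p ->
  slice_smooth I F p -> F p != 0 ->
  (exists2 d : R, 0 < d & forall z, cline I z -> N (z - p) < d -> cline I (F z)) ->
  slice_smooth I (fun z => (F z)^-1) p.
Proof.
move=> hI Lp hF Fp [d0 d00 FL].
have np : 0 < N (F p) by rewrite qnorm_gt0.
have cV (e : R) : 0 < e -> exists2 d : R, 0 < d & forall z, cline I z -> N (z - p) < d ->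
    F z != 0 /\ N ((F z)^-1 - (F p)^-1) <= e.
  move=> e0.
  have e1 : 0 < Num.min (N (F p) / 2) (e * (N (F p) * (N (F p) / 2))).
    by rewrite lt_min divr_gt0//= !mulr_gt0.
  have [d d0' h] := slice_smooth_continuous hI Lp hF e1.
  exists d => // z Lz zp; move: (h z Lz zp); rewrite le_min => /andP[z1 z2].
  have Nz : N (F p) / 2 <= N (F z).
    by have := qnorm_dist_ge (F p) (F z); rewrite qdistC; lra.
  have Fz : F z != 0 by rewrite -qnorm_gt0; lra.
  split=> //.
  have -> : (F z)^-1 - (F p)^-1 = (F z)^-1 * (F p - F z) * (F p)^-1.
    by rewrite mulrBr mulVq// mulrBl mul1r -mulrA mulqV// mulr1.
  rewrite !qnormM !qnormV ler_pdivrMr// mulrC ler_pdivrMr ?qnorm_gt0//.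
  rewrite qdistC; apply: le_trans z2 _.
  rewrite -mulrA ler_pM2l// ler_pM2l//.
have [a ha] := hF.
exists (- ((F p)^-1 * (F p)^-1) * a) => e e0.
pose up := (F p)^-1; pose M : R := N up + 1.
have M0 : 0 <= N up by exact: qnorm_ge0.
pose K : R := M * M + 2 * M * N a + 1.
have na := qnorm_ge0 a.
have K0 : 0 < K by rewrite /K /M; nra.
pose e1 := Num.min 1 (e / K).
have e10 : 0 < e1 by rewrite lt_min ltr01 divr_gt0.
have e11 : e1 <= 1 by rewrite ge_min lexx.
have e1K : K * e1 <= e by rewrite mulrC -ler_pdivlMr// ge_min lexx orbT.
have [d1 d10 h1] := ha _ e10; have [d2 d20 h2] := cV _ e10.
exists (Num.min d0 (Num.min d1 d2)); first by rewrite !lt_min d00 d10 d20.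
move=> z1 z2 L1 L2; rewrite !lt_min => /andP[x0 /andP[x1 x2]] /andP[y0 /andP[y1 y2]].
have [F1 V1] := h2 z1 L1 x2; have [F2 V2] := h2 z2 L2 y2.
have H1 := h1 z1 z2 L1 L2 x1 y1.
rewrite -/up in V1 V2 *; set u1 := (F z1)^-1 in V1 *; set u2 := (F z2)^-1 in V2 *.
have Lu1 : cline I u1 by apply: clineV => //; exact: FL.
have Lu2 : cline I u2 by apply: clineV => //; exact: FL.
have -> : u2 - u1 - (z2 - z1) * (- (up * up) * a) =
   - (u2 * u1 * (F z2 - F z1 - (z2 - z1) * a)) - (z2 - z1) * ((u2 * u1 - up * up) * a).
  have E : u2 - u1 = - (u2 * u1 * (F z2 - F z1)).
    rewrite mulrBr.
    have -> : u2 * u1 * F z2 = u1.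
      by rewrite -mulrA (cline_comm hI Lu1 (FL _ L2 y0)) mulrA /u2 mulVq// mul1r.
    by rewrite -mulrA /u1 mulVq// mulr1 opprB.
  have C : u2 * u1 * (z2 - z1) = (z2 - z1) * (u2 * u1).
    by apply: (cline_comm hI); [exact: clineM|exact: clineB].
  rewrite E (mulrBr (u2 * u1) _ (_ * a)) (mulrA (u2 * u1)) C mulrA.
  rewrite [(u2 * u1 - _) * a]mulrBl (mulrBr (z2 - z1) (u2 * u1 * a)) mulrN mulNr !mulrA.
  move: (u2 * u1 * (F z2 - F z1)) ((z2 - z1) * u2 * u1 * a) ((z2 - z1) * up * up * a) => x1' x2' x3'.
  by apply: quatP; rewrite !qcoordE; split; ring.
have n1 : N u1 <= M by have := qnorm_dist_ge u1 up; rewrite /M; lra.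
have n2 : N u2 <= M by have := qnorm_dist_ge u2 up; rewrite /M; lra.
have n3 : N (u2 * u1 - up * up) <= 2 * M * e1.
  have -> : u2 * u1 - up * up = (u2 - up) * u1 + up * (u1 - up).
    by rewrite mulrBl mulrBr addrA subrK.
  apply: le_trans (qnormD _ _) _; rewrite !qnormM.
  have a1 : N (u2 - up) * N u1 <= e1 * M by rewrite ler_pM ?qnorm_ge0.
  have a2 : N up * N (u1 - up) <= M * e1 by rewrite ler_pM ?qnorm_ge0// /M; lra.
  lra.
apply: le_trans (qnormB _ _) _; rewrite qnormN !qnormM.
have B1 : N u2 * N u1 * N (F z2 - F z1 - (z2 - z1) * a) <= M * M * (e1 * N (z2 - z1)).
  by rewrite ler_pM ?mulr_ge0 ?qnorm_ge0// ler_pM ?qnorm_ge0.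
have B2 : N (z2 - z1) * (N (u2 * u1 - up * up) * N a) <= N (z2 - z1) * (2 * M * e1 * N a).
  by rewrite ler_wpM2l ?qnorm_ge0// ler_wpM2r.
apply: le_trans (lerD B1 B2) _.
have : K * e1 * N (z2 - z1) <= e * N (z2 - z1) by rewrite ler_wpM2r ?qnorm_ge0.
have : 0 <= e1 * N (z2 - z1) by rewrite mulr_ge0 ?qnorm_ge0 ?ltW.
rewrite /K; lra.
Qed.

Lemma taylor_dichotomy I f p a B C : taylor I f p a B C ->
  (forall z, cline I z -> C * N (z - p) <= 1 / 2 -> f z = 0) \/
  exists m, (forall j, (j < m)%N -> a j = 0) /\ a m != 0.
Proof.
move=> ht; have [a0|/existsNP[n /eqP an]] := pselect (forall j, a j = 0).
  by left; exact: taylor_zero ht a0.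
right; have ex : exists n, a n != 0 by exists n.
exists (ex_minn ex); case: ex_minnP => m am mmin; split=> // j jm.
by apply/eqP; apply: contraTT jm => aj; rewrite -leqNgt; exact: mmin.
Qed.

Lemma smooth_neq0_near I f p : imag_units I -> cline I p -> slice_smooth I f p -> f p != 0 ->
  exists2 d : R, 0 < d & forall z, cline I z -> N (z - p) < d -> f z != 0.
Proof.
move=> hI Lp hf fp; have h0 : 0 < N (f p) / 2 by rewrite divr_gt0// qnorm_gt0.
have [d d0 h] := slice_smooth_continuous hI Lp hf h0; exists d => // z Lz zp.
have := h z Lz zp; have := qnorm_dist_ge (f p) (f z); rewrite qdistC -qnorm_gt0.
lra.
Qed.

Lemma taylor_neq0_near I f p a B C m : imag_units I -> cline I p ->
  taylor I f p a B C -> (forall j, (j < m)%N -> a j = 0) -> a m != 0 ->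
  exists2 d : R, 0 < d & forall z, cline I z -> 0 < N (z - p) < d -> f z != 0.
Proof.
move=> hI Lp ht a0 am; have hs := taylor_smooth hI Lp (taylor_divp hI Lp ht a0).
have [||d d0 h] := @smooth_neq0_near I (divp f p m (a m)) p hI Lp; first by eexists; exact: hs.
  by rewrite /divp eqxx.
exists d => // z Lz /andP[z0 zd]; have := h z Lz zd.
rewrite divpE; last by rewrite -subr_eq0 -qnorm_gt0.
by apply: contra_neq => ->; rewrite mulr0.
Qed.

Lemma open_taylor I W f p : imag_units I -> open W -> W p -> cline I p ->
  (forall z, W z -> cline I z -> slice_smooth I f z) ->
  exists a B C, taylor I f p a B C.
Proof.
move=> hI /open_qnormP oW Wp Lp hf; have [d d0 h] := oW p Wp.
have d2 : 0 < d / 2 by rewrite divr_gt0.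
have [|a [B hB]] := @taylor_exists R I f p (d / 2) hI Lp d2.
  by move=> z Lz zd; apply: hf => //; apply: h; lra.
by exists a, B, (d / 2)^-1.
Qed.

(** By the Taylor expansion, around each point f either vanishes on a disc or has no zero on a
    punctured disc. Hence vanishing nearby is a relatively open and closed condition, and it holds
    at p because the zeros accumulate there. *)
Lemma identity_principle I W f p : imag_units I -> open W -> connected (W `&` cline I) ->
  (forall z, W z -> cline I z -> slice_smooth I f z) -> W p -> cline I p ->
  (forall d : R, 0 < d -> exists2 z, cline I z & 0 < N (z - p) < d /\ f z = 0) ->
  forall z, W z -> cline I z -> f z = 0.
Proof.
move=> hI oW cW hf Wp Lp acc.
(* C and D test only points of the slice but are open in the whole space, as relative openness and
   closedness in the slice require. *)
pose C := [set z | exists2 d : R, 0 < d & forall w, cline I w -> N (w - z) < d -> f w = 0].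
pose D := [set z | exists2 d : R, 0 < d & forall w, cline I w -> N (w - z) < d -> ~ C w].
have Cz z : C z -> cline I z -> f z = 0.
  by move=> [d d0 h] Lz; apply: h => //; rewrite subrr qnorm0.
have dich z : W z -> cline I z -> C z \/
    exists2 d : R, 0 < d & forall w, cline I w -> 0 < N (w - z) < d -> f w != 0.
  move=> Wz Lz; have [a [B [K ht]]] := open_taylor hI oW Wz Lz hf.
  have [h|[m [h1 h2]]] := taylor_dichotomy ht; last first.
    by right; exact: taylor_neq0_near ht h1 h2.
  left; have [_ K0 _] := ht; exists ((2 * K)^-1); first by rewrite invr_gt0 mulr_gt0.
  move=> w Lw wz; apply: h => //.
  by move/ltW: wz; rewrite -[_^-1]mul1r ler_pdivlMr ?mulr_gt0//; lra.
have oC : open C.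
  apply/open_qnormP => q [d d0 h]; exists (d / 2); first by rewrite divr_gt0.
  move=> q' qq'; exists (d / 2); first by rewrite divr_gt0.
  by move=> w Lw wq'; apply: h => //; have := ler_distqD q' w q; lra.
have oD : open D.
  apply/open_qnormP => q [d d0 h]; exists (d / 2); first by rewrite divr_gt0.
  move=> q' qq'; exists (d / 2); first by rewrite divr_gt0.
  by move=> w Lw wq'; apply: h => //; have := ler_distqD q' w q; lra.
have Cp : C p.
  have [//|[d d0 h]] := dich p Wp Lp; have [z Lz [zd z0]] := acc d d0.
  by have := h z Lz zd; rewrite z0 eqxx.
have E : (W `&` cline I) `&` C = W `&` cline I.
  apply: cW; first by exists p.
    by exists C.
  exists (~` D); first exact: open_closedC.
  apply/seteqP; split=> z [[Wz Lz]].
    move=> Cz'; split=> // -[d d0 h]; apply: (h z) => //.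
    by rewrite subrr qnorm0.
  move=> nD; split=> //; have [//|[d d0 h]] := dich z Wz Lz.
  have [//|nC] := pselect (C z).
  exfalso; apply: nD; exists d => // w Lw wz.
  have [->//|wz0] := eqVneq w z; move=> Cw.
  have := h w Lw; rewrite wz andbT qnorm_gt0 subr_eq0 wz0 => /(_ isT).
  by rewrite Cz// eqxx.
move=> z Wz Lz; have : (W `&` cline I `&` C) z by rewrite E.
by move=> [_ Cz']; exact: Cz.
Qed.

End Calculus.

(** * The regular product *)

Section Star.
Variable R : realType.
Local Notation H := (quat R).
Local Notation N := (@qnorm R).
Implicit Types (I J p q z w v : H) (f g h F G K L : H -> H) (W : set H).

(* The components of q that commute, resp. anticommute, with I: q = F + G J
   with F, G in the slice of I gives cpart I q = F and apart I q = G J. *)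
Definition cpart I q : H := 2^-1 *: (q - I * q * I).
Definition apart I q : H := 2^-1 *: (q + I * q * I).

Lemma halfDD q : 2^-1 *: (q + q) = q.
Proof.
rewrite scalerDr -scalerDl.
have -> : 2^-1 + 2^-1 = 1 :> R by lra.
by rewrite scale1r.
Qed.

Lemma cpartDapart I q : cpart I q + apart I q = q.
Proof. by rewrite /cpart /apart -scalerDr addrACA addNr addr0 halfDD. Qed.

Lemma imag_mulK I q : imag_units I -> I * (I * q) = - q.
Proof. by move=> hI; rewrite mulrA imag_unit_sqr// mulN1r. Qed.

Lemma imag_mulKr I q : imag_units I -> q * I * I = - q.
Proof. by move=> hI; rewrite -mulrA imag_unit_sqr// mulrN1. Qed.

Lemma cpart_line I q : imag_units I -> cline I (cpart I q).
Proof.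
move=> hI; apply/(clineP _ hI); rewrite /cpart -scalerAl -scalerAr mulrBl mulrBr.
by rewrite imag_mulKr// -[I * q * I]mulrA imag_mulK// !opprK addrC.
Qed.

Lemma apart_anti I q : imag_units I -> apart I q * I = - (I * apart I q).
Proof.
move=> hI; rewrite /apart -scalerAl -scalerAr -scalerN mulrDl mulrDr.
by rewrite imag_mulKr// -[I * q * I]mulrA imag_mulK// opprD opprK addrC.
Qed.

Lemma anti_twist I a v : imag_units I -> a * I = - (I * a) -> cline I v ->
  a * qconj v = v * a.
Proof.
move=> hI aI [x [y ->]]; rewrite qconjD qconjA qconjZ imag_unit_conj// mulrDr mulrDl qscalarC.
by rewrite -(scalerAr y) mulrN aI opprK (scalerAl y).
Qed.

Lemma part_unique I q a b : imag_units I -> q = a + b -> cline I a -> b * I = - (I * b) ->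
  cpart I q = a /\ apart I q = b.
Proof.
move=> hI -> /(clineP _ hI) aI bI.
have E : I * (a + b) * I = b - a.
  by rewrite mulrDr mulrDl -aI imag_mulKr// -mulrA bI mulrN imag_mulK// opprK addrC.
rewrite /cpart /apart E; split; rewrite -[RHS]halfDD; congr (_ *: _).
  by apply: quatP; rewrite !qcoordE; split; ring.
by apply: quatP; rewrite !qcoordE; split; ring.
Qed.

Lemma split_parts I J q a b : imag_units I -> imag_units J -> qdot I J = 0 ->
  cline I a -> cline I b -> q = a + b * J -> cpart I q = a /\ apart I q = b * J.
Proof.
move=> hI hJ IJ La /(clineP _ hI) bI qE; apply: part_unique => //.
by rewrite -mulrA (orth_anticomm hI hJ IJ) mulrN !mulrA bI.
Qed.

Lemma exists_splitting W I J f : imag_units I -> imag_units J -> qdot I J = 0 ->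
  splitting W I J f (fun z => cpart I (f z)) (fun z => - (apart I (f z) * J)).
Proof.
move=> hI hJ IJ z _; split; first exact: cpart_line.
  apply/(clineP _ hI); rewrite mulNr mulrN -mulrA (orth_anticomm hI hJ IJ) mulrN !mulrA apart_anti//.
  by rewrite mulNr opprK.
by rewrite mulNr imag_mulKr// opprK cpartDapart.
Qed.

Lemma conj_anti I a : imag_units I -> a * I = - (I * a) -> qconj a = - a.
Proof.
move=> /imag_unitsP[I0 II] e.
have := (congr1 (qcoord 1) e, congr1 (qcoord 2) e); have := congr1 (qcoord 3) e.
rewrite !(qcoordN, qcoordM) I0 => h3 [h1 h2].
suff a0 : qcoord 0 a = 0.
  by apply: quatP; rewrite !(qcoord_conj, qcoordE) a0 oppr0.
have e1 : qcoord 0 a * qcoord 1 I = 0 by lra.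
have e2 : qcoord 0 a * qcoord 2 I = 0 by lra.
have e3 : qcoord 0 a * qcoord 3 I = 0 by lra.
rewrite -[LHS]mulr1 -II /qdot I0 !mulrDr !mulrA e1 e2 e3; lra.
Qed.

Lemma symmetric_conj W z : symmetric_set W -> W z -> W (qconj z).
Proof.
move=> sW; have [I [x [y [hI _ ->]]]] := quat_slice z.
rewrite qconj_pt// /slice_pt scaleNr -scalerN => Wz.
by apply: (sW x y I (- I)) => //; exact: imag_unitN.
Qed.

Lemma real_line I J q : imag_units I -> imag_units J -> qdot I J = 0 -> cline I q ->
  cline J q -> exists x : R, q = x%:A.
Proof.
move=> hI hJ IJ [x [y ->]] [x' [y' e]]; exists x.
have /imag_unitsP[I0 II] := hI; have /imag_unitsP[J0 JJ] := hJ.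
suff -> : y = 0 by rewrite scale0r addr0.
have := congr1 (fun q => qdot q I) e; rewrite qdot_pt// /qdot !(qcoordA, qcoordE) I0 => ->.
have : y' * qdot I J = 0 by rewrite IJ mulr0.
by rewrite /qdot I0 J0; lra.
Qed.

(** With f q split into parts that commute and anticommute with the unit of q, this is the first
    part times g q plus the second times g at the conjugate of q. The unit occurs twice, so its sign
    is irrelevant; at real q it is 0, which is harmless since the two values of g coincide. *)
Definition starf f g q : H :=
  2^-1 *: (f q * (g q + g (qconj q)) - qunit q * f q * qunit q * (g q - g (qconj q))).

(** In the same splitting, this is the conjugate of the commuting part at the conjugate point minus
    the anticommuting part at q. *)
Definition regcf f q : H :=
  2^-1 *: (qconj (f q) + qconj (f (qconj q)) +
           qunit q * (qconj (f q) - qconj (f (qconj q))) * qunit q).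

Lemma qunit_slice I z : imag_units I -> cline I z ->
  [\/ qconj z = z, qunit z = I | qunit z = - I].
Proof.
move=> hI [x [y ->]]; have [[-> _]|[_ ->]|[_ ->]] := qunit_pt x y hI.
- by apply: Or31; rewrite scale0r addr0 qconjA.
- by apply: Or32.
- by apply: Or33.
Qed.

Lemma starf_slice I f g z : imag_units I -> cline I z ->
  starf f g z = cpart I (f z) * g z + apart I (f z) * g (qconj z).
Proof.
move=> hI Lz.
suff E (a b c : H) : 2^-1 *: (a * (b + c) - I * a * I * (b - c)) = cpart I a * b + apart I a * c.
  have [e|e|e] := qunit_slice hI Lz; rewrite /starf e.
  - by rewrite subrr mulr0 subr0 -mulrDl cpartDapart mulrDr halfDD.
  - exact: E.
  - by rewrite !(mulNr, mulrN) opprK; exact: E.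
rewrite /cpart /apart -!scalerAl -scalerDr; congr (_ *: _).
rewrite mulrDr mulrBr mulrBl mulrDl.
move: (a * b) (a * c) (I * a * I * b) (I * a * I * c) => x1 x2 x3 x4.
by apply: quatP; rewrite !qcoordE; split; ring.
Qed.

(** Conjugation on the slice becomes multiplication by constants, a form to which
    [slice_smooth_twist] applies. *)
Lemma conj_cpart_slice I J a : imag_units I -> imag_units J -> qdot I J = 0 -> cline I a ->
  qconj a = - J * a * J.
Proof.
move=> hI hJ IJ La; have := anti_twist hI (orth_anticomm hI hJ IJ) (cline_conj hI La).
by rewrite qconjK !mulNr => ->; rewrite imag_mulKr// opprK.
Qed.

Lemma regcf_slice I f z : imag_units I -> cline I z ->
  regcf f z = qconj (cpart I (f (qconj z))) - apart I (f z).
Proof.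
move=> hI Lz; have cI q : qconj (I * q * I) = I * qconj q * I.
  by rewrite !qconjM imag_unit_conj// !(mulNr, mulrN) opprK mulrA.
have ca q : qconj (apart I q) = - apart I q by exact/(conj_anti hI)/apart_anti.
suff E (a b : H) : 2^-1 *: (qconj a + qconj b + I * (qconj a - qconj b) * I) =
    qconj (cpart I b) - apart I a.
  have [e|e|e] := qunit_slice hI Lz; rewrite /regcf e.
  - rewrite subrr mulr0 mul0r addr0 halfDD.
    by rewrite -ca -qconjD cpartDapart.
  - exact: E.
  - by rewrite !(mulNr, mulrN) opprK; exact: E.
rewrite -ca /cpart /apart !qconjZ -scalerDr; congr (_ *: _).
rewrite qconjB qconjD !cI mulrBr mulrBl.
move: (qconj a) (qconj b) (I * qconj a * I) (I * qconj b * I) => x1 x2 x3 x4.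
by apply: quatP; rewrite !qcoordE; split; ring.
Qed.

Lemma smooth_cmul I f p c : imag_units I -> cline I p -> cline I c ->
  slice_smooth I f p -> slice_smooth I (fun z => c * f z) p.
Proof.
move=> hI Lp Lc hf; have := slice_smoothM hI Lp (slice_smooth_cst I p c) hf.
by apply; exists 1.
Qed.

Lemma smooth_parts I f p : imag_units I -> cline I p -> slice_smooth I f p ->
  slice_smooth I (fun z => cpart I (f z)) p /\ slice_smooth I (fun z => apart I (f z)) p.
Proof.
move=> hI Lp hf.
have hIf : slice_smooth I (fun z => I * f z * I) p.
  by apply: slice_smooth_mulr; apply: smooth_cmul => //; exact: clineI.
have E (g : H -> H) : (fun z => 2^-1 *: g z) = (fun z => g z * (2^-1)%:A).
  by apply: funext => z; rewrite mulr_algr.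
split; rewrite /cpart /apart.
  by rewrite (E (fun z => f z - I * f z * I)); apply/slice_smooth_mulr/slice_smoothB.
by rewrite (E (fun z => f z + I * f z * I)); apply/slice_smooth_mulr/slice_smoothD.
Qed.

Lemma smooth_conj_cpart I f p : imag_units I -> cline I p -> slice_smooth I f (qconj p) ->
  slice_smooth I (fun z => qconj (cpart I (f (qconj z)))) p.
Proof.
move=> hI Lp hf; have [J hJ IJ] := exists_orth hI.
have [hc _] := smooth_parts hI (cline_conj hI Lp) hf.
have -> : (fun z => qconj (cpart I (f (qconj z)))) =
   (fun z => cst (- J) z * cpart I (f (qconj z)) * J).
  by apply: funext => z; rewrite (conj_cpart_slice hI hJ IJ (cpart_line _ hI)).
apply: slice_smooth_mulr.
apply: (slice_smooth_twist hI hI (slice_isom_conj hI) Lp (slice_smooth_cst I p (- J)) hc).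
exists 1 => // z v _ _ Lv; rewrite /cst; apply: (anti_twist hI) => //.
by rewrite mulNr mulrN opprK (orth_anticomm hI hJ IJ) opprK.
Qed.

Lemma smooth_star I f g p : imag_units I -> cline I p -> slice_smooth I f p ->
  slice_smooth I g p -> slice_smooth I g (qconj p) ->
  slice_smooth I (fun z => cpart I (f z) * g z + apart I (f z) * g (qconj z)) p.
Proof.
move=> hI Lp hf hg hg'; have [hc ha] := smooth_parts hI Lp hf.
apply: slice_smoothD.
  apply: slice_smoothM => //; exists 1 => // z _ _; exact: cpart_line.
apply: (slice_smooth_twist hI hI (slice_isom_conj hI) Lp ha hg').
by exists 1 => // z v _ _ Lv; apply: (anti_twist hI) => //; exact: apart_anti.
Qed.

Section OnDomain.
Variables (W : set H) (oW : open W) (sW : symmetric_set W).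

Lemma starf_regular f g : regular W f -> regular W g -> regular W (starf f g).
Proof.
move=> /(regularP _ oW) hf /(regularP _ oW) hg; apply/(regularP _ oW) => I p hI Wp Lp.
apply: (@slice_smooth_near _ _ (fun z => cpart I (f z) * g z + apart I (f z) * g (qconj z))) => //.
  by exists 1 => // z Lz _; rewrite (starf_slice _ _ hI Lz).
apply: smooth_star => //; [exact: hf|exact: hg|apply: hg => //].
  exact: symmetric_conj.
exact: cline_conj.
Qed.

Lemma regcf_regular f : regular W f -> regular W (regcf f).
Proof.
move=> /(regularP _ oW) hf; apply/(regularP _ oW) => I p hI Wp Lp.
apply: (@slice_smooth_near _ _ (fun z => qconj (cpart I (f (qconj z))) - apart I (f z))) => //.
  by exists 1 => // z Lz _; rewrite (regcf_slice _ hI Lz).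
apply: slice_smoothB; last by have [] := smooth_parts hI Lp (hf _ _ hI Wp Lp).
apply: smooth_conj_cpart => //; apply: hf => //; first exact: symmetric_conj.
exact: cline_conj.
Qed.

Lemma starf_is_star f g : regular W f -> regular W g -> is_star W f g (starf f g).
Proof.
move=> hf hg I J F G K L hI hJ IJ sf sg; split; first exact: starf_regular.
move=> z [Wz Lz]; have Lz' := cline_conj hI Lz; have Wz' := symmetric_conj sW Wz.
have [LF LG fE] := sf z (conj Wz Lz).
have [LK LL gE] := sg z (conj Wz Lz); have [LK' LL' gE'] := sg _ (conj Wz' Lz').
have [c a] := split_parts hI hJ IJ LF LG fE.
rewrite (starf_slice _ _ hI Lz) c a gE gE'.
have tw v : cline I v -> J * v = qconj v * J.
  move=> Lv; rewrite -{1}[v]qconjK; apply: (anti_twist hI) (cline_conj hI Lv).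
  exact: orth_anticomm.
have -> : G z * J * (K (qconj z) + L (qconj z) * J) =
   G z * qconj (K (qconj z)) * J - G z * qconj (L (qconj z)).
  by rewrite mulrDr -!mulrA tw// (mulrA J) tw// -!mulrA (imag_unit_sqr hJ) mulrN1 mulrN.
rewrite !mulrDr mulrDl !mulrA.
move: (F z * K z) (F z * L z * J) (_ * J) (G z * qconj (L (qconj z))) => x1 x2 x3 x4.
by apply: quatP; rewrite !qcoordE; split; ring.
Qed.

Lemma regcf_is_regconj f : regular W f -> is_regconj W f (regcf f).
Proof.
move=> hf I J F G hI hJ IJ sf; split; first exact: regcf_regular.
move=> z [Wz Lz]; have Lz' := cline_conj hI Lz; have Wz' := symmetric_conj sW Wz.
have [LF LG fE] := sf z (conj Wz Lz); have [LF' LG' fE'] := sf _ (conj Wz' Lz').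
have [_ a] := split_parts hI hJ IJ LF LG fE; have [c _] := split_parts hI hJ IJ LF' LG' fE'.
by rewrite (regcf_slice _ hI Lz) c a.
Qed.

Lemma star_is_star f g : regular W f -> regular W g -> is_star W f g (star W f g).
Proof.
by move=> hf hg; apply: (xgetPex _ (P := [set h | is_star W f g h])); exists (starf f g); exact: starf_is_star.
Qed.

Lemma regconj_is_regconj f : regular W f -> is_regconj W f (regconj W f).
Proof.
by move=> hf; apply: (xgetPex _ (P := [set h | is_regconj W f h])); exists (regcf f); exact: regcf_is_regconj.
Qed.

(** [star] is known only through [is_star], but this property prescribes the values on every slice,
    where the explicit formula has the same ones. *)
Lemma starE I f g z : imag_units I -> regular W f -> regular W g -> W z -> cline I z ->
  star W f g z = cpart I (f z) * g z + apart I (f z) * g (qconj z).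
Proof.
move=> hI hf hg Wz Lz; rewrite -(starf_slice _ _ hI Lz).
have [J hJ IJ] := exists_orth hI.
have sf := @exists_splitting W I J f hI hJ IJ; have sg := @exists_splitting W I J g hI hJ IJ.
have [_ ->//] := star_is_star hf hg hI hJ IJ sf sg.
by have [_ ->//] := starf_is_star hf hg hI hJ IJ sf sg.
Qed.

Lemma regconjE I f z : imag_units I -> regular W f -> W z -> cline I z ->
  regconj W f z = qconj (cpart I (f (qconj z))) - apart I (f z).
Proof.
move=> hI hf Wz Lz; rewrite -(regcf_slice _ hI Lz).
have [J hJ IJ] := exists_orth hI.
have sf := @exists_splitting W I J f hI hJ IJ.
have [_ ->//] := regconj_is_regconj hf hI hJ IJ sf.
by have [_ ->//] := regcf_is_regconj hf hI hJ IJ sf.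
Qed.

Let unitI : exists I : H, imag_units I.
Proof. by have [I [x [y [hI _ _]]]] := quat_slice (0 : H); exists I. Qed.

Lemma star_regular f g : regular W f -> regular W g -> regular W (star W f g).
Proof.
move=> hf hg; have [I hI] := unitI; have [J hJ IJ] := exists_orth hI.
by have [] := star_is_star hf hg hI hJ IJ (exists_splitting _ hI hJ IJ) (exists_splitting _ hI hJ IJ).
Qed.

Lemma regconj_regular f : regular W f -> regular W (regconj W f).
Proof.
move=> hf; have [I hI] := unitI; have [J hJ IJ] := exists_orth hI.
by have [] := regconj_is_regconj hf hI hJ IJ (exists_splitting _ hI hJ IJ).
Qed.

Lemma symmetrization_regular f : regular W f -> regular W (symmetrization W f).
Proof. by move=> hf; exact: star_regular hf (regconj_regular hf). Qed.

Lemma starA f g h z : regular W f -> regular W g -> regular W h -> W z ->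
  star W (star W f g) h z = star W f (star W g h) z.
Proof.
move=> hf hg hh Wz; have [I [x [y [hI _ zE]]]] := quat_slice z.
have Lz : cline I z by rewrite zE; exact: cline_pt.
have Lz' := cline_conj hI Lz; have Wz' := symmetric_conj sW Wz.
have hfg := star_regular hf hg; have hgh := star_regular hg hh.
rewrite !(starE hI _ _ Wz Lz)// (starE hI _ _ Wz' Lz')// qconjK.
(* A product of two parts of the same kind commutes with I and a mixed one anticommutes, so this
   grouping is the splitting of the regular product of f and g. Associativity then reduces to that
   of the quaternions. *)
have P : cpart I (f z) * g z + apart I (f z) * g (qconj z) =
   (cpart I (f z) * cpart I (g z) + apart I (f z) * apart I (g (qconj z))) +
   (cpart I (f z) * apart I (g z) + apart I (f z) * cpart I (g (qconj z))).
  rewrite -{1}(cpartDapart I (g z)) -{1}(cpartDapart I (g (qconj z))) !mulrDr.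
  by rewrite [X in _ + X = _]addrC addrACA.
have CI q : cpart I q * I = I * cpart I q by apply/clineP => //; exact: cpart_line.
have AI q : apart I q * I = - (I * apart I q) by exact: apart_anti.
have [||c a] := part_unique hI P.
- apply/clineP => //; rewrite mulrDl mulrDr; congr (_ + _); first by rewrite -mulrA CI mulrA CI mulrA.
  by rewrite -mulrA AI mulrN [X in - X = _]mulrA AI mulNr opprK -mulrA.
- rewrite mulrDl mulrDr opprD; congr (_ + _); first by rewrite -mulrA AI mulrN [X in - X = _]mulrA CI -mulrA.
  by rewrite -mulrA CI [LHS]mulrA AI mulNr -mulrA.
rewrite c a !mulrDl !mulrDr !mulrA -!addrA; congr (_ + _).
by rewrite addrC -!addrA; congr (_ + _); rewrite addrC.
Qed.

Lemma symmetrizationE I f z : imag_units I -> regular W f -> W z -> cline I z ->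
  symmetrization W f z =
  cpart I (f z) * qconj (cpart I (f (qconj z))) - apart I (f z) * apart I (f (qconj z)).
Proof.
move=> hI hf Wz Lz; have Lz' := cline_conj hI Lz; have Wz' := symmetric_conj sW Wz.
rewrite /symmetrization (starE hI hf (regconj_regular hf) Wz Lz).
rewrite !(regconjE hI hf)// qconjK !mulrBr.
(* Moving the commuting part across the anticommuting one undoes the conjugation, and the two mixed
   terms cancel. *)
have -> : apart I (f z) * qconj (cpart I (f z)) = cpart I (f z) * apart I (f z).
  by apply: (anti_twist hI); [exact: apart_anti|exact: cpart_line].
by rewrite addrA subrK.
Qed.

Lemma star_preserving I f g z : imag_units I -> regular W f -> regular W g -> W z -> cline I z ->
  cline I (f z) -> star W f g z = f z * g z.
Proof.
move=> hI hf hg Wz Lz Lf; rewrite (starE hI hf hg Wz Lz).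
have A0 : (0 : H) * I = - (I * 0) by rewrite mul0r mulr0 oppr0.
have [-> ->] := part_unique hI (esym (addr0 (f z))) Lf A0.
by rewrite mul0r addr0.
Qed.

End OnDomain.

End Star.

(** * Connectedness and the representation formula *)

Section Connectedness.
Variable R : realType.
Local Notation H := (quat R).
Local Notation N := (@qnorm R).
Implicit Types (I J p q z w v : H) (f g : H -> H) (A B W Z : set H).

Lemma convex_connected A :
  (forall a b (t : R), A a -> A b -> 0 <= t <= 1 -> A (a + t *: (b - a))) -> connected A.
Proof.
move=> cA; have [->|/set0P[a Aa]] := eqVneq A set0; first exact: connected0.
pose seg b : set H := (fun t : R => a + t *: (b - a)) @` `[0, 1].
have -> : A = \bigcup_(b in A) seg b.
  apply/seteqP; split=> [b Ab|x [b Ab [t /=]]].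
    exists b => //; exists 1; first by rewrite /= in_itv/= ler01 lexx.
    by rewrite scale1r addrC subrK.
  by rewrite in_itv/= => t01 <-; exact: cA.
apply: bigcup_connected.
  exists a => b Ab; exists 0; first by rewrite /= in_itv/= lexx ler01.
  by rewrite scale0r addr0.
move=> b Ab; apply: connected_continuous_connected; first exact: segment_connected.
apply: continuous_subspaceT => t.
apply: cvgD; first exact: cvg_cst.
by apply: cvgZr_tmp; exact: cvg_id.
Qed.

Definition pdisc I p (d : R) : set H := [set w | cline I w /\ 0 < N (w - p) < d].

(** The punctured disc is the union of four convex half discs, given by the signs of the two
    coordinates of w - p. Points with both coordinates of modulus d / 4 link each half disc to the
    next. *)
Lemma pdisc_connected I p d : imag_units I -> cline I p -> 0 < d -> connected (pdisc I p d).
Proof.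
move=> hI Lp d0.
pose hd (l : H -> R) : set H := [set w | [/\ cline I w, N (w - p) < d & 0 < l (w - p)]].
have chd (l : H -> R) : (forall a b, l (a + b) = l a + l b) ->
    (forall (t : R) a, l (t *: a) = t * l a) -> connected (hd l).
  move=> lD lZ; apply: convex_connected => a b t [La da la] [Lb db lb] /andP[t0 t1].
  have E : a + t *: (b - a) - p = (1 - t) *: (a - p) + t *: (b - p).
    rewrite !scalerBr !scalerBl !scale1r.
    by apply: quatP; rewrite !qcoordE; split; ring.
  split.
  - by apply: clineD => //; apply: clineZ => //; exact: clineB.
  - rewrite E; apply: le_lt_trans (qnormD _ _) _; rewrite !qnormZ !ger0_norm ?subr_ge0//.
    have [->|tn] := eqVneq t 0; first by rewrite subr0 mul1r mul0r addr0.
    have tp : 0 < t by rewrite lt_neqAle eq_sym tn.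
    have u1 : (1 - t) * N (a - p) <= (1 - t) * d by rewrite ler_wpM2l ?subr_ge0// ltW.
    have u2 : t * N (b - p) < t * d by rewrite ltr_pM2l.
    lra.
  - rewrite E lD !lZ.
    have [->|tn] := eqVneq t 0; first by rewrite subr0 mul1r mul0r addr0.
    have tp : 0 < t by rewrite lt_neqAle eq_sym tn.
    by rewrite ltr_wpDl ?mulr_ge0 ?subr_ge0 ?mulr_gt0// ltW.
pose re (w : H) : R := qre w; pose im (w : H) : R := qdot w I.
have reD a b : re (a + b) = re a + re b by rewrite /re /qre qcoordD.
have imD a b : im (a + b) = im a + im b by rewrite /im /qdot !qcoordD; ring.
have reZ (t : R) a : re (t *: a) = t * re a by rewrite /re /qre qcoordZ.
have imZ (t : R) a : im (t *: a) = t * im a by rewrite /im /qdot !qcoordZ; ring.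
have PE : pdisc I p d = hd re `|` hd im `|` hd (fun w => - re w) `|` hd (fun w => - im w).
  apply/seteqP; split=> w.
    move=> [Lw /andP[w0 wd]].
    have Lwp : cline I (w - p) by exact: clineB.
    have [r0|r0|r0] := ltgtP (re (w - p)) 0.
    - by left; right; split; rewrite /= ?oppr_gt0.
    - by left; left; left; split.
    have [i0|i0|i0] := ltgtP (im (w - p)) 0.
    - by right; split; rewrite /= ?oppr_gt0.
    - by left; left; right; split.
    move: w0; rewrite (slice_ptE hI Lwp) -/(re _) -/(im _) r0 i0.
    by rewrite /slice_pt !scale0r addr0 qnorm0 ltxx.
  have nz (l : H -> R) : l 0 = 0 -> hd l w -> pdisc I p d w.
    move=> l0 [Lw wd lw]; split=> //; rewrite wd andbT qnorm_gt0.
    by apply: contraTneq lw => ->; rewrite l0 ltxx.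
  have r0 : re 0 = 0 by rewrite /re /qre qcoord0.
  have i0 : im 0 = 0 by rewrite /im /qdot !qcoord0; ring.
  by move=> [[[]|]|]; apply: nz => //; rewrite ?r0 ?i0 ?oppr0.
have pt (a b : R) : `|a| = d / 4 -> `|b| = d / 4 ->
    [/\ cline I (p + slice_pt I a b), N (p + slice_pt I a b - p) < d,
        re (p + slice_pt I a b - p) = a & im (p + slice_pt I a b - p) = b].
  move=> a4 b4; have -> : p + slice_pt I a b - p = slice_pt I a b by rewrite addrAC subrr add0r.
  split; last 2 first.
  - exact: qre_pt.
  - exact: qdot_pt.
  - by apply: clineD => //; exact: cline_pt.
  - by apply: le_lt_trans (slice_pt_norm_le _ _ hI) _; rewrite a4 b4; lra.
have d4 : 0 < d / 4 by rewrite divr_gt0.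
have p4 : `|d / 4| = d / 4 by rewrite gtr0_norm.
have n4 : `|- (d / 4)| = d / 4 by rewrite normrN.
rewrite PE; apply: connectedU; last 2 first.
- apply: connectedU; last 2 first.
  + apply: connectedU; [|exact: chd|exact: chd].
    have [h1 h2 h3 h4] := pt _ _ p4 p4.
    by exists (p + slice_pt I (d / 4) (d / 4)); split; split=> //; rewrite ?h3 ?h4.
  + by apply: chd => [a b|t a]; rewrite ?reD ?reZ; ring.
  + have [h1 h2 h3 h4] := pt _ _ n4 p4.
    exists (p + slice_pt I (- (d / 4)) (d / 4)); split; first by right; split=> //; rewrite h4.
    by split=> //; rewrite h3 opprK.
- by apply: chd => [a b|t a]; rewrite ?imD ?imZ; ring.
- have [h1 h2 h3 h4] := pt _ _ p4 n4.
  exists (p + slice_pt I (d / 4) (- (d / 4))); split; first by left; left; split=> //; rewrite h3.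
  by split=> //; rewrite h4 opprK.
Qed.

(** Nothing is known at the center z, so the punctured disc around a nearby z' must avoid it; hence
    the bound by the distance from z' to z. *)
Lemma punctured_interior_open I B :
  open [set z | exists2 d : R, 0 < d & pdisc I z d `<=` B].
Proof.
apply/open_qnormP => z [d d0 h].
exists (d / 2); first by rewrite divr_gt0.
move=> z' zz'; have [->|ne] := eqVneq z' z; first by exists d.
have n0 : 0 < N (z' - z) by rewrite qnorm_gt0 subr_eq0.
exists (Num.min (d / 2) (N (z' - z))); first by rewrite lt_min divr_gt0.
move=> w [Lw /andP[w0]]; rewrite lt_min => /andP[w1 w2]; apply: h; split=> //.
apply/andP; split; last by have := ler_distqD z' w z; lra.
rewrite qnorm_gt0 subr_eq0; apply: contraTneq w2 => ->.
by rewrite qdistC ltxx.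
Qed.

Lemma small_pdisc I p d : imag_units I -> cline I p -> 0 < d -> exists w, pdisc I p d w.
Proof. by move=> hI Lp d0; have [w Lw wd] := small_cline hI Lp d0; exists w. Qed.

(** A relatively open and closed part B of the complement is extended to the points of Z. Small
    punctured discs are connected and avoid Z, so each lies inside B or outside B; the centers of
    the first kind form a relatively open and closed part of the slice of W. *)
Lemma connected_setD_discrete I W Z : imag_units I -> open W -> connected (W `&` cline I) ->
  (forall p, W p -> cline I p -> exists2 d : R, 0 < d & forall z, pdisc I p d z -> ~ Z z) ->
  connected ((W `\` Z) `&` cline I).
Proof.
move=> hI oW cW dZ B [b0 Bb0] [C1 oC1 BC1] [C2 cC2 BC2].
have hW p : W p -> cline I p -> exists2 d : R, 0 < d & pdisc I p d `<=` (W `\` Z) `&` cline I.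
  move=> Wp Lp; have [d1 d10 h1] := dZ p Wp Lp.
  have [d2 d20 h2] := (open_qnormP W).1 oW p Wp.
  exists (Num.min d1 d2); first by rewrite lt_min d10.
  move=> w [Lw /andP[w0]]; rewrite lt_min => /andP[w1 w2]; split=> //; split; first exact: h2.
  by apply: h1; split=> //; rewrite w0.
pose U := [set z | exists2 d : R, 0 < d & pdisc I z d `<=` B].
pose V := [set z | exists2 d : R, 0 < d & pdisc I z d `<=` ~` B].
have pdiscS p (d d' : R) : d <= d' -> pdisc I p d `<=` pdisc I p d'.
  by move=> dd' w [Lw /andP[w0 wd]]; split=> //; rewrite w0 (lt_le_trans wd).
have UV p : cline I p -> U p -> ~ V p.
  move=> Lp [d d0 h] [d' d'0 h'].
  have [|w hw] := @small_pdisc I p (Num.min d d') hI Lp; first by rewrite lt_min d0.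
  have Bw : B w by apply/h/pdiscS/hw; rewrite ge_min lexx.
  by apply: (h' w) => //; apply/pdiscS/hw; rewrite ge_min lexx orbT.
have dich p : W p -> cline I p -> U p \/ V p.
  move=> Wp Lp; have [d d0 h] := hW p Wp Lp.
  have [[w [Pw Bw]]|nB] := pselect (exists w, pdisc I p d w /\ B w); last first.
    by right; exists d => // w Pw Bw; apply: nB; exists w.
  left; exists d => //.
  have E : pdisc I p d `&` B = pdisc I p d.
    apply: (pdisc_connected hI Lp d0); first by exists w.
      by exists C1 => //; rewrite BC1 setIA (setIidl h).
    by exists C2 => //; rewrite BC2 setIA (setIidl h).
  by move=> z; rewrite -E => -[].
have BU : B `<=` U.
  move=> z Bz; have := Bz; rewrite BC1 => -[[[Wz nZz] Lz] C1z].
  have [//|[d d0 hV]] := dich z Wz Lz.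
  have [d1 d10 h1] := hW z Wz Lz; have [d2 d20 h2] := (open_qnormP C1).1 oC1 z C1z.
  exists (Num.min d1 d2); first by rewrite lt_min d10.
  move=> w [Lw /andP[w0]]; rewrite lt_min => /andP[w1 w2]; rewrite BC1; split; last exact: h2.
  by apply: h1; split=> //; rewrite w0.
have E : (W `&` cline I) `&` U = W `&` cline I.
  apply: cW.
  - by exists b0; split; last exact: BU; move: Bb0; rewrite BC1 => -[[[]]].
  - by exists U => //; exact: punctured_interior_open.
  - exists (~` V); first by apply: open_closedC; exact: punctured_interior_open.
    apply/seteqP; split=> z [[Wz Lz]] h; split=> //; first exact: UV.
    by have [] := dich z Wz Lz.
apply/seteqP; split=> z; first by rewrite BC1 => -[].
move=> [[Wz nZz] Lz].
have [_ [d d0 h]] : (W `&` cline I `&` U) z by rewrite E.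
rewrite BC2; split=> //.
apply: contrapT => nC2.
have /open_qnormP oC2 : open (~` C2) by exact: closed_openC.
have [d' d'0 h'] := oC2 z nC2.
have [|w [Lw /andP[w0]]] := @small_pdisc I z (Num.min d d') hI Lz; first by rewrite lt_min d0.
rewrite lt_min => /andP[w1 w2].
have : B w by apply: h; split=> //; rewrite w0.
by rewrite BC2 => -[_]; exact: h'.
Qed.

End Connectedness.

(** * The representation formula and the zeros of the symmetrization *)

Section Representation.
Variable R : realType.
Local Notation H := (quat R).
Local Notation N := (@qnorm R).
Implicit Types (I J p q z w v : H) (f g : H -> H) (W : set H).

Definition slice_map J I z : H := slice_pt I (qre z) (qdot z J).

Lemma slice_map_pt J I x y : imag_units J -> slice_map J I (slice_pt J x y) = slice_pt I x y.
Proof. by move=> hJ; rewrite /slice_map qre_pt// qdot_pt. Qed.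

Lemma slice_map_isom J I : imag_units J -> imag_units I -> slice_isom J I (slice_map J I).
Proof.
move=> hJ hI; split=> [z _|z w _ _|z Lz]; first exact: cline_pt.
  rewrite /slice_map /slice_pt /qre.
  have -> : qdot (z - w) J = qdot z J - qdot w J by rewrite /qdot !qcoordE; ring.
  by rewrite !qcoordE !scalerBl opprD addrACA.
apply/eqP; rewrite -(@eqrXn2 _ 2)// ?qnorm_ge0//.
by rewrite {2}(slice_ptE hJ Lz) !sqr_norm_pt.
Qed.

Lemma slice_isom_comp J I tau : imag_units I -> slice_isom J I tau ->
  slice_isom J I (fun z => qconj (tau z)).
Proof.
move=> hI [tL tB tN]; split=> [z Lz|z w Lz Lw|z Lz]; first exact/cline_conj/tL.
- by rewrite tB// qconjB.
- by rewrite qnorm_conj tN.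
Qed.

Lemma domain_pt W I J x y : symmetric_set W -> imag_units I -> imag_units J ->
  W (slice_pt I x y) -> W (slice_pt J x y).
Proof. by move=> sW hI hJ; exact: sW. Qed.

Lemma real_near W (x : R) : open W -> W x%:A -> forall d : R, 0 < d ->
  exists2 t : R, W (x + t)%:A & 0 < t < d.
Proof.
move=> /open_qnormP oW Wx d d0; have [e e0 h] := oW _ Wx.
have m0 : 0 < Num.min d e / 2 by rewrite divr_gt0// lt_min d0.
have md : Num.min d e / 2 < Num.min d e by move: m0; lra.
move: (md); rewrite lt_min => /andP[m1 m2].
exists (Num.min d e / 2); last by rewrite m0.
by apply: h; rewrite -scalerBl addrAC subrr add0r qnormZ qnorm1 mulr1 gtr0_norm.
Qed.

Lemma identity_real W I f : symmetric_slice_domain W -> imag_units I ->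
  (forall z, W z -> cline I z -> slice_smooth I f z) -> (forall x : R, W x%:A -> f x%:A = 0) ->
  forall z, W z -> cline I z -> f z = 0.
Proof.
move=> [sW [oW cW [x Wx] cI]] hI hf f0.
apply: (identity_principle hI oW (cI _ hI) hf Wx (clineA hI x)) => d d0.
have [t Wt /andP[t0 td]] := real_near oW Wx d0.
exists (x + t)%:A; first exact: clineA.
by split; [rewrite -scalerBl addrAC subrr add0r qnormZ qnorm1 mulr1 gtr0_norm// t0|exact: f0].
Qed.

(** The two sides agree on the real axis, so it suffices that the right side be smooth on the slice
    of J. It is, because (1 - J I) I = J (1 - J I) and (1 + J I) (- I) = J (1 + J I) convert
    increments along I into increments along J. *)
Lemma representation W f I J x y : symmetric_slice_domain W -> regular W f ->
  imag_units I -> imag_units J -> W (slice_pt I x y) ->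
  f (slice_pt J x y) = 2^-1 *: ((1 - J * I) * f (slice_pt I x y) +
                                (1 + J * I) * f (slice_pt I x (- y))).
Proof.
move=> dW; have [sW [oW _ _ _]] := dW => /(regularP _ oW) hf hI hJ Wz.
pose psi z := (1 - J * I) * f (slice_map J I z) + (1 + J * I) * f (qconj (slice_map J I z)).
have two z : f z = f z * (2^-1)%:A + f z * (2^-1)%:A.
  by rewrite -mulrDr -scalerDl -[LHS]mulr1; congr (_ * _); rewrite -[LHS]scale1r; congr (_ *: _); lra.
suff : forall z, W z -> cline J z -> psi z * (2^-1)%:A - f z = 0.
  move=> /(_ (slice_pt J x y) (domain_pt sW hI hJ Wz) (cline_pt _ _ _)) /eqP.
  rewrite subr_eq0 => /eqP <-.
  by rewrite /psi slice_map_pt// qconj_pt// mulr_algr.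
apply: (identity_real dW hJ) => [z Wz' Lz|t Wt]; last first.
  have -> : psi t%:A = f t%:A + f t%:A.
    have E : slice_map J I t%:A = t%:A.
      have := @slice_map_pt J I t 0 hJ.
      by rewrite /slice_pt !scale0r !addr0.
    by rewrite /psi E qconjA -mulrDl addrACA addNr addr0 mulrDl mul1r.
  by rewrite mulrDl -two subrr.
have iso := slice_map_isom hJ hI; have iso' := slice_isom_comp hI iso.
have Lt : cline I (slice_map J I z) by case: iso => + _ _; apply.
have Wt : W (slice_map J I z).
  by move: Wz'; rewrite (slice_ptE hJ Lz) slice_map_pt//; exact: domain_pt.
have key (v : H) : cline J v ->
    (1 - J * I) * slice_map J I v = v * (1 - J * I) /\
    (1 + J * I) * qconj (slice_map J I v) = v * (1 + J * I).
  move=> [a [b ->]]; rewrite slice_map_pt// qconj_pt// /slice_pt.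
  have k1 : (1 - J * I) * I = J * (1 - J * I).
    by rewrite mulrBl mul1r imag_mulKr// mulrBr mulr1 imag_mulK// !opprK addrC.
  have k2 : (1 + J * I) * - I = J * (1 + J * I).
    by rewrite mulrDl mul1r mulrN imag_mulKr// mulrDr mulr1 imag_mulK// opprK addrC.
  rewrite scaleNr -scalerN; split; rewrite [LHS]mulrDr [RHS]mulrDl qscalarC.
    by rewrite -(scalerAr b) -(scalerAl b) k1.
  by rewrite -(scalerAr b) -(scalerAl b) k2.
apply: slice_smoothB; last exact: hf.
apply: slice_smooth_mulr; apply: slice_smoothD.
  apply: (slice_smooth_twist hJ hI iso Lz (slice_smooth_cst J z (1 - J * I))); first exact: hf.
  by exists 1 => // w v _ _ Lv; rewrite /cst; have [] := key v Lv.
apply: (slice_smooth_twist hJ hI iso' Lz (slice_smooth_cst J z (1 + J * I))).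
  by apply: hf => //; [exact: symmetric_conj|exact: cline_conj].
by exists 1 => // w v _ _ Lv; rewrite /cst; have [] := key v Lv.
Qed.

(** By the representation formula the value at x + J y is A + J B with A and B independent of J.
    Both lie in every slice, and two orthogonal slices meet only in the reals. *)
Lemma preserving_stem W f I x y : symmetric_slice_domain W -> regular W f ->
  (forall J z, imag_units J -> W z -> cline J z -> cline J (f z)) ->
  imag_units I -> W (slice_pt I x y) ->
  exists a b : R, forall J, imag_units J -> f (slice_pt J x y) = slice_pt J a b.
Proof.
move=> dW hf fL hI Wz; have [sW _] := dW.
have WJ J t : imag_units J -> t = y \/ t = - y -> W (slice_pt J x t).
  move=> hJ [->|->]; first exact: domain_pt Wz.
  by rewrite -qconj_pt//; apply: symmetric_conj => //; exact: domain_pt Wz.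
pose A : H := 2^-1 *: (f (slice_pt I x y) + f (slice_pt I x (- y))).
pose B : H := - (I * (2^-1 *: (f (slice_pt I x y) - f (slice_pt I x (- y))))).
have rep J : imag_units J -> f (slice_pt J x y) = A + J * B.
  move=> hJ; rewrite (representation dW hf hI hJ Wz) /A /B.
  rewrite mulrN -!scalerAr -scalerN -scalerDr; congr (_ *: _).
  rewrite mulrBl mulrDl !mul1r !mulrBr !mulrA.
  move: (f _) (f _) (J * I * _) (J * I * _) => x1 x2 x3 x4.
  by apply: quatP; rewrite !qcoordE; split; ring.
have rep' J : imag_units J -> f (slice_pt J x (- y)) = A - J * B.
  move=> hJ; have := rep _ (imag_unitN hJ); rewrite mulNr => <-.
  by rewrite /slice_pt scaleNr scalerN.
have AB J : imag_units J -> cline J A /\ cline J B.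
  move=> hJ.
  have l1 := fL _ _ hJ (WJ J _ hJ (or_introl erefl)) (cline_pt J x y).
  have l2 := fL _ _ hJ (WJ J _ hJ (or_intror erefl)) (cline_pt J x (- y)).
  rewrite (rep J hJ) in l1; rewrite (rep' J hJ) in l2.
  have LA : cline J A.
    have := clineZ hJ 2^-1 (clineD hJ l1 l2).
    by rewrite addrACA subrr addr0 halfDD.
  split=> //; have := clineN hJ (clineM hJ (clineI hJ) (clineB hJ l1 LA)).
  by rewrite addrAC subrr add0r imag_mulK// opprK.
have [K hK IK] := exists_orth hI.
have [LA LB] := AB I hI; have [LA' LB'] := AB K hK.
have [a aE] := real_line hI hK IK LA LA'; have [b bE] := real_line hI hK IK LB LB'.
by exists a, b => J hJ; rewrite (rep J hJ) aE bE mulr_algr.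
Qed.

Lemma preserving_norm W f I J x y : symmetric_slice_domain W -> regular W f ->
  (forall K z, imag_units K -> W z -> cline K z -> cline K (f z)) ->
  imag_units I -> imag_units J -> W (slice_pt I x y) ->
  N (f (slice_pt J x y)) = N (f (slice_pt I x y)).
Proof.
move=> dW hf fL hI hJ Wz; have [a [b h]] := preserving_stem dW hf fL hI Wz.
by apply/eqP; rewrite !h// -(@eqrXn2 _ 2)// ?qnorm_ge0// !sqr_norm_pt.
Qed.

Section Symmetrization.
Variables (W : set H) (dW : symmetric_slice_domain W) (f : H -> H) (hf : regular W f).
Let sW : symmetric_set W. Proof. by case: dW. Qed.
Let oW : open W. Proof. by case: dW => _ []. Qed.
Local Notation fs := (symmetrization W f).

Lemma symmetrization_line I z : imag_units I -> W z -> cline I z -> cline I (fs z).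
Proof.
move=> hI Wz Lz; rewrite (symmetrizationE oW sW hI hf Wz Lz).
apply: clineB => //.
  by apply: clineM => //; [|apply: cline_conj => //]; exact: cpart_line.
apply/(clineP _ hI); rewrite -mulrA apart_anti// mulrN [X in - X = _]mulrA apart_anti//.
by rewrite mulNr opprK mulrA.
Qed.

Lemma symmetrization_real x : W x%:A -> fs x%:A = 0 -> f x%:A = 0.
Proof.
move=> Wx; have [I [_ [_ [hI _ _]]]] := quat_slice (0 : H).
rewrite (symmetrizationE oW sW hI hf Wx (clineA hI x)) qconjA qmul_conj => e.
have := cpartDapart I (f x%:A); set c := cpart I _ in e *; set a := apart I _ in e *.
have aa : a * a = - (qdot a a *: 1).
  by rewrite -qmul_conj (conj_anti hI (apart_anti _ hI)) mulrN opprK.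
move: e; rewrite aa opprK -scalerDl => /eqP; rewrite scaler_eq0 oner_eq0 orbF.
rewrite paddr_eq0 ?qdot_ge0// !qdot_eq0 => /andP[/eqP -> /eqP ->].
by rewrite addr0.
Qed.

Hypothesis f0 : exists2 q, W q & f q != 0.

(** Accumulating zeros make f^s vanish on the slice of I, hence on the real axis. The axis lies in
    every slice, so f, which vanishes there too, would be 0 on all of them. *)
Lemma symmetrization_isolated I p : imag_units I -> W p -> cline I p ->
  exists2 d : R, 0 < d & forall z, pdisc I p d z -> fs z <> 0.
Proof.
move=> hI Wp Lp; apply: contrapT => nd.
have hs := symmetrization_regular oW sW hf.
have z0 z : W z -> cline I z -> fs z = 0.
  move: z; have [_ [_ _ _ cI]] := dW.
  apply: (identity_principle hI oW (cI _ hI) _ Wp Lp).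
    by move=> z Wz Lz; exact: (regularP _ oW).1.
  move=> d d0; apply: contrapT => nz; apply: nd; exists d => // z [Lz zd] fz.
  by apply: nz; exists z.
have [q Wq /eqP] := f0; apply.
have [J [x [y [hJ _ qE]]]] := quat_slice q.
apply: (identity_real dW hJ) Wq _ => //.
- by move=> z Wz Lz; exact: (regularP _ oW).1.
- by move=> t Wt; apply: symmetrization_real => //; apply: z0 => //; exact: clineA.
- by rewrite qE; exact: cline_pt.
Qed.

Lemma symmetrization_zeros_sphere I J x y : imag_units I -> imag_units J ->
  zeros W fs (slice_pt I x y) -> zeros W fs (slice_pt J x y).
Proof.
move=> hI hJ [Wz fz]; split; first exact: domain_pt Wz.
apply/eqP; rewrite -qnorm_eq0.
have hs := symmetrization_regular oW sW hf.
rewrite (preserving_norm dW hs _ hI hJ Wz) ?fz ?qnorm0// => K z.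
exact: symmetrization_line.
Qed.

Lemma quotient_domain : symmetric_slice_domain (W `\` zeros W fs).
Proof.
have [_ [_ _ [x0 Wx0] cI]] := dW.
have hs := symmetrization_regular oW sW hf.
have sD : symmetric_set (W `\` zeros W fs).
  move=> x y I J hI hJ [Wz nZ]; split; first exact: domain_pt Wz.
  by move=> /(symmetrization_zeros_sphere hJ hI).
have [x1 Wx1] : exists x1 : R, (W `\` zeros W fs) x1%:A.
  have [I [_ [_ [hI _ _]]]] := quat_slice (0 : H).
  have [d d0 h] := symmetrization_isolated hI Wx0 (clineA hI x0).
  have [t Wt /andP[t0 td]] := real_near oW Wx0 d0.
  exists (x0 + t); split=> // -[_]; apply: h; split; first exact: clineA.
  by rewrite -scalerBl addrAC subrr add0r qnormZ qnorm1 mulr1 gtr0_norm// t0.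
have cS I : imag_units I -> connected ((W `\` zeros W fs) `&` cline I).
  move=> hI; apply: (connected_setD_discrete hI oW (cI _ hI)) => p Wp Lp.
  have [d d0 h] := symmetrization_isolated hI Wp Lp.
  by exists d => // z zd [_]; exact: h.
split=> //; split; [|..|by exists x1|exact: cS].
- apply/open_qnormP => p [Wp nZ].
  have [I [x [y [hI y0 pE]]]] := quat_slice p.
  have Lp : cline I p by rewrite pE; exact: cline_pt.
  have fp : fs p != 0 by apply/eqP => e; apply: nZ.
  have hsp : slice_smooth I fs p by exact: (regularP _ oW).1.
  have [d d0 h] := smooth_neq0_near hI Lp hsp fp.
  have [d' d'0 h'] := (open_qnormP W).1 oW p Wp.
  exists (Num.min d d'); first by rewrite lt_min d0.
  move=> q; rewrite lt_min => /andP[qd qd']; have Wq := h' _ qd'.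
  split=> // Zq.
  have [J [x' [y' [hJ y'0 qE]]]] := quat_slice q; rewrite qE in Zq.
  have [W' fz] := symmetrization_zeros_sphere hJ hI Zq.
  (* Rotating q along its sphere to the slice of p brings it no farther from p, because both
     imaginary coordinates are nonnegative and the inner product of the units is at most 1. Thus
     nonvanishing on one slice near p gives a full neighborhood. *)
  suff : N (slice_pt I x' y' - p) < d by move=> /(h _ (cline_pt _ _ _)); rewrite fz eqxx.
  apply: le_lt_trans qd; rewrite pE qE.
  have sub K a b a' b' : slice_pt K a b - slice_pt K a' b' = slice_pt K (a - a') (b - b') :> H.
    by rewrite /slice_pt opprD addrACA -!scalerBl.
  rewrite -ler_sqr ?nnegrE ?qnorm_ge0// sub sqr_norm_pt//.
  have /imag_unitsP[I0 II] := hI; have /imag_unitsP[J0 JJ] := hJ.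
  have IJ : qdot J I <= 1.
    by have := qdot_le J I; rewrite !imag_unit_norm// mulr1.
  have -> : N (slice_pt J x' y' - slice_pt I x y) ^+ 2 =
    (x' - x) ^+ 2 + y' ^+ 2 + y ^+ 2 - y' * y * qdot J I *+ 2.
    rewrite sqr_qnorm -[y' ^+ 2]mulr1 -[y ^+ 2]mulr1 -{1}JJ -II /qdot.
    by rewrite !(qcoordE, qcoord1) I0 J0; ring.
  have : 0 <= y' * y * (1 - qdot J I) by rewrite !mulr_ge0 ?subr_ge0.
  lra.
- have -> : W `\` zeros W fs = \bigcup_(I in @imag_units R) ((W `\` zeros W fs) `&` cline I).
    apply/seteqP; split=> [q Wq|q [I hI []]//].
    have [I [x [y [hI _ qE]]]] := quat_slice q.
    by exists I => //; split=> //; rewrite qE; exact: cline_pt.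
  apply: bigcup_connected; last exact: cS.
  by exists x1%:A => I hI; split=> //; exact: clineA.
Qed.

End Symmetrization.

End Representation.

(** * Division and removable singularities *)

Section Division.
Variable R : realType.
Local Notation H := (quat R).
Local Notation N := (@qnorm R).
Implicit Types (I J p q z w v : H) (f g h P : H -> H) (W : set H).

Lemma open_near W p : open W -> W p -> exists2 d : R, 0 < d & forall q, N (q - p) < d -> W q.
Proof. by move=> /open_qnormP oW; exact: oW. Qed.

Lemma regular_sub W W' f : open W -> open W' -> W' `<=` W -> regular W f -> regular W' f.
Proof.
move=> oW oW' sub /(regularP _ oW) hf; apply/(regularP _ oW') => I p hI Wp Lp.
by apply: hf => //; exact: sub.
Qed.

Lemma divp_smooth I W f p a B C m z : imag_units I -> open W ->
  (forall z, W z -> cline I z -> slice_smooth I f z) -> cline I p ->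
  taylor I f p a B C -> (forall j, (j < m)%N -> a j = 0) ->
  W z -> cline I z -> slice_smooth I (divp f p m (a m)) z.
Proof.
move=> hI oW hf Lp ht a0 Wz Lz; have [->|zp] := eqVneq z p.
  by eexists; exact: taylor_smooth hI Lp (taylor_divp hI Lp ht a0).
have zp0 : z - p != 0 by rewrite subr_eq0.
apply: (@slice_smooth_near _ _ (fun z => ((z - p) ^+ m)^-1 * f z)) => //.
  exists (N (z - p)) => [|w Lw wz]; first by rewrite qnorm_gt0.
  by rewrite divpE//; apply: contraTneq wz => ->; rewrite qdistC ltxx.
apply: slice_smoothM => //; last 2 first.
- exact: hf.
- by exists 1 => // w Lw _; apply: clineV => //; apply: clineX => //; exact: clineB.
apply: slice_smoothV => //; first exact: slice_smoothX.
  by rewrite expq_eq0 (negPf zp0) andbF.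
by exists 1 => // w Lw _; apply: clineX => //; exact: clineB.
Qed.

Lemma cline_limit I f p (d : R) : imag_units I -> cline I p -> 0 < d -> slice_smooth I f p ->
  (forall z, pdisc I p d z -> cline I (f z)) -> cline I (f p).
Proof.
move=> hI Lp d0 hf h; apply/(clineP _ hI)/eqP; rewrite -subr_eq0 -qnorm_eq0.
rewrite eq_le qnorm_ge0 andbT; apply/ler_addgt0Pr => e e0; rewrite add0r.
have e2 : 0 < e / 2 by rewrite divr_gt0.
have [dl dl0 hd] := slice_smooth_continuous hI Lp hf e2.
have [|z [Lz /andP[z0]]] := @small_pdisc R I p (Num.min d dl) hI Lp; first by rewrite lt_min d0.
rewrite lt_min => /andP[z1 z2]; have H1 := hd z Lz z2.
have /(clineP _ hI) fz : cline I (f z) by apply: h; split=> //; rewrite z0.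
have -> : f p * I - I * f p = I * (f z - f p) - (f z - f p) * I.
  rewrite mulrBr mulrBl fz; move: (I * f z) (f p * I) (I * f p) => x1 x2 x3.
  by apply: quatP; rewrite !qcoordE; split; ring.
apply: le_trans (qnormB _ _) _; rewrite !qnormM imag_unit_norm//; lra.
Qed.

(** Only the value at p is in question: it is a limit of values in the slice, which is closed. *)
Lemma divp_line I W f p a B C m z : imag_units I -> open W ->
  (forall z, W z -> cline I z -> slice_smooth I f z) ->
  (forall z, W z -> cline I z -> cline I (f z)) -> cline I p -> W p ->
  taylor I f p a B C -> (forall j, (j < m)%N -> a j = 0) ->
  W z -> cline I z -> cline I (divp f p m (a m) z).
Proof.
move=> hI oW hf fL Lp Wp ht a0 Wz Lz.
have D w : W w -> cline I w -> w != p -> cline I (divp f p m (a m) w).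
  move=> Ww Lw wp; rewrite divpE//; apply: clineM => //; last exact: fL.
  by apply: clineV => //; apply: clineX => //; exact: clineB.
have [->|zp] := eqVneq z p; last exact: D.
have [d d0 h] := open_near oW Wp.
apply: (@cline_limit I _ p d) => //; first exact: (divp_smooth hI oW hf Lp ht a0 Wp Lp).
move=> w [Lw /andP[w0 wd]]; apply: D => //; first exact: h.
by rewrite -subr_eq0 -qnorm_gt0.
Qed.

(** If the coefficients below k vanish and k < m, then f divided by (z - p)^k tends to [a k], while
    the growth bound makes it tend to 0. The order of vanishing is thus visible in norms alone. *)
Lemma growth_taylor I f p a B C (M d : R) m : imag_units I -> cline I p -> 0 < d ->
  taylor I f p a B C -> (forall z, pdisc I p d z -> N (f z) <= M * N (z - p) ^+ m) ->
  forall j, (j < m)%N -> a j = 0.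
Proof.
move=> hI Lp d0 ht gr.
suff H k : (k <= m)%N -> forall j, (j < k)%N -> a j = 0 by apply: H.
elim: k => [//|k IH] km j; rewrite ltnS leq_eqVlt => /predU1P[->|jk]; last first.
  by apply: IH => //; exact: ltnW.
have a0 := IH (ltnW km).
have [D hD] : slice_smooth I (divp f p k (a k)) p.
  by eexists; exact: taylor_smooth hI Lp (taylor_divp hI Lp ht a0).
apply/eqP; rewrite -qnorm_eq0 eq_le qnorm_ge0 andbT.
apply/ler_addgt0Pr => e e0; rewrite add0r.
have e2 : 0 < e / 2 by rewrite divr_gt0.
have [dl dl0 hd] := slice_smooth_continuous hI Lp (ex_intro _ D hD) e2.
have M0 : 0 < `|M| + 1 by have := normr_ge0 M; lra.
have [|z [Lz /andP[z0]]] := @small_pdisc R I p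
    (Num.min (Num.min 1 (e / 2 / (`|M| + 1))) (Num.min d dl)) hI Lp.
  by rewrite !lt_min ltr01 d0 dl0 !divr_gt0.
rewrite !lt_min => /andP[/andP[z1 z2] /andP[z3 z4]].
have zp : z != p by rewrite -subr_eq0 -qnorm_gt0.
have H1 := hd z Lz z4; rewrite {2}/divp eqxx in H1.
have H2 : N (f z) <= M * N (z - p) ^+ m by apply: gr; split=> //; rewrite z0.
have H3 : N (divp f p k (a k) z) <= e / 2.
  rewrite divpE// qnormM qnormV qnormX ler_pdivrMl ?exprn_gt0//.
  apply: le_trans H2 _.
  have -> : m = (k + (m - k.+1).+1)%N by rewrite addnS -addSn subnKC.
  rewrite exprD mulrCA ler_pM2l ?exprn_gt0// exprS mulrA.
  have x1 : N (z - p) ^+ (m - k.+1) <= 1 by rewrite exprn_ile1 ?ltW.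
  have x2 : 0 <= N (z - p) ^+ (m - k.+1) by rewrite exprn_ge0 ?ltW.
  have x3 : M * N (z - p) <= e / 2.
    have : M * N (z - p) <= (`|M| + 1) * N (z - p).
      by rewrite ler_pM2r// (le_trans (ler_norm M))// lerDl.
    by move/ltW: z2; rewrite ler_pdivlMr//; lra.
  have : (e / 2 - M * N (z - p)) * N (z - p) ^+ (m - k.+1) >= 0 by rewrite mulr_ge0// subr_ge0.
  nra.
have := qnorm_dist_ge (a k) (divp f p k (a k) z); rewrite qdistC; lra.
Qed.

Lemma growth_divp I f p a B C m : imag_units I -> cline I p ->
  taylor I f p a B C -> (forall j, (j < m)%N -> a j = 0) ->
  exists M d : R, 0 < d /\ forall z, pdisc I p d z -> N (f z) <= M * N (z - p) ^+ m.
Proof.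
move=> hI Lp ht a0.
have [D hD] : slice_smooth I (divp f p m (a m)) p.
  by eexists; exact: taylor_smooth hI Lp (taylor_divp hI Lp ht a0).
have [dl dl0 hd] := slice_smooth_continuous hI Lp (ex_intro _ D hD) ltr01.
exists (N (a m) + 1), dl; split=> // z [Lz /andP[z0 zd]].
have := hd z Lz zd; rewrite {2}/divp eqxx divpE; last by rewrite -subr_eq0 -qnorm_gt0.
have := qnorm_dist_ge ((z - p) ^- m * f z) (a m).
have -> : N (f z) = N (z - p) ^+ m * N ((z - p) ^- m * f z).
  by rewrite qnormM qnormV qnormX mulrA divff ?mul1r// expf_eq0 gt_eqF ?andbF.
have : 0 <= N (z - p) ^+ m by rewrite exprn_ge0 ?ltW.
rewrite [_ * N (_ * _)]mulrC => x1 x2 x3; rewrite ler_wpM2r//; lra.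
Qed.

(** The value chosen at a zero q of P must serve all slices through q at once, a real constraint
    when q lies on the real axis. *)
Lemma removable_quotient W P f : open W ->
  (forall J z, imag_units J -> W z -> cline J z -> slice_smooth J P z) ->
  (forall J z, imag_units J -> W z -> cline J z -> P z != 0 ->
     slice_smooth J (fun z => (P z)^-1 * f z) z) ->
  (forall q, W q -> P q = 0 -> exists l, forall J, imag_units J -> cline J q ->
     slice_smooth J (fun z => if z == q then l else (P z)^-1 * f z) q /\
     exists2 d : R, 0 < d & forall z, pdisc J q d z -> P z != 0) ->
  exists2 w, regular W w & forall q, W q -> P q != 0 -> w q = (P q)^-1 * f q.
Proof.
move=> oW hP hq hr.
have /choice[l hl] : forall q, exists l, W q -> P q = 0 -> forall J, imag_units J -> cline J q ->
     slice_smooth J (fun z => if z == q then l else (P z)^-1 * f z) q /\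
     exists2 d : R, 0 < d & forall z, pdisc J q d z -> P z != 0.
  move=> q; have [[Wq Pq]|nq] := pselect (W q /\ P q = 0).
    by have [l hl] := hr q Wq Pq; exists l.
  by exists 0 => Wq Pq; exfalso; apply: nq.
exists (fun q => if P q == 0 then l q else (P q)^-1 * f q); last first.
  by move=> q _ /negPf ->.
apply/(regularP _ oW) => J q hJ Wq Lq; have [Pq|Pq] := eqVneq (P q) 0.
  have [hs [d d0 hd]] := hl q Wq Pq J hJ Lq.
  apply: slice_smooth_near hs => //; exists d => // z Lz zd.
  have [->|zq] := eqVneq z q; first by rewrite Pq eqxx.
  by rewrite (negPf (hd z _))//; split=> //; rewrite zd qnorm_gt0 subr_eq0 zq.
apply: slice_smooth_near (hq J q hJ Wq Lq Pq) => //.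
have [d d0 hd] := smooth_neq0_near hJ Lq (hP J q hJ Wq Lq) Pq.
by exists d => // z Lz zd; rewrite (negPf (hd z Lz zd)).
Qed.

End Division.

(** * Powers of q - p on the slices through p *)

Section LinearPowers.
Variable R : realType.
Local Notation H := (quat R).
Local Notation N := (@qnorm R).
Implicit Types (I J p q z w v : H).

Lemma openT_quat : open [set: H]. Proof. exact: openT. Qed.
Lemma symmetricT : symmetric_set [set: H]. Proof. by []. Qed.
Local Hint Resolve openT_quat symmetricT : core.

Lemma linear_regular (W : set H) p : open W -> regular W (fun q => q - p).
Proof.
move=> oW; apply/(regularP _ oW) => I z hI _ Lz.
by apply: slice_smoothB; [exact: slice_smooth_id|exact: slice_smooth_cst].
Qed.

Lemma cst_regular (W : set H) (c : H) : open W -> regular W (cst c).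
Proof. by move=> oW; apply/(regularP _ oW) => I z hI _ Lz; exact: slice_smooth_cst. Qed.

Lemma star_pow_regular p n : regular [set: H] (star_pow [set: H] (fun q => q - p) n).
Proof.
elim: n => [|n IH]; first exact: cst_regular.
by rewrite /star_pow iterS; apply: star_regular => //; exact: linear_regular.
Qed.

Lemma star_pow_slice I p z n : imag_units I -> cline I p -> cline I z ->
  star_pow [set: H] (fun q => q - p) n z = (z - p) ^+ n.
Proof.
move=> hI Lp Lz; elim: n => [//|n IH].
rewrite /star_pow iterS -/(star_pow _ _ n).
rewrite (star_preserving openT_quat symmetricT hI _ (star_pow_regular p n) _ Lz)//.
- by rewrite IH exprS.
- exact: linear_regular.
- exact: clineB.
Qed.

Lemma lin_pow_slice I p z (n : nat) : imag_units I -> cline I p -> cline I z ->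
  lin_pow p n z = (z - p) ^+ n.
Proof. exact: star_pow_slice. Qed.

(** On the slice the symmetrization of the power is (z - p)^(n+1) times its regular conjugate, the
    same power of z - \bar p. This factor cancels except at \bar p. *)
Lemma lin_powN_slice I p z n : imag_units I -> cline I p -> cline I z ->
  z != p -> z != qconj p -> lin_pow p (Negz n) z = (z - p) ^- n.+1.
Proof.
move=> hI Lp Lz zp zp'; rewrite /lin_pow /regrecip.
have hP := star_pow_regular p n.+1; have Lz' := cline_conj hI Lz.
have nil : (0 : H) * I = - (I * 0) by rewrite mul0r mulr0 oppr0.
have parts w : cline I w -> cpart I ((w - p) ^+ n.+1) = (w - p) ^+ n.+1 /\
    apart I ((w - p) ^+ n.+1) = 0.
  move=> Lw; apply: (part_unique hI (esym (addr0 _))) => //.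
  by apply: clineX => //; exact: clineB.
rewrite (symmetrizationE openT_quat symmetricT hI hP (Logic.I : [set: H] z) Lz).
rewrite (regconjE openT_quat symmetricT hI hP (Logic.I : [set: H] z) Lz).
rewrite !(star_pow_slice _ hI Lp)//.
have [-> ->] := parts z Lz; have [-> ->] := parts _ Lz'.
rewrite mul0r !subr0 qconjX qconjB qconjK.
have Lp' := cline_conj hI Lp.
have La : cline I ((z - p) ^+ n.+1) by apply: clineX => //; exact: clineB.
have Lb : cline I ((z - qconj p) ^+ n.+1) by apply: clineX => //; exact: clineB.
have a0 : (z - p) ^+ n.+1 != 0 by rewrite expq_eq0 subr_eq0 (negPf zp).
have b0 : (z - qconj p) ^+ n.+1 != 0 by rewrite expq_eq0 subr_eq0 (negPf zp').
by rewrite (cline_comm hI La Lb) invrM// -mulrA mulVq// mulr1.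
Qed.

End LinearPowers.

(** * Laurent expansions of the quotient *)

Section Laurent.
Variable R : realType.
Local Notation H := (quat R).
Local Notation N := (@qnorm R).
Implicit Types (I J p q z w v : H) (f g h : H -> H) (W : set H).

(** The Laurent coefficients of (z - p)^(-m) times the series with coefficients b: the shift of b by
    m, where [Negz n] stands for -(n + 1). *)
Definition laurent_coef (b : nat -> H) (m : nat) (k : int) : H :=
  match k with
  | Posz n => b (n + m)%N
  | Negz n => if (n < m)%N then b (m - n.+1)%N else 0
  end.

Lemma laurent_coef_bound b m : principal_bound (laurent_coef b m) m.
Proof.
move=> [//|k]; rewrite ltnS => mk.
by rewrite -NegzE /= ltnNge mk.
Qed.

Lemma cvg_eventually_const (u : nat -> H) l n0 : (forall n, (n0 <= n)%N -> u n = l) ->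
  u @ \oo --> l.
Proof. by move=> h; apply: cvg_near_cst; exists n0 => // n /= /h ->. Qed.

Lemma slice_laurent I p (u : H -> H) b B C m z : imag_units I -> cline I p -> taylor I u p b B C ->
  cline I z -> z != p -> z != qconj p -> C * N (z - p) <= 1 / 2 ->
  exists s t : H, [/\
    series (fun n => lin_pow p n%:Z z * laurent_coef b m n%:Z) @ \oo --> s,
    series (fun n => lin_pow p (- n.+1%:Z) z * laurent_coef b m (- n.+1%:Z)) @ \oo --> t &
    (z - p) ^- m * u z = s + t].
Proof.
move=> hI Lp ht Lz zp zp' zC; have [B0 C0 hT] := ht.
have d0 : z - p != 0 by rewrite subr_eq0.
have dk k : (z - p) ^+ k != 0 by rewrite expq_eq0 (negPf d0) andbF.
(* These m terms are the ones that move to negative powers: the second series becomes constant at S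
   divided by (z - p)^m, and only the first needs the remainder bound. *)
pose S : H := \sum_(j < m) (z - p) ^+ j * b j.
exists ((z - p) ^- m * (u z - S)), ((z - p) ^- m * S); split; last by rewrite -mulrDr subrK.
- apply/cvg_qnormP => e e0.
  pose K := N ((z - p) ^- m) * B.
  have c : (fun k => K * (1 / 2 : R) ^+ k) @ \oo --> (K * 0 : R).
    by apply: cvgMl_tmp; apply: cvg_expr; rewrite ger0_norm//; lra.
  rewrite mulr0 in c.
  apply: filterS ((cvgrPdist_le _ _).1 c e e0) => k.
  have K0 : 0 <= K by rewrite mulr_ge0 ?qnorm_ge0.
  rewrite sub0r normrN ger0_norm => [ke|]; last by rewrite mulr_ge0 ?exprn_ge0.
  apply: le_trans ke; rewrite qdistC.
  have -> : (z - p) ^- m * (u z - S) - series (fun n => lin_pow p n%:Z z * laurent_coef b m n%:Z) k =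
     (z - p) ^- m * (u z - \sum_(j < m + k) (z - p) ^+ j * b j).
    rewrite big_split_ord/= -/S opprD addrA [RHS]mulrBr; congr (_ - _).
    rewrite /series/= big_mkord mulr_sumr; apply: eq_bigr => j _.
    rewrite /= (star_pow_slice _ hI Lp Lz) exprD -mulrA (mulrA _ (_ ^+ m)) mulVq// mul1r.
    by rewrite addnC.
  rewrite qnormM /K -mulrA ler_wpM2l ?qnorm_ge0//.
  apply: le_trans (hT z Lz zC (m + k)%N) _; rewrite ler_wpM2l// exprD.
  have t0 : 0 <= C * N (z - p) by rewrite mulr_ge0 ?qnorm_ge0// ltW.
  have y1 : (C * N (z - p)) ^+ m <= 1 by rewrite exprn_ile1//; lra.
  have y2 : (C * N (z - p)) ^+ k <= (1 / 2) ^+ k by rewrite lerXn2r ?nnegrE.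
  apply: le_trans y2; rewrite ler_piMl ?exprn_ge0//.
- apply: (@cvg_eventually_const _ _ m) => n mn.
  rewrite /series/= (big_cat_nat (leq0n m) mn)/=.
  have -> : \sum_(m <= j < n) lin_pow p (- j.+1%:Z) z * laurent_coef b m (- j.+1%:Z) = 0.
    rewrite big_nat_cond big1// => j /andP[/andP[mj _] _].
    have -> : - Posz j.+1 = Negz j by [].
    by rewrite /= ltnNge mj mulr0.
  rewrite addr0.
  rewrite big_mkord (reindex_inj rev_ord_inj)/= mulr_sumr; apply: eq_bigr => j _.
  have jm := ltn_ord j.
  have h1 := lin_powN_slice (m - j.+1) hI Lp Lz zp zp'; rewrite /= in h1; rewrite h1.
  have -> : (m - j.+1 < m)%N by rewrite subnSK// leq_subr.
  have -> : (m - (m - j.+1).+1)%N = j by rewrite subnSK// subKn// ltnW.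
  rewrite mulrA; congr (_ * _).
  have E : (z - p) ^+ m = (z - p) ^+ j * (z - p) ^+ (m - j.+1).+1.
    by rewrite -exprD subnSK// subnKC// ltnW.
  by rewrite E invrM ?unitq ?dk// -mulrA mulVq ?dk// mulr1.
Qed.

Section Quotient.
Variables (W : set H) (dW : symmetric_slice_domain W) (f g : H -> H).
Hypotheses (hf : regular W f) (hg : regular W g) (f0 : exists2 q, W q & f q != 0).
Let sW : symmetric_set W. Proof. by case: dW. Qed.
Let oW : open W. Proof. by case: dW => _ []. Qed.
Local Notation fs := (symmetrization W f).
Local Notation W' := (W `\` zeros W fs).
Let dW' : symmetric_slice_domain W'. Proof. exact: quotient_domain. Qed.
Let sW' : symmetric_set W'. Proof. by case: dW'. Qed.
Let oW' : open W'. Proof. by case: dW' => _ []. Qed.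
Let subW : W' `<=` W. Proof. by move=> q []. Qed.
Local Notation num := (star W (regconj W f) g).
Local Notation quot := (star W' (regrecip W f) g).

Let hfs : regular W fs. Proof. exact: symmetrization_regular. Qed.
Let hc : regular W (regconj W f). Proof. exact: regconj_regular. Qed.

Lemma domain_neq0 q : W' q -> fs q != 0.
Proof. by move=> [Wq nZ]; apply/eqP => e; apply: nZ. Qed.

Lemma symmetrization_line_near I p : imag_units I -> W p -> cline I p ->
  exists2 d : R, 0 < d & forall z, cline I z -> N (z - p) < d -> cline I (fs z).
Proof.
move=> hI Wp Lp; have [d d0 h] := open_near oW Wp; exists d => // z Lz zd.
by apply: symmetrization_line => //; exact: h.
Qed.

Lemma symmetrizationV_smooth I p : imag_units I -> W' p -> cline I p ->
  slice_smooth I (fun z => (fs z)^-1) p.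
Proof.
move=> hI Wp Lp; apply: slice_smoothV => //.
- by apply: (regularP _ oW).1 => //; exact: subW.
- exact: domain_neq0.
- by apply: symmetrization_line_near => //; exact: subW.
Qed.

Lemma regrecip_regular : regular W' (regrecip W f).
Proof.
apply/(regularP _ oW') => I p hI Wp Lp; have Wp' := subW Wp.
rewrite /regrecip; apply: slice_smoothM => //; first exact: symmetrizationV_smooth.
  exact: (regularP _ oW).1.
have [d d0 h] := symmetrization_line_near hI Wp' Lp.
by exists d => // z Lz zd; apply: clineV => //; exact: h.
Qed.

Let hg' : regular W' g. Proof. exact: regular_sub hg. Qed.

Lemma quotient_regular : regular W' quot.
Proof. exact (star_regular oW' sW' regrecip_regular hg'). Qed.

Lemma numerator_regular : regular W num.
Proof. exact (star_regular oW sW hc hg). Qed.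

(** On the slice f^s takes values that commute with I, so its inverse factors out of both parts of
    its product with f^c. *)
Lemma quotientE I z : imag_units I -> W' z -> cline I z -> quot z = (fs z)^-1 * num z.
Proof.
move=> hI Wz Lz; rewrite (starE oW' sW' hI regrecip_regular hg' Wz Lz).
rewrite (starE oW sW hI hc hg (subW Wz) Lz) /regrecip.
have /(clineP _ hI) uI : cline I (fs z)^-1.
  by apply: clineV => //; apply: symmetrization_line => //; exact: subW.
set u := _^-1 in uI *; rewrite mulrDr !mulrA; congr (_ * _ + _ * _).
  by rewrite /cpart -scalerAr mulrBr !mulrA uI.
by rewrite /apart -scalerAr mulrDr !mulrA uI.
Qed.

Lemma quotient_factor I p : imag_units I -> zeros W fs p -> cline I p ->
  exists m a B C b B' C' d, [/\
    taylor I fs p a B C, forall j, (j < m)%N -> a j = 0, a m != 0,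
    taylor I (fun z => (divp fs p m (a m) z)^-1 * num z) p b B' C' &
    0 < d /\ forall z, pdisc I p d z -> [/\ W' z, C' * N (z - p) <= 1 / 2 &
      quot z = (z - p) ^- m * ((divp fs p m (a m) z)^-1 * num z)]].
Proof.
move=> hI [Wp fp] Lp.
have hsm z : W z -> cline I z -> slice_smooth I fs z.
  by move=> Wz Lz; exact: (regularP _ oW).1.
have fL z : W z -> cline I z -> cline I (fs z).
  by move=> Wz Lz; exact: symmetrization_line.
have [a [B [C ht]]] := open_taylor hI oW Wp Lp hsm.
have [d1 d10 h1] := symmetrization_isolated dW hf f0 hI Wp Lp.
have [z0|[m [a0 am]]] := taylor_dichotomy ht.
  have [_ C0 _] := ht.
  have [|z [Lz /andP[zp zd]]] := @small_pdisc R I p (Num.min d1 (2 * C)^-1) hI Lp.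
    by rewrite lt_min d10 invr_gt0 mulr_gt0.
  move: zd; rewrite lt_min => /andP[zd zC]; exfalso.
  apply: (h1 z); first by split=> //; rewrite zp.
  by apply: z0 => //; move/ltW: zC; rewrite -[_^-1]mul1r ler_pdivlMr ?mulr_gt0//; lra.
set D := divp fs p m (a m).
have hD z : W z -> cline I z -> slice_smooth I D z.
  by move=> Wz Lz; exact: (divp_smooth hI oW hsm Lp ht a0).
have DL z : W z -> cline I z -> cline I (D z).
  by move=> Wz Lz; exact: (divp_line hI oW hsm fL Lp Wp ht a0).
have Dp : D p != 0 by rewrite /D /divp eqxx.
have [d2 d20 h2] := smooth_neq0_near hI Lp (hD p Wp Lp) Dp.
have [d3 d30 h3] := open_near oW Wp.
pose d4 := Num.min d2 d3 / 2.
have d40 : 0 < d4 by rewrite divr_gt0// lt_min d20.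
have [|b [B' hb]] := @taylor_exists R I (fun z => (D z)^-1 * num z) p d4 hI Lp d40.
  move=> z Lz zd.
  have : N (z - p) < Num.min d2 d3 by move: d40; rewrite /d4 in zd *; lra.
  rewrite lt_min => /andP[z2 z3]; have Wz := h3 z z3.
  have DLz : exists2 d : R, 0 < d & forall w, cline I w -> N (w - z) < d -> cline I (D w).
    by have [d d0 h] := open_near oW Wz; exists d => // w Lw wz; apply: DL => //; exact: h.
  apply: slice_smoothM => //.
  - apply: slice_smoothV => //; [exact: hD|exact: h2].
  - exact ((regularP _ oW).1 numerator_regular I z hI Wz Lz).
  - by have [d d0 h] := DLz; exists d => // w Lw wz; apply: clineV => //; exact: h.
(* The radius d1 keeps z away from the other zeros of f^s, and d4 / 2 is where the expansion with
   inverse radius d4^-1 is valid. *)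
exists m, a, B, C, b, B', d4^-1, (Num.min d1 (Num.min d4 (d4 / 2))); split=> //.
split; first by rewrite !lt_min d10 d40 divr_gt0.
move=> z [Lz /andP[zp]]; rewrite !lt_min => /andP[z1 /andP[z4 z5]].
have : N (z - p) < Num.min d2 d3 by move: d40; rewrite /d4 in z4 *; lra.
rewrite lt_min => /andP[z2 z3]; have Wz := h3 z z3.
have Wz' : W' z by split=> // -[_]; apply: h1; split=> //; rewrite zp.
have zne : z != p by rewrite -subr_eq0 -qnorm_gt0.
have d0 : z - p != 0 by rewrite subr_eq0.
have dm : (z - p) ^+ m != 0 by rewrite expq_eq0 (negPf d0) andbF.
have fE : fs z = (z - p) ^+ m * D z.
  by rewrite /D divpE// mulrA mulqV// mul1r.
have Dz := h2 z Lz z2.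
split=> //.
  by rewrite mulrC ler_pdivrMr//; lra.
rewrite (quotientE hI Wz' Lz) fE mulrA; congr (_ * _).
rewrite (cline_comm hI _ (DL z Wz Lz)); last by apply: clineX => //; exact: clineB.
by rewrite invrM.
Qed.

End Quotient.

End Laurent.

(** * From slices to sigma balls, and the bound on the order *)

Section Pole.
Variable R : realType.
Local Notation H := (quat R).
Local Notation N := (@qnorm R).
Implicit Types (I J p q z w v : H) (f g h F : H -> H) (W : set H).

Lemma cvg_qmull (u : nat -> H) (c l : H) : u @ \oo --> l -> (fun n => c * u n) @ \oo --> c * l.
Proof.
move=> /cvg_qnormP hu; apply/cvg_qnormP => e e0.
have c0 : 0 < N c + 1 by have := qnorm_ge0 c; lra.
apply: filterS (hu _ (divr_gt0 e0 c0)) => n un.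
rewrite -mulrBr qnormM; move: un; rewrite ler_pdivlMr// => un.
have := qnorm_ge0 (u n - l); have := qnorm_ge0 c; nra.
Qed.

Lemma qlim_unique (u : nat -> H) (l l' : H) : u @ \oo --> l -> u @ \oo --> l' -> l = l'.
Proof.
move=> /cvg_qnormP h /cvg_qnormP h'; apply/eqP; rewrite -subr_eq0 -qnorm_eq0.
rewrite eq_le qnorm_ge0 andbT; apply/ler_addgt0Pr => e e0; rewrite add0r.
have e2 : 0 < e / 2 by rewrite divr_gt0.
have [n [/= h1 h2]] := filter_ex (filterI (h _ e2) (h' _ e2)).
by have := ler_distqD (u n) l l'; rewrite (qdistC l (u n)); lra.
Qed.

Lemma qlim_le (u : nat -> H) (l : H) (M : R) : u @ \oo --> l -> (forall n, N (u n) <= M) -> N l <= M.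
Proof.
move=> /cvg_qnormP h hM; apply/ler_addgt0Pr => e e0.
have [n /= h1] := filter_ex (h _ e0).
have := qnorm_dist_ge l (u n); rewrite qdistC; have := hM n; lra.
Qed.

Lemma punctured_ball_line I p q (r : R) : imag_units I -> cline I p -> cline I q ->
  punctured_sigma_ball p r q <-> pdisc I p r q.
Proof.
move=> hI Lp Lq; rewrite /punctured_sigma_ball /tau_dist /sigma_dist /=.
have -> : `[< common_cline p q >] by apply/asboolP; exists I.
by split=> [[h1 h2]|[_ /andP[h1 h2]]]; split=> //; rewrite h1.
Qed.

(** Off the slice of p the distance sigma is at least |Im p| = y. A ball of radius at most y
    therefore lies in one slice, and an expansion there is all that is required at a nonreal
    point. *)
Lemma punctured_ball_nonreal I x y q (r : R) : imag_units I -> 0 < y -> r <= y ->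
  punctured_sigma_ball (slice_pt I x y) r q -> cline I q.
Proof.
move=> hI y0 ry; rewrite /punctured_sigma_ball /sigma_dist /=.
case: asboolP => [[J [hJ [a [b e]] [a' [b' ->]]]] _|_ [_]].
  have b0 : y *: I = b *: J.
    have := congr1 (@qim R) e.
    by rewrite -[a%:A + _]/(slice_pt J a b) !qim_pt.
  have bn : b != 0.
    apply: contraTneq (y0) => b0'; move/eqP: b0; rewrite b0' scale0r scaler_eq0.
    by rewrite (negPf (imag_unit_neq0 hI)) orbF => /eqP ->; rewrite ltxx.
  have -> : J = (b^-1 * y) *: I by rewrite -scalerA b0 scalerA mulVf ?scale1r.
  by rewrite scalerA; exact: cline_pt.
move=> h; exfalso; move: h; apply/negP; rewrite -leNgt; apply: le_trans ry _.
rewrite -(ger0_norm (sqrtr_ge0 _)) -{1}(gtr0_norm y0) -ler_sqr ?nnegrE//.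
rewrite !ger0_norm ?sqrtr_ge0 ?(ltW y0)// sqr_sqrtr ?addr_ge0 ?sqr_ge0//.
rewrite qim_pt// qnormZ (imag_unit_norm hI) mulr1 (gtr0_norm y0).
have := sqr_ge0 (qre q - qre (slice_pt I x y)).
have := qnorm_ge0 (qim q) => q0; have : 0 <= N (qim q) * y by rewrite mulr_ge0// ltW.
have := sqr_ge0 (N (qim q)).
by rewrite sqrrD; lra.
Qed.

Lemma sub_real_pt J x y x' : slice_pt J x' y - x%:A = slice_pt J (x' - x) y :> H.
Proof. by rewrite /slice_pt scalerBl addrAC. Qed.

Lemma real_pdisc I J x x' y (d : R) : imag_units I -> imag_units J ->
  pdisc J x%:A d (slice_pt J x' y) -> pdisc I x%:A d (slice_pt I x' y).
Proof.
move=> hI hJ [_ h]; split; first exact: cline_pt.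
suff -> : N (slice_pt I x' y - x%:A) = N (slice_pt J x' y - x%:A) by [].
by apply/eqP; rewrite !sub_real_pt -(@eqrXn2 _ 2)// ?qnorm_ge0// !sqr_norm_pt.
Qed.

(* The representation formula carries the expansion from one slice to the
   others, with the same coefficients and the same radius. *)
Lemma laurent_real W F I x a (d : R) : symmetric_slice_domain W -> regular W F ->
  ~ W x%:A -> imag_units I -> 0 < d ->
  (forall z, pdisc I x%:A d z -> W z /\ exists s t : H, [/\
    series (fun n => lin_pow x%:A n%:Z z * a n%:Z) @ \oo --> s,
    series (fun n => lin_pow x%:A (- n.+1%:Z) z * a (- n.+1%:Z)) @ \oo --> t & F z = s + t]) ->
  laurent W F x%:A a.
Proof.
move=> dW hF nW hI d0 h; have [sW [oW _ _ _]] := dW; set p : H := x%:A in nW h *.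
have Lp J : imag_units J -> cline J p by move=> hJ; exact: clineA.
(* For p real the linear powers are ordinary powers at every point of W, since p is not in W. They
   are regular there, so the representation formula applies to each term of the series. *)
pose lin (k : int) (q : H) : H :=
  match k with Posz n => (q - p) ^+ n | Negz n => (q - p) ^- n.+1 end.
have qp q : W q -> q != p by move=> Wq; apply: contra_notN nW => /eqP <-.
have linE k q : W q -> lin_pow p k q = lin k q.
  move=> Wq; have [J [x' [y' [hJ _ qE]]]] := quat_slice q.
  have Lq : cline J q by rewrite qE; exact: cline_pt.
  case: k => n; first exact: lin_pow_slice hJ (Lp J hJ) Lq.
  by apply: (lin_powN_slice n hJ (Lp J hJ) Lq); rewrite ?qconjA qp.
have linR k : regular W (lin k).
  apply/(regularP _ oW) => J z hJ Wz Lz; case: k => n.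
    exact: slice_smoothX (Lp J hJ).
  apply: slice_smoothV => //.
  - exact: slice_smoothX (Lp J hJ).
  - by rewrite expq_eq0 subr_eq0 qp.
  - by exists 1 => // w Lw _; apply: clineX => //; apply: clineB => //; exact: Lp.
exists d; split=> // q.
  have [J [x' [y' [hJ _ ->]]]] := quat_slice q.
  move/(punctured_ball_line _ hJ (Lp J hJ) (cline_pt J x' y')) => /(real_pdisc hI hJ)/h[Wz _].
  exact: domain_pt Wz.
have [J [x' [y' [hJ _ qE]]]] := quat_slice q; rewrite {}qE.
move/(punctured_ball_line _ hJ (Lp J hJ) (cline_pt J x' y')) => /(real_pdisc hI hJ) zd.
have zd' : pdisc I p d (slice_pt I x' (- y')).
  move: zd => [Lz zd]; split; first exact: cline_pt.
  by rewrite -qconj_pt// -[p](qconjA x) -qconjB qnorm_conj.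
have [Wz [s [t [hs ht FE]]]] := h _ zd; have [Wz' [s' [t' [hs' ht' FE']]]] := h _ zd'.
have Wq : W (slice_pt J x' y') by exact: domain_pt Wz.
(* The combination of the representation formula is right linear, so it passes through the
   coefficients on the right and through the sums. *)
pose rep (u u' : H) : H := 2^-1 *: ((1 - J * I) * u + (1 + J * I) * u').
have repD u u' v v' : rep u u' + rep v v' = rep (u + v) (u' + v').
  by rewrite /rep -scalerDr addrACA -!mulrDr.
have repM u u' c : rep u u' * c = rep (u * c) (u' * c).
  by rewrite /rep -scalerAl mulrDl !mulrA.
have lrep k : lin_pow p k (slice_pt J x' y') =
    rep (lin_pow p k (slice_pt I x' y')) (lin_pow p k (slice_pt I x' (- y'))).
  rewrite !linE//; exact: representation dW (linR k) hI hJ Wz.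
have cv (k : nat -> int) u u' :
    series (fun n => lin_pow p (k n) (slice_pt I x' y') * a (k n)) @ \oo --> u ->
    series (fun n => lin_pow p (k n) (slice_pt I x' (- y')) * a (k n)) @ \oo --> u' ->
    series (fun n => lin_pow p (k n) (slice_pt J x' y') * a (k n)) @ \oo --> rep u u'.
  move=> hu hu'.
  have -> : series (fun n => lin_pow p (k n) (slice_pt J x' y') * a (k n)) =
     (fun n => rep (series (fun n => lin_pow p (k n) (slice_pt I x' y') * a (k n)) n)
                   (series (fun n => lin_pow p (k n) (slice_pt I x' (- y')) * a (k n)) n)).
    apply: funext => n; rewrite /series/=; elim: n => [|n IH].
      by rewrite !big_geq// /rep !mulr0 addr0 scaler0.
    by rewrite !big_nat_recr//= IH lrep repM repD.
  rewrite /rep; apply: cvgZl_tmp; apply: cvgD; exact: cvg_qmull.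
exists (rep s s'), (rep t t'); split.
- exact: (cv (fun n => n%:Z)).
- exact: (cv (fun n => - n.+1%:Z)).
- by rewrite repD -FE -FE'; exact: representation dW hF hI hJ Wz.
Qed.

(** Multiplied by a power of z - p of exponent n > m, the expansion has all its terms but the
    coefficient of index -n of size N (z - p). As z tends to p along the slice this coefficient is
    0, against the minimality of n. The argument applies to any expansion of F. *)
Lemma laurent_order_le W F I p a (M d : R) m n : imag_units I -> cline I p -> 0 < d ->
  (forall z, pdisc I p d z -> N ((z - p) ^+ m * F z) <= M) ->
  laurent W F p a -> least (principal_bound a) n -> (n <= m)%N.
Proof.
move=> hI Lp d0 hM [r [r0 rW hr]] [bn ln]; rewrite leqNgt; apply/negP => mn.
case: n bn ln mn => [//|n] bn ln mn.
suff an : a (- n.+1%:Z) = 0.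
  have : (n.+1 <= n)%N.
    apply: ln => k; rewrite leq_eqVlt => /predU1P[<-//|]; exact: bn.
  by rewrite ltnn.
have hball z : pdisc I p r z -> exists s t : H, [/\
    series (fun n => (z - p) ^+ n * a n%:Z) @ \oo --> s,
    series (fun n => lin_pow p (- n.+1%:Z) z * a (- n.+1%:Z)) @ \oo --> t & F z = s + t].
  move=> zr; have [Lz _] := zr.
  have [|s [t [hs ht E]]] := hr z; first exact/(punctured_ball_line _ hI Lp Lz).
  exists s, t; split=> //.
  by under eq_fun do rewrite -(lin_pow_slice _ hI Lp Lz).
have [z0 hz0] := small_pdisc hI Lp r0.
have [Lz0 /andP[z00 z0r]] := hz0.
have [s0 [t0 [/cvg_qnormP/(_ 1 ltr01) [k0 _ hk0] _ _]]] := hball z0 hz0.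
set rho := N (z0 - p) in z00 z0r.
(* From k0 on, two consecutive partial sums at z0 are within 1 of their limit, so a term is at most
   2; the finite sum takes care of the earlier terms. *)
pose K : R := 2 + \sum_(i < k0) N ((z0 - p) ^+ i * a i%:Z).
have K2 : 0 <= \sum_(i < k0) N ((z0 - p) ^+ i * a i%:Z) by apply: sumr_ge0 => i _; exact: qnorm_ge0.
have hK k : N (a k%:Z) * rho ^+ k <= K.
  rewrite mulrC -qnormX -qnormM; have [kk|kk] := leqP k0 k.
    have := hk0 k kk; have := hk0 k.+1 (leqW kk); rewrite /= /series/= big_nat_recr//=.
    set S := \sum_(0 <= _ < _) _ => h1 h2.
    have -> : (z0 - p) ^+ k * a k = (S + (z0 - p) ^+ k * a k - s0) - (S - s0).
      by rewrite opprB addrA subrK addrC addKr.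
    by rewrite (le_trans (qnormB _ _))// /K; lra.
  rewrite /K (bigD1 (Ordinal kk))//=.
  have : 0 <= \sum_(i < k0 | i != Ordinal kk) N ((z0 - p) ^+ i * a i%:Z).
    by apply: sumr_ge0 => i _; exact: qnorm_ge0.
  lra.
pose T : R := \sum_(k < n) N (a (Negz k)).
have T0 : 0 <= T by apply: sumr_ge0 => i _; exact: qnorm_ge0.
have M0 : 0 <= M.
  by have [w hw] := small_pdisc hI Lp d0; apply: le_trans (hM w hw); exact: qnorm_ge0.
(* M accounts for the bounded function, 2 * K for the nonnegative powers at half the distance of z0,
   and T for the other negative powers. *)
pose G : R := M + 2 * K + T + 1.
have G0 : 0 < G by rewrite /G /K; lra.
have key z : pdisc I p d z -> pdisc I p r z -> N (z - p) <= 1 -> N (z - p) <= rho / 2 ->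
    z != qconj p -> N (a (Negz n)) <= N (z - p) * G.
  move=> zd zr z1 zrho zp'; have [Lz /andP[zp0 _]] := zd.
  have zp : z != p by rewrite -subr_eq0 -qnorm_gt0.
  have [s [t [hs ht FE]]] := hball z zr.
  have sK : N s <= 2 * K.
    apply: (qlim_le hs) => k; rewrite /series/=.
    apply: le_trans (qnorm_sum _ _ _) _.
    apply: (@le_trans _ _ (\sum_(0 <= i < k) K * (1 / 2) ^+ i)).
      apply: ler_sum => i _; rewrite qnormM qnormX.
      have hz : N (z - p) ^+ i <= (rho / 2) ^+ i by rewrite lerXn2r ?nnegrE ?qnorm_ge0// divr_ge0// ltW.
      apply: (@le_trans _ _ ((rho / 2) ^+ i * N (a i))); first by rewrite ler_wpM2r ?qnorm_ge0.
      have -> : (rho / 2) ^+ i * N (a i) = N (a i) * rho ^+ i * (1 / 2) ^+ i.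
        by rewrite div1r exprMn; ring.
      by rewrite ler_wpM2r ?exprn_ge0.
    rewrite -mulr_sumr; have := @geometric_tail R (1 / 2) 0 k; rewrite expr0 mulr1 => hg.
    have K0 : 0 <= K by rewrite /K; lra.
    apply: le_trans (ler_wpM2l K0 (hg _ _)) _ => //; last by lra.
    by apply/andP; split; lra.
  have tE : t = \sum_(k < n.+1) (z - p) ^- k.+1 * a (Negz k).
    apply: (qlim_unique ht); apply: (@cvg_eventually_const _ _ _ n.+1) => k nk.
    rewrite /series/= (big_cat_nat (leq0n n.+1) nk)/=.
    have -> : \sum_(n.+1 <= j < k) lin_pow p (- j.+1%:Z) z * a (- j.+1%:Z) = 0.
      by rewrite big_nat_cond big1// => j /andP[/andP[mj _] _]; rewrite bn ?mulr0.
    rewrite addr0 big_mkord; apply: eq_bigr => j _.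
    by have := lin_powN_slice j hI Lp Lz zp zp' => /= ->.
  have d0' : z - p != 0 by rewrite subr_eq0.
  have dk k : (z - p) ^+ k != 0 by rewrite expq_eq0 (negPf d0') andbF.
  have E : (z - p) ^+ n.+1 * F z = (z - p) ^+ n.+1 * s +
      (\sum_(k < n) (z - p) ^+ (n - k) * a (Negz k) + a (Negz n)).
    rewrite FE mulrDr tE mulr_sumr big_ord_recr/=; congr (_ + (_ + _)); last first.
      by rewrite mulrA mulqV// mul1r.
    apply: eq_bigr => k _; rewrite mulrA; congr (_ * _).
    have -> : (z - p) ^+ n.+1 = (z - p) ^+ (n - k) * (z - p) ^+ k.+1.
      by rewrite -exprD addnS subnK// ltnW.
    by rewrite -mulrA mulqV// mulr1.
  have -> : a (Negz n) = (z - p) ^+ n.+1 * F z - (z - p) ^+ n.+1 * s -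
      \sum_(k < n) (z - p) ^+ (n - k) * a (Negz k).
    by rewrite E [(z - p) ^+ n.+1 * s + _]addrC addrK [X in X - _]addrC addrK.
  have zk k : (0 < k)%N -> N (z - p) ^+ k <= N (z - p).
    by case: k => // k _; rewrite exprS ler_piMr ?qnorm_ge0// exprn_ile1 ?qnorm_ge0.
  have E1 : N ((z - p) ^+ n.+1 * F z) <= N (z - p) * M.
    have -> : n.+1 = ((n.+1 - m) + m)%N by rewrite subnK// ltnW.
    rewrite exprD -mulrA qnormM qnormX ler_pM ?exprn_ge0 ?qnorm_ge0//; last exact: hM.
    by apply: zk; rewrite subn_gt0.
  have E2 : N ((z - p) ^+ n.+1 * s) <= N (z - p) * (2 * K).
    by rewrite qnormM qnormX ler_pM ?exprn_ge0 ?qnorm_ge0// zk.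
  have E3 : N (\sum_(k < n) (z - p) ^+ (n - k) * a (Negz k)) <= N (z - p) * T.
    apply: le_trans (qnorm_sum _ _ _) _; rewrite /T mulr_sumr; apply: ler_sum => k _.
    by rewrite qnormM qnormX ler_wpM2r ?qnorm_ge0// zk// subn_gt0.
  apply: le_trans (qnormB _ _) _.
  have := qnormB ((z - p) ^+ n.+1 * F z) ((z - p) ^+ n.+1 * s).
  rewrite /G; lra.
have -> : - n.+1%:Z = Negz n by [].
apply/eqP; rewrite -qnorm_eq0 eq_le qnorm_ge0 andbT; apply/ler_addgt0Pr => e e0; rewrite add0r.
(* The formula for the negative powers fails at the conjugate of p, which z must avoid. When p is
   real the conjugate is p itself, already excluded, and any radius will do. *)
pose cj : R := if qconj p == p then 1 else N (qconj p - p).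
have cj0 : 0 < cj by rewrite /cj; case: eqVneq => // ne; rewrite qnorm_gt0 subr_eq0.
have [|z [Lz /andP[z0' zm]]] := @small_pdisc R I p
   (Num.min (Num.min d r) (Num.min (Num.min 1 (rho / 2)) (Num.min cj (e / G)))) hI Lp.
  by rewrite !lt_min d0 r0 ltr01 cj0 !divr_gt0.
move: zm; rewrite !lt_min => /andP[/andP[z1 z2] /andP[/andP[z3 z4] /andP[z5 z6]]].
apply: le_trans (key z _ _ (ltW z3) (ltW z4) _) _.
- by split=> //; rewrite z0'.
- by split=> //; rewrite z0'.
- apply: contraTneq z5 => zE; rewrite -leNgt /cj zE; case: eqVneq => // pp.
  by move: z0'; rewrite zE pp subrr qnorm0 ltxx.
- by move/ltW: z6; rewrite ler_pdivlMr.
Qed.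

End Pole.

(** * The classical multiplicity *)

Section Multiplicity.
Variable R : realType.
Local Notation H := (quat R).
Local Notation N := (@qnorm R).
Implicit Types (I J p q z v : H) (f g h w F : H -> H).
Local Hint Resolve openT_quat symmetricT : core.

(** The regular product of q - p and q - \bar p. Its coefficients are 2 Re p and |p|^2 up to sign,
    so it depends only on the sphere of p. *)
Definition sphere_poly p q : H := q * q - q * (p + qconj p) + p * qconj p.

Lemma addq_conj p : p + qconj p = (qre p + qre p)%:A.
Proof.
by apply: quatP; rewrite !(qcoordA, qcoordD, qcoord_conj) /qre; split; ring.
Qed.

Lemma sphere_poly_pt I J x y z : imag_units I -> imag_units J -> cline J z ->
  sphere_poly (slice_pt I x y) z = (z - slice_pt J x y) * (z - qconj (slice_pt J x y)).
Proof.
move=> hI hJ Lz; rewrite /sphere_poly.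
have E : slice_pt I x y + qconj (slice_pt I x y) = slice_pt J x y + qconj (slice_pt J x y).
  by rewrite !addq_conj !qre_pt.
have E' : slice_pt I x y * qconj (slice_pt I x y) = slice_pt J x y * qconj (slice_pt J x y).
  by rewrite !qmul_conj -!sqr_qnorm !sqr_norm_pt.
rewrite E E'; set a := slice_pt J x y; have La : cline J a by exact: cline_pt.
rewrite mulrBl !mulrBr mulrDr (cline_comm hJ La Lz).
move: (z * z) (z * a) (z * qconj a) (a * qconj a) => x1 x2 x3 x4.
by apply: quatP; rewrite !qcoordE; split; ring.
Qed.

Lemma sphere_poly_line p J z : imag_units J -> cline J z -> cline J (sphere_poly p z).
Proof.
move=> hJ Lz; rewrite /sphere_poly addq_conj qmul_conj.
apply: clineD => //; last by exact: clineA.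
by apply: clineB => //; [exact: clineM|apply: clineM => //; exact: clineA].
Qed.

Lemma sphere_poly_conj p z : qconj (sphere_poly p z) = sphere_poly p (qconj z).
Proof.
rewrite /sphere_poly addq_conj qmul_conj qconjD qconjB !qconjM !qconjA.
by rewrite qscalarC.
Qed.

Section InDomain.
Variables (W : set H) (oW : open W) (sW : symmetric_set W).

Lemma eq_star f f' g q : regular W f -> regular W f' -> regular W g -> W q ->
  f q = f' q -> star W f g q = star W f' g q.
Proof.
move=> hf hf' hg Wq e; have [J [x [y [hJ _ qE]]]] := quat_slice q.
have Lq : cline J q by rewrite qE; exact: cline_pt.
by rewrite (starE oW sW hJ hf hg Wq Lq) (starE oW sW hJ hf' hg Wq Lq) e.
Qed.

Lemma star_linear_conj p q : W q -> star W (fun q => q - p) (fun q => q - qconj p) q = sphere_poly p q.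
Proof.
move=> Wq; have [J [x [y [hJ _ qE]]]] := quat_slice q.
have Lq : cline J q by rewrite qE; exact: cline_pt.
rewrite (starE oW sW hJ (linear_regular _ oW) (linear_regular _ oW) Wq Lq).
have E : q - p = (q - cpart J p) + (- apart J p).
  by rewrite -{1}(cpartDapart J p) opprD addrA.
have Lc := cpart_line p hJ.
have [||-> ->] := part_unique hJ E.
- exact: clineB.
- by rewrite mulNr apart_anti// mulrN.
have tw := anti_twist hJ (apart_anti p hJ) Lq.
have e1 : q * p = q * cpart J p + q * apart J p by rewrite -mulrDr cpartDapart.
have e2 : p * qconj p = cpart J p * qconj p + apart J p * qconj p.
  by rewrite -mulrDl cpartDapart.
rewrite mulNr !mulrBl !mulrBr tw (cline_comm hJ Lc Lq) /sphere_poly [q * (p + _)]mulrDr e1 e2.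
move: (q * q) (q * qconj p) (q * cpart J p) (q * apart J p) => x1 x2 x3 x4.
move: (cpart J p * qconj p) (apart J p * qconj p) => x5 x6.
by apply: quatP; rewrite !qcoordE; split; ring.
Qed.

(** Induction on m, applied to the regular product of q - \bar p and w. The power of the polynomial
    preserves slices and passes through the remaining factor q - p, which then meets q - \bar p and
    supplies one more factor of the polynomial. *)
Lemma star_pow_divide p m w : regular W w -> exists2 g, regular W g &
  forall q, W q -> star W (star_pow [set: H] (fun q => q - p) m) g q = sphere_poly p q ^+ m * w q.
Proof.
pose L := fun q : H => q - p; pose L' := fun q : H => q - qconj p.
have hL : regular W L by exact: linear_regular.
have hL' : regular W L' by exact: linear_regular.
have hP n : regular W (star_pow [set: H] L n).
  exact (regular_sub (@openT_quat R) oW (@subsetT _ W) (star_pow_regular p n)).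
have hLT : regular [set: H] L by exact: linear_regular.
elim: m w => [|m IH] w hw.
  exists w => // q Wq; have [J [x [y [hJ _ qE]]]] := quat_slice q.
  have Lq : cline J q by rewrite qE; exact: cline_pt.
  rewrite (star_preserving oW sW hJ (hP 0%N) hw Wq Lq); last exact: cline1.
  by rewrite expr0.
have hY := star_regular oW sW hL' hw.
have [g hg gE] := IH _ hY; exists g => // q Wq.
have [J [x [y [hJ _ qE]]]] := quat_slice q.
have Lq : cline J q by rewrite qE; exact: cline_pt.
have Lq' := cline_conj hJ Lq; have Wq' := symmetric_conj sW Wq.
have hLP := star_regular oW sW hL (hP m).
(* The powers are formed on the whole space; their recursion is carried over to W, where the two
   products have the same values. *)
have E0 : star_pow [set: H] L m.+1 q = star W L (star_pow [set: H] L m) q.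
  rewrite /star_pow iterS -/(star_pow _ _ m).
  rewrite (starE oW sW hJ hL (hP m) Wq Lq).
  exact (starE (@openT_quat R) (@symmetricT R) hJ hLT (star_pow_regular p m) (Logic.I : [set: H] q) Lq).
rewrite (eq_star (hP m.+1) hLP hg Wq E0) (starA oW sW hL (hP m) hg Wq).
have hPg := star_regular oW sW (hP m) hg.
rewrite (starE oW sW hJ hL hPg Wq Lq) !gE//.
have Ld : cline J (sphere_poly p q ^+ m) by apply: clineX => //; exact: sphere_poly_line.
have tw := anti_twist hJ (apart_anti (L q) hJ) Ld.
rewrite qconjX sphere_poly_conj in tw.
rewrite !mulrA tw (cline_comm hJ (cpart_line (L q) hJ) Ld) -!mulrA -mulrDr.
rewrite -(starE oW sW hJ hL hY Wq Lq) -(starA oW sW hL hL' hw Wq).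
have hLL := star_regular oW sW hL hL'.
rewrite (star_preserving oW sW hJ hLL hw Wq Lq) star_linear_conj//; last exact: sphere_poly_line.
by rewrite mulrA -exprSr.
Qed.

End InDomain.

Section Symm.
Variables (W : set H) (dW : symmetric_slice_domain W) (f : H -> H).
Hypotheses (hf : regular W f) (f0 : exists2 q, W q & f q != 0).
Let sW : symmetric_set W. Proof. by case: dW. Qed.
Let oW : open W. Proof. by case: dW => _ []. Qed.
Local Notation fs := (symmetrization W f).
Let hfs : regular W fs. Proof. exact: symmetrization_regular. Qed.

Let fsm J z : imag_units J -> W z -> cline J z -> slice_smooth J fs z.
Proof. by move=> hJ Wz Lz; exact ((regularP _ oW).1 hfs J z hJ Wz Lz). Qed.

Variables (I : H) (x y : R) (hI : imag_units I).
Local Notation p := (slice_pt I x y).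
Hypothesis Zp : zeros W fs p.
Variables (m : nat) (a : nat -> H) (B C : R).
Hypotheses (ht : taylor I fs p a B C) (a0 : forall j, (j < m)%N -> a j = 0) (am : a m != 0).

Let Lp : cline I p. Proof. exact: cline_pt. Qed.
Let Wp : W p. Proof. by case: Zp. Qed.
Let fp0 : fs p = 0. Proof. by case: Zp. Qed.

Let m_gt0 : (0 < m)%N.
Proof.
rewrite lt0n; apply: contra_neqN am => /eqP ->.
by rewrite -(taylor_value hI Lp ht).
Qed.

(* The norm of fs does not depend on the slice, hence neither does its order of
   vanishing along the sphere through p. *)
Lemma sphere_taylor J : imag_units J -> exists b B' C',
  taylor J fs (slice_pt J x y) b B' C' /\ forall j, (j < m)%N -> b j = 0.
Proof.
move=> hJ; have Wj : W (slice_pt J x y) by exact: domain_pt Wp.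
have [b [B' [C' hb]]] := open_taylor hJ oW Wj (cline_pt J x y) (fun z => @fsm J z hJ).
exists b, B', C'; split=> //.
have [M [d [d0 gr]]] := growth_divp hI Lp ht a0.
have [d' d'0 hd'] := open_near oW Wp.
apply: (@growth_taylor R J fs _ b B' C' M (Num.min d d')) hb _ => //; first exact: cline_pt.
  by rewrite lt_min d0.
move=> z [[x' [y' ->]] zd]; rewrite -/(slice_pt J x' y') in zd *.
have sub K (s t s' t' : R) : slice_pt K s t - slice_pt K s' t' = slice_pt K (s - s') (t - t') :> H.
  by rewrite /slice_pt opprD addrACA -!scalerBl.
have E : N (slice_pt J x' y' - slice_pt J x y) = N (slice_pt I x' y' - p).
  by apply/eqP; rewrite !sub -(@eqrXn2 _ 2)// ?qnorm_ge0// !sqr_norm_pt.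
rewrite E in zd *; move: zd; rewrite lt_min => /andP[z0 /andP[z1 z2]].
have Wz := hd' _ z2.
rewrite (preserving_norm dW hfs _ hI hJ Wz); last by move=> K u hK; exact: symmetrization_line.
by apply: gr; split; [exact: cline_pt|rewrite z0].
Qed.

Lemma eq_smooth_line J K F q : (forall z, cline J z <-> cline K z) ->
  slice_smooth J F q -> slice_smooth K F q.
Proof.
move=> JK [D hD]; exists D => e /hD[d d0 h]; exists d => // z1 z2 L1 L2.
by apply: h; apply/JK.
Qed.

Lemma real_divide : y = 0 -> exists2 w, regular W w &
  forall q, W q -> fs q = (q - p) ^+ m * w q.
Proof.
move=> y0; have pE : p = x%:A by rewrite /slice_pt y0 scale0r addr0.
have LpJ J : imag_units J -> cline J p by move=> hJ; rewrite pE; exact: clineA.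
pose P q := (q - p) ^+ m.
have P0 q : P q = 0 <-> q = p.
  split=> [/eqP|->]; rewrite /P; last by rewrite subrr expr0n gtn_eqF.
  by rewrite expq_eq0 m_gt0 subr_eq0 => /eqP.
have hP J z : imag_units J -> W z -> cline J z -> slice_smooth J P z.
  by move=> hJ Wz Lz; exact: (slice_smoothX m hJ Lz (LpJ J hJ)).
have PL J z : imag_units J -> cline J z -> cline J (P z).
  by move=> hJ Lz; apply: clineX => //; apply: clineB => //; exact: LpJ.
have [||w hw wE] := @removable_quotient R W P fs oW hP.
- move=> J z hJ Wz Lz Pz; apply: slice_smoothM => //.
  + by apply: slice_smoothV => //; [exact: hP|exists 1 => // v Lv _; exact: PL].
  + exact: fsm.
  + by exists 1 => // v Lv _; apply: clineV => //; exact: PL.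
(* A real p lies on every slice, so the leading coefficient on the slice of I has to be the leading
   coefficient on all the others. *)
- move=> q Wq /P0 ->; exists (a m) => J hJ _; split; last first.
    exists 1 => // z [_ /andP[zp _]]; apply: contraTneq zp => /P0 ->.
    by rewrite subrr qnorm0 ltxx.
  have [b [B' [C' [hb b0]]]] := sphere_taylor hJ.
  have pJ : slice_pt J x y = p by rewrite pE /slice_pt y0 scale0r addr0.
  rewrite pJ in hb.
  have sI := divp_smooth hI oW (fun z => @fsm I z hI) Lp ht a0 Wp Lp.
  have sJ := divp_smooth hJ oW (fun z => @fsm J z hJ) (LpJ J hJ) hb b0 Wp (LpJ J hJ).
  (* Both are the limit of (z - p)^(-m) fs z along the real axis. *)
  suff <- : b m = a m by [].
  apply/eqP; rewrite -subr_eq0 -qnorm_eq0 eq_le qnorm_ge0 andbT.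
  apply/ler_addgt0Pr => e e0; rewrite add0r.
  have e2 : 0 < e / 2 by rewrite divr_gt0.
  have [d1 d10 h1] := slice_smooth_continuous hI Lp sI e2.
  have [d2 d20 h2] := slice_smooth_continuous hJ (LpJ J hJ) sJ e2.
  pose t : R := Num.min d1 d2 / 2.
  have t0 : 0 < t by rewrite divr_gt0// lt_min d10.
  have td : t < Num.min d1 d2 by move: t0; rewrite /t; lra.
  move: td; rewrite lt_min => /andP[td1 td2].
  pose z : H := p + t%:A.
  have zp : z - p = t%:A by rewrite /z addrAC subrr add0r.
  have zn : N (z - p) = t by rewrite zp qnormZ qnorm1 mulr1 gtr0_norm.
  have zne : z != p by rewrite -subr_eq0 -qnorm_gt0 zn.
  have Lz K : imag_units K -> cline K z by move=> hK; apply: clineD => //; [exact: LpJ|exact: clineA].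
  have := h1 z (Lz I hI); have := h2 z (Lz J hJ); rewrite zn => /(_ td2) H2 /(_ td1) H1.
  rewrite !(divpE _ _ _ zne) in H1 H2; rewrite /divp !eqxx in H1 H2.
  have := ler_distqD ((z - p) ^- m * fs z) (b m) (a m); rewrite (qdistC (b m) (_ * _)); lra.
- exists w => // q Wq; have [/P0 ->|Pq] := eqVneq (P q) 0.
    by rewrite fp0 subrr expr0n gtn_eqF// mul0r.
  by rewrite wE// mulrA mulqV// mul1r.
Qed.

(** On the slice of J the polynomial vanishes at x + J y and x - J y only. Near either point one
    factor is divided out of f^s by [divp], and the other is invertible. *)
Lemma nonreal_divide : y != 0 -> exists2 w, regular W w &
  forall q, W q -> fs q = sphere_poly p q ^+ m * w q.
Proof.
move=> y0; pose P q := sphere_poly p q ^+ m.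
have PE J z : imag_units J -> cline J z ->
    P z = (z - slice_pt J x y) ^+ m * (z - qconj (slice_pt J x y)) ^+ m.
  move=> hJ Lz; rewrite /P (sphere_poly_pt _ _ hI hJ Lz) exprMn_comm//.
  by apply: (cline_comm hJ); apply: clineB => //; [|apply: cline_conj => //]; exact: cline_pt.
have P0 J z : imag_units J -> cline J z ->
    P z = 0 <-> z = slice_pt J x y \/ z = slice_pt (- J) x y.
  move=> hJ Lz; have -> : slice_pt (- J) x y = qconj (slice_pt J x y).
    by rewrite qconj_pt// /slice_pt scaleNr scalerN.
  rewrite (PE J z hJ Lz); split=> [/eqP|[->|->]]; last 2 first.
  - by rewrite subrr expr0n gtn_eqF// mul0r.
  - by rewrite subrr expr0n gtn_eqF// mulr0.
  by rewrite mulq_eq0 !expq_eq0 m_gt0 !subr_eq0/= => /orP[/eqP ->|/eqP ->]; [left|right].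
have hP J z : imag_units J -> W z -> cline J z -> slice_smooth J P z.
  move=> hJ Wz Lz; have Lpj := cline_pt J x y.
  apply: (@slice_smooth_near _ _ (fun z => (z - slice_pt J x y) ^+ m * (z - qconj (slice_pt J x y)) ^+ m)) => //.
    by exists 1 => // v Lv _; rewrite (PE J v hJ Lv).
  apply: slice_smoothM => //.
  - exact: slice_smoothX.
  - by apply: slice_smoothX => //; exact: cline_conj.
  - by exists 1 => // v Lv _; apply: clineX => //; exact: clineB.
have PL J z : imag_units J -> cline J z -> cline J (P z).
  by move=> hJ Lz; apply: clineX => //; exact: sphere_poly_line.
have [||w hw wE] := @removable_quotient R W P fs oW hP.
- move=> J z hJ Wz Lz Pz; apply: slice_smoothM => //.
  + by apply: slice_smoothV => //; [exact: hP|exists 1 => // v Lv _; exact: PL].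
  + exact: fsm.
  + by exists 1 => // v Lv _; apply: clineV => //; exact: PL.
- move=> q Wq Pq; have [J0 [x' [y' [hJ0 _ qE0]]]] := quat_slice q.
  have Lq0 : cline J0 q by rewrite qE0; exact: cline_pt.
  (* The sign of the unit is chosen so that q has the coordinates x and y of p. As q is not real,
     every slice through it is then the slice of J. *)
  have [J hJ qE] : exists2 J, imag_units J & q = slice_pt J x y.
    by have [->|->] := (P0 J0 q hJ0 Lq0).1 Pq; [exists J0|exists (- J0) => //; exact: imag_unitN].
  have [b [B' [C' [hb b0]]]] := sphere_taylor hJ.
  rewrite -qE in hb; have Lq : cline J q by rewrite qE; exact: cline_pt.
  have Lq' := cline_conj hJ Lq.
  have sJ := divp_smooth hJ oW (fun z => @fsm J z hJ) Lq hb b0 Wq Lq.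
  have qq' : q - qconj q != 0.
    rewrite subr_eq0 qE qconj_pt//; apply: contra_neq y0 => /(slice_pt_inj hJ)[_]; lra.
  exists (((q - qconj q) ^+ m)^-1 * b m) => K hK LKq.
  have JK z : cline J z <-> cline K z.
    have [s [t e]] := LKq.
    have E : y *: J = t *: K.
      by rewrite -(qim_pt x y hJ) -(qim_pt s t hK) -qE e.
    have tn : t != 0.
      apply: contra_neq y0 => t0; move/eqP: E; rewrite t0 scale0r scaler_eq0.
      by rewrite (negPf (imag_unit_neq0 hJ)) orbF => /eqP.
    have KE : K = (t^-1 * y) *: J by rewrite -scalerA E scalerA mulVf// scale1r.
    have JE : J = (y^-1 * t) *: K by rewrite -scalerA -E scalerA mulVf// scale1r.
    split=> -[s' [t' ->]]; apply: clineD; rewrite ?clineA//; first exact: clineA.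
    + by rewrite JE; apply/clineZ/clineZ => //; exact: clineI.
    + exact: clineA.
    + by rewrite KE; apply/clineZ/clineZ => //; exact: clineI.
  split; last first.
    exists (N (q - qconj q)) => [|z [Lz /andP[z0 zd]]]; first by rewrite qnorm_gt0.
    have Lz' : cline J z by apply/JK.
    rewrite (PE J z hJ Lz') -qE mulq_eq0 !expq_eq0 m_gt0 !subr_eq0/= negb_or; apply/andP; split.
      by rewrite -subr_eq0 -qnorm_gt0.
    by apply: contraTneq zd => ->; rewrite qdistC ltxx.
  apply: (eq_smooth_line JK).
  apply: (@slice_smooth_near _ _ (fun z => ((z - qconj q) ^+ m)^-1 * divp fs q m (b m) z)) => //.
    exists (N (q - qconj q)) => [|z Lz zd]; first by rewrite qnorm_gt0.
    have [->|zq] := eqVneq z q; first by rewrite /divp eqxx.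
    have zq' : z - qconj q != 0.
      by rewrite subr_eq0; apply: contraTneq zd => ->; rewrite qdistC ltxx.
    have zq0 : z - q != 0 by rewrite subr_eq0.
    rewrite divpE// (PE J z hJ Lz) -qE invrM ?unitq ?expq_eq0 ?(negPf zq') ?(negPf zq0) ?andbF//.
    by rewrite mulrA.
  apply: slice_smoothM => //; last first.
    by exists 1 => // v Lv _; apply: clineV => //; apply: clineX => //; exact: clineB.
  apply: slice_smoothV => //; first exact: slice_smoothX.
    by rewrite expq_eq0 (negPf qq') andbF.
  by exists 1 => // v Lv _; apply: clineX => //; exact: clineB.
- exists w => // q Wq; have [Pq|Pq] := eqVneq (P q) 0; last first.
    by rewrite wE// mulrA mulqV// mul1r.
  rewrite -/(P q) Pq mul0r; have [J0 [x' [y' [hJ0 _ qE0]]]] := quat_slice q.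
  have Lq0 : cline J0 q by rewrite qE0; exact: cline_pt.
  have [->|->] := (P0 J0 q hJ0 Lq0).1 Pq.
    by have [] := symmetrization_zeros_sphere dW hf hI hJ0 Zp.
  by have [] := symmetrization_zeros_sphere dW hf hI (imag_unitN hJ0) Zp.
Qed.

(** The multiplicity is meaningful only if a greatest exponent exists, and m is shown to be one. The
    division lemmas give the exponent m; an exponent n > m would make f^s of size N (z - p)^n on the
    slice, against [a m] being nonzero. *)
Lemma classical_mult_ge : (m <= classical_mult W fs p)%N.
Proof.
pose S := [set n | exists2 g, regular W g &
   forall q, W q -> fs q = star W (lin_pow p (Posz n)) g q].
have hP n : regular W (star_pow [set: H] (fun q => q - p) n).
  exact (regular_sub (@openT_quat R) oW (@subsetT _ W) (star_pow_regular p n)).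
have Sm : S m.
  have [y0|y0] := eqVneq y 0; last first.
    have [w hw wE] := nonreal_divide y0.
    have [g hg gE] := star_pow_divide oW sW p m hw.
    by exists g => // q Wq; rewrite wE// -gE.
  have [w hw wE] := real_divide y0; exists w => // q Wq.
  have [J [x' [y' [hJ _ qE]]]] := quat_slice q.
  have Lq : cline J q by rewrite qE; exact: cline_pt.
  have LpJ : cline J p by rewrite /slice_pt y0 scale0r addr0; exact: clineA.
  have E := star_pow_slice m hJ LpJ Lq.
  rewrite wE// -E; apply/esym; apply: (star_preserving oW sW hJ (hP m) hw Wq Lq).
  by rewrite E; apply: clineX => //; exact: clineB.
have Sle n : S n -> (n <= m)%N.
  move=> [g hg gE]; rewrite leqNgt; apply/negP => mn.
  have gz z : W z -> cline I z -> fs z = (z - p) ^+ n * g z.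
    move=> Wz Lz; have E := star_pow_slice n hI Lp Lz.
    rewrite gE// -E; apply: (star_preserving oW sW hI (hP n) hg Wz Lz).
    by rewrite E; apply: clineX => //; exact: clineB.
  have gp : slice_smooth I g p by exact ((regularP _ oW).1 hg I p hI Wp Lp).
  have [d d0 hd] := slice_smooth_continuous hI Lp gp ltr01.
  have [d' d'0 hd'] := open_near oW Wp.
  have gr z : pdisc I p (Num.min d d') z -> N (fs z) <= (N (g p) + 1) * N (z - p) ^+ n.
    move=> [Lz /andP[z0]]; rewrite lt_min => /andP[z1 z2].
    rewrite gz//; last exact: hd'.
    rewrite qnormM qnormX mulrC ler_wpM2r ?exprn_ge0 ?qnorm_ge0//.
    by have := hd z Lz z1; have := qnorm_dist_ge (g z) (g p); lra.
  have am0 : a m = 0.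
    by apply: (growth_taylor hI Lp _ ht gr) => //; rewrite lt_min d0.
  by move: am; rewrite am0 eqxx.
have gS : greatest S m by split.
have [Sk hk] : greatest S (classical_mult W fs p).
  by apply: (xgetPex 0%N (P := greatest S)); exists m.
exact: hk.
Qed.

End Symm.
End Multiplicity.

(** * The poles of the quotient *)

Section Main.
Variable R : realType.
Local Notation H := (quat R).
Local Notation N := (@qnorm R).
Variables (W : set H) (f g : H -> H) (dW : symmetric_slice_domain W).
Hypotheses (hf : regular W f) (hg : regular W g) (f0 : exists2 q, W q & f q != 0).
Local Notation fs := (symmetrization W f).
Local Notation W' := (W `\` zeros W fs).
Local Notation quot := (star W' (regrecip W f) g).
Let sW : symmetric_set W. Proof. by case: dW. Qed.
Let oW : open W. Proof. by case: dW => _ []. Qed.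
Let dW' : symmetric_slice_domain W'. Proof. exact: quotient_domain. Qed.
Let hq : regular W' quot. Proof. exact: quotient_regular. Qed.

(** The last clause ranges over all expansions because the one behind [pole_order] is not known
    explicitly. *)
Lemma quotient_pole p : zeros W fs p -> exists m, [/\
  exists2 a, laurent W' quot p a & principal_bound a m,
  (m <= classical_mult W fs p)%N &
  forall a n, laurent W' quot p a -> least (principal_bound a) n -> (n <= m)%N].
Proof.
move=> Zp; have [I [x [y [hI y0 pE]]]] := quat_slice p; rewrite pE in Zp *.
set P := slice_pt I x y in Zp *; have LP : cline I P by exact: cline_pt.
have [m [a [B [C [b [B' [C' [d [ht a0 am hv [d0 hd]]]]]]]]]] :=
  quotient_factor dW hf hg f0 hI Zp LP.
exists m; split.
- exists (laurent_coef b m); last exact: laurent_coef_bound.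
  have on_slice z : pdisc I P d z -> z != qconj P -> exists s t : H, [/\
      series (fun n => lin_pow P n%:Z z * laurent_coef b m n%:Z) @ \oo --> s,
      series (fun n => lin_pow P (- n.+1%:Z) z * laurent_coef b m (- n.+1%:Z)) @ \oo --> t &
      quot z = s + t].
    move=> zd zP; have [Lz /andP[z0 _]] := zd; have [Wz zC ->] := hd z zd.
    apply: (slice_laurent m hI LP hv Lz) => //.
    by rewrite -subr_eq0 -qnorm_gt0.
  move: y0; rewrite le_eqVlt => /predU1P[y0|y0].
    have PE : P = x%:A by rewrite /P /slice_pt -y0 scale0r addr0.
    rewrite PE in on_slice hd Zp *.
    apply: (laurent_real dW' hq _ hI d0); first by case=> _; apply.
    move=> z zd; have [Wz _ _] := hd z zd; split=> //; apply: on_slice => //.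
    have [_ /andP[z0 _]] := zd; rewrite qconjA.
    by rewrite -subr_eq0 -qnorm_gt0.
  (* A radius of at most y keeps the ball in the slice of p and away from the conjugate of p, which
     is at distance 2 y. *)
  exists (Num.min d y); have m0 : 0 < Num.min d y by rewrite lt_min d0.
  have ball q : punctured_sigma_ball P (Num.min d y) q -> pdisc I P d q /\ q != qconj P.
    move=> hq'; have Lq : cline I q.
      by apply: (punctured_ball_nonreal hI y0) hq'; rewrite ge_min lexx orbT.
    have [_ /andP[q0]] := (punctured_ball_line _ hI LP Lq).1 hq'.
    rewrite lt_min => /andP[q1 q2]; split; first by split=> //; rewrite q0.
    apply: contraTneq q2 => ->; rewrite -leNgt /P qconj_pt//.
    have -> : slice_pt I x (- y) - slice_pt I x y = slice_pt I 0 (- y - y).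
      by rewrite /slice_pt opprD addrACA subrr scale0r -scalerBl.
    have [_] := pt_coord_le 0 (- y - y) hI; apply: le_trans.
    by rewrite -opprD normrN ger0_norm; lra.
  split=> // q /ball[qd qP]; first by have [] := hd q qd.
  exact: on_slice.
- exact: (classical_mult_ge dW hf hI Zp ht a0 am).
- move=> c n hc hn.
  have [D hD] : slice_smooth I (fun z => (divp fs P m (a m) z)^-1 * star W (regconj W f) g z) P.
    by eexists; exact: taylor_smooth hI LP hv.
  have [d1 d10 h1] := slice_smooth_continuous hI LP (ex_intro _ D hD) ltr01.
  apply: (@laurent_order_le R W' quot I P c
    (N ((divp fs P m (a m) P)^-1 * star W (regconj W f) g P) + 1) (Num.min d d1) m n hI LP) hc hn.
    by rewrite lt_min d0.
  move=> z [Lz /andP[z0]]; rewrite lt_min => /andP[z1 z2].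
  have [|_ _ ->] := hd z; first by split=> //; rewrite z0.
  have zn : z - P != 0 by rewrite -qnorm_gt0.
  rewrite (mulrA ((z - P) ^+ m)) mulqV ?expq_eq0 ?(negPf zn) ?andbF// mul1r.
  have := h1 z Lz z2; have := qnorm_dist_ge ((divp fs P m (a m) z)^-1 * star W (regconj W f) g z)
    ((divp fs P m (a m) P)^-1 * star W (regconj W f) g P).
  lra.
Qed.

End Main.

Theorem proposition7p1 (R : realType) (Omega : set (quat R))
    (f g : quat R -> quat R)
    (hOmega : symmetric_slice_domain Omega)
    (hf : regular Omega f) (hg : regular Omega g)
    (hf0 : exists2 q, Omega q & f q != 0) :
  let fs := symmetrization Omega f in
  let Omega' := Omega `\` zeros Omega fs in
  let quotient := star Omega' (regrecip Omega f) g in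
  (forall p, zeros Omega fs p ->
     pole Omega' quotient p /\
     (pole_order Omega' quotient p <= classical_mult Omega fs p)%N) /\
  semiregular Omega Omega' quotient.
Proof.
move=> fs Omega' quotient.
have poles p : zeros Omega fs p -> pole Omega' quotient p /\
     (pole_order Omega' quotient p <= classical_mult Omega fs p)%N.
  move=> /(quotient_pole hOmega hf hg hf0)[m [[a ha bm] mk hle]].
  split; first by exists a => //; exists m.
  have ex : exists n, `[< principal_bound a n >] by exists m; apply/asboolP.
  have la : least (principal_bound a) (ex_minn ex).
    case: ex_minnP => n /asboolP bn nmin; split=> // k bk.
    by apply: nmin; apply/asboolP.
  (* The expansion just found, with its least bound, shows that the set in [pole_order] is
     inhabited, so the selected value belongs to it, possibly with another expansion c. *)
  have [c hc lc] : [set n | exists2 a, laurent Omega' quotient p a &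
      least (principal_bound a) n] (pole_order Omega' quotient p).
    by apply: xgetPex; exists (ex_minn ex), a.
  exact: leq_trans (hle _ _ hc lc) mk.
split=> //; split=> //.
- exact: quotient_domain.
- by move=> q [].
- exact: quotient_regular.
- move=> p [Wp nW]; left; apply: (poles p _).1.
  by apply: contrapT => nZ; apply: nW.
Qed.
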